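(* Let $T_0=\sigma'\mathbb{Q}=\{t\subset\mathbb{Q} : (t,<)\text{ is well ordered and }\max(t)\text{ exists}\}$, ordered by $t\prec s$ if $t$ is a proper initial segment of $s$. Then $JT_0$ is a weakly compactly generated Banach space not containing $\ell_1$, and its dual $JT_0^\ast$ does not admit any equivalent Kadec norm, although $JT_0^\ast$ admits an equivalent strictly convex norm.
   Context: A tree is a partially ordered set $(T,\prec)$ such that for every $t\in T$ the set $\{s\in T : s\prec t\}$ is well ordered by $\prec$. A chain is a totally ordered subset of $T$; a segment is a chain $\sigma$ such that whenever $s\prec t\prec u$ and $s,u\in\sigma$, then $t\in\sigma$. The James tree space $JT$ is the completion of $c_{00}(T)=\{f\in\mathbb{R}^T : f \text{ has finite support}\}$ under the norm $\|f\| = \sup \left(\sum_{i=1}^n \left(\sum_{t\in \sigma_i}f(t)\right)^2\right)^{1/2}$, the supremum running over all finite families of pairwise disjoint segments $\sigma_1,\ldots,\sigma_n$ of $T$. A Banach space is weakly compactly generated if it is the closed linear span of a weakly compact subset. ''Not containing $\ell_1$'' means having no subspace isomorphic to $\ell_1$. A norm is strictly convex if its unit sphere contains no nondegenerate segment; it is a Kadec norm if the weak topology and the norm topology coincide on its unit sphere. *)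

(* Defs.v *)
From HB Require Import structures.
From mathcomp Require Import all_boot all_order all_algebra finmap generic_quotient ring_quotient.
From mathcomp Require Import all_classical all_reals all_analysis ring.

Set Implicit Arguments.
Unset Strict Implicit.
Unset Printing Implicit Defensive.

Import Order.TTheory GRing.Theory Num.Theory.
Import numFieldNormedType.Exports.

Local Open Scope classical_set_scope.
Local Open Scope ring_scope.

Section dual_space.
Context {R : realType} (V : normedModType R).

Definition continuous_scalar : {pred V -> R^o} :=
  mem [set f : V -> R^o | scalar f /\ continuous f].

Lemma continuous_scalar_submod_closed : submod_closed continuous_scalar.
Proof.
split.
  rewrite inE /=; split; last by move=> x; exact: cvg_cst.
  by move=> a x y; rewrite /= mulr0 addr0.
move=> a f g; rewrite !inE /= => -[lf cf] [lg cg]; split.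
  move=> b x y; rewrite !fctE lf lg /=.
  rewrite /GRing.scale /=.
  by rewrite !mulrDr !mulrA (mulrC b a) !addrA; congr (_ + _); rewrite addrAC.
move=> x; apply: cvgD; last exact: cg.
by apply: cvgZ; [exact: cvg_cst|exact: cf].
Qed.

HB.instance Definition _ := GRing.isSubmodClosed.Build R (V -> R^o)
  continuous_scalar continuous_scalar_submod_closed.

Record dual := Dual {
  dual_fun :> V -> R^o;
  dual_funP : dual_fun \in continuous_scalar }.

HB.instance Definition _ := [isSub for dual_fun].
HB.instance Definition _ := [Choice of dual by <:].
HB.instance Definition _ := [SubChoice_isSubLmodule of dual by <:].

Lemma dual_scalar (f : dual) : scalar f.
Proof. by case: f => f /=; rewrite inE => -[]. Qed.

Lemma dual_continuous (f : dual) : continuous f.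
Proof. by case: f => f /=; rewrite inE => -[]. Qed.

HB.instance Definition _ (f : dual) :=
  GRing.isLinear.Build R V R^o *%R (dual_fun f) (dual_scalar f).

Lemma dualE (f g : dual) : (f =1 g) -> f = g.
Proof. by move=> fg; apply/val_inj/funext. Qed.

Definition dual_norm (f : dual) : R :=
  sup [set `|f x| | x in [set x : V | `|x| <= 1]].

Lemma dual_norm_has_sup (f : dual) :
  has_sup [set `|f x| | x in [set x : V | `|x| <= 1]].
Proof.
split; first by exists `|f 0|, 0 => //=; rewrite normr0.
have : bounded_near f (nbhs (0 : V)).
  by apply: continuous_linear_bounded; exact: dual_continuous.
move/(bounded_funP (f : {linear V -> R^o})) => /(_ 1)[M fM].
by exists M => _ [x /= x1 <-]; exact: fM.
Qed.

Lemma dual_norm_ub (f : dual) (x : V) : `|x| <= 1 -> `|f x| <= dual_norm f.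
Proof.
move=> x1; apply: sup_upper_bound; last by exists x.
exact: dual_norm_has_sup.
Qed.

Lemma dual_norm_le (f : dual) (M : R) :
  (forall x, `|x| <= 1 -> `|f x| <= M) -> dual_norm f <= M.
Proof.
move=> fM; apply: ge_sup; first by case: (dual_norm_has_sup f).
by move=> _ [x x1 <-]; exact: fM.
Qed.

Lemma dual_norm_ge0 (f : dual) : 0 <= dual_norm f.
Proof.
apply: le_trans (normr_ge0 (f 0)) _; apply: dual_norm_ub.
by rewrite normr0.
Qed.

Lemma dual_normD (f g : dual) : dual_norm (f + g) <= dual_norm f + dual_norm g.
Proof.
apply: dual_norm_le => x x1; apply: le_trans (ler_normD _ _) _.
by apply: lerD; exact: dual_norm_ub.
Qed.

Lemma dual_normZ (a : R) (f : dual) : dual_norm (a *: f) = `|a| * dual_norm f.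
Proof.
apply/eqP; rewrite eq_le; apply/andP; split.
  apply: dual_norm_le => x x1.
  by rewrite [leLHS]normrM ler_wpM2l ?dual_norm_ub.
have [->|a0] := eqVneq a 0; first by rewrite normr0 mul0r dual_norm_ge0.
rewrite mulrC -ler_pdivlMr ?normr_gt0//.
apply: dual_norm_le => x x1; rewrite ler_pdivlMr ?normr_gt0// mulrC -normrM.
exact: (dual_norm_ub (a *: f) x1).
Qed.

Lemma dual_norm_eq0 (f : dual) : dual_norm f = 0 -> f = 0.
Proof.
move=> f0; apply: dualE => x; change (f x = 0).
have [->|x0] := eqVneq x 0; first exact: linear0.
have nx0 : `|x| != 0 by rewrite normr_eq0.
have : `|f (`|x|^-1 *: x)| <= 0.
  by rewrite -f0 dual_norm_ub// normrZ normfV normr_id mulVf.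
rewrite normr_le0 linearZ /= => /eqP /(congr1 (fun y => `|x| * y)).
by rewrite /GRing.scale /= mulrA mulfV// mul1r mulr0.
Qed.

HB.instance Definition _ := Lmodule_isNormed.Build R dual
  dual_normD dual_normZ dual_norm_eq0.

End dual_space.

(** The carrier of [V], equipped below with the initial topology for all of its continuous
    linear functionals. *)
Definition weak {R : realType} (V : normedModType R) : Type := V.

Section weak_topology.
Context {R : realType} (V : normedModType R).

HB.instance Definition _ := Topological.copy (weak V)
  (sup_topology (fun f : dual V => Topological.class
    (initial_topology (f : V -> R^o)))).

Lemma weak_continuous (f : dual V) : continuous (f : weak V -> R^o).
Proof.
move=> x; apply: (@cvg_trans _ (nbhs ((f : initial_topology (f : V -> R^o) -> R^o) x))) => //.
have := (@cvg_sup V (dual V) (fun f : dual V => Topological.class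
  (initial_topology (f : V -> R^o))) (nbhs (x : weak V)) x _).1 (@cvg_id _ _) f.
move=> h A fA; apply: h; exact: (@initial_continuous V R^o (f : V -> R^o) x A fA).
Qed.

Definition linear_span (K : set V) : set V :=
  [set x | exists n (a : 'I_n -> R) (k : 'I_n -> V),
    (forall i, K (k i)) /\ x = \sum_(i < n) a i *: k i].

Definition weakly_compactly_generated :=
  exists K : set V,
    @compact (weak V) K /\ closure (linear_span K) = setT.

End weak_topology.

Section ell1_space.
Context {R : realType}.

Definition summable_seq : {pred nat -> R^o} :=
  mem [set a : nat -> R^o | cvgn (series (fun n => `|a n|))].

Lemma ell1_norm_seriesD (a b : nat -> R^o) :
  cvgn (series (fun n => `|a n|)) -> cvgn (series (fun n => `|b n|)) ->
  cvgn (series (fun n => `|(a + b) n|)).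
Proof.
move=> ca cb; apply: (@series_le_cvg _ _ (fun n => `|a n| + `|b n|)).
- by move=> n; exact: normr_ge0.
- by move=> n; apply: addr_ge0; exact: normr_ge0.
- by move=> n; exact: ler_normD.
exact: is_cvg_seriesD.
Qed.

Lemma ell1_norm_seriesZ (k : R) (a : nat -> R^o) :
  series (fun n => `|(k *: a) n|) = (fun n => `|k| * series (fun n => `|a n|) n).
Proof.
apply/funext => n; rewrite /series /= mulr_sumr.
by apply: eq_bigr => i _; rewrite normrM.
Qed.

Lemma summable_seq_submod_closed : submod_closed summable_seq.
Proof.
split.
  rewrite inE /=.
  rewrite (_ : series (fun n => `|(0 : nat -> R^o) n|) = cst 0); first exact: is_cvg_cst.
  by apply/funext => n; rewrite /series /= big1// => i _; rewrite normr0.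
move=> k a b; rewrite !inE /= => ca cb; apply: ell1_norm_seriesD => //.
by rewrite ell1_norm_seriesZ; apply: is_cvgMl_tmp.
Qed.

HB.instance Definition _ := GRing.isSubmodClosed.Build R (nat -> R^o)
  summable_seq summable_seq_submod_closed.

Record ell1 := Ell1 {
  ell1_fun :> nat -> R^o;
  ell1_funP : ell1_fun \in summable_seq }.

HB.instance Definition _ := [isSub for ell1_fun].
HB.instance Definition _ := [Choice of ell1 by <:].
HB.instance Definition _ := [SubChoice_isSubLmodule of ell1 by <:].

Lemma ell1_cvg (a : ell1) : cvgn (series (fun n => `|a n|)).
Proof. by case: a => a /=; rewrite inE. Qed.

Definition ell1_norm (a : ell1) : R := limn (series (fun n => `|a n|)).

Lemma ell1_normD (a b : ell1) : ell1_norm (a + b) <= ell1_norm a + ell1_norm b.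
Proof.
rewrite /ell1_norm -limD; [|exact: ell1_cvg|exact: ell1_cvg].
apply: ler_lim; [exact: ell1_cvg|by apply: is_cvgD; exact: ell1_cvg|].
apply: nearW => n; rewrite !fctE /series /= -big_split.
by apply: ler_sum => i _; exact: ler_normD.
Qed.

Lemma ell1_normZ (k : R) (a : ell1) : ell1_norm (k *: a) = `|k| * ell1_norm a.
Proof.
rewrite /ell1_norm; have -> : series (fun n => `|(k *: a)%R n|) =
    (fun n => `|k| * series (fun n => `|a n|) n) by exact: ell1_norm_seriesZ.
by apply: cvg_lim => //; apply: cvgMl_tmp; exact: ell1_cvg.
Qed.

Lemma ell1_norm_eq0 (a : ell1) : ell1_norm a = 0 -> a = 0.
Proof.
move=> a0; apply/val_inj/funext => n /=; change (a n = 0).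
have nd : nondecreasing_seq (series (fun n => `|a n|)).
  by apply: nondecreasing_series => *; exact: normr_ge0.
have := nondecreasing_cvgn_le nd (@ell1_cvg a) n.+1.
rewrite [X in _ <= X]a0 /series /= big_nat_recr//= => an.
apply/eqP; rewrite -normr_le0; apply: le_trans an; rewrite lerDr.
by apply: sumr_ge0 => *; exact: normr_ge0.
Qed.

HB.instance Definition _ := Lmodule_isNormed.Build R ell1
  ell1_normD ell1_normZ ell1_norm_eq0.

End ell1_space.
Arguments ell1 : clear implicits.

(** A linear isomorphism of l1 onto a subspace of [V] is a linear map into [V]
    which is bounded and bounded below. *)
Definition contains_ell1 {R : realType} (V : normedModType R) :=
  exists J : {linear ell1 R -> V}, exists c C : R,
    [/\ 0 < c, 0 < C & forall a, c * `|a| <= `|J a| <= C * `|a|].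

Section renorming.
Context {R : realType} (V : normedModType R).

(** Definiteness and nonnegativity of [N] follow from the lower bound. *)
Definition equivalent_norm (N : V -> R) :=
  [/\ forall x y, N (x + y) <= N x + N y,
      forall (a : R) x, N (a *: x) = `|a| * N x &
      exists c C : R, [/\ 0 < c, 0 < C & forall x, c * `|x| <= N x <= C * `|x|]].

Definition strictly_convex_norm (N : V -> R) :=
  forall x y, x != y ->
    ~ (forall t : R, 0 <= t <= 1 -> N ((1 - t) *: x + t *: y) = 1).

(** Used for norms [N] equivalent to the norm of [V], which have the same norm
    topology and the same weak topology as [V]. *)
Definition kadec_norm (N : V -> R) :=
  forall A : set V,
    (exists2 U : set V, open U & A = U `&` [set x | N x = 1]) <->
    (exists2 U : set V, @open (weak V) U & A = U `&` [set x | N x = 1]).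

End renorming.

Lemma cauchy_seqP {R : realType} {E : normedModType R} (u : nat -> E) :
  cauchy (u @ \oo) <->
  (forall e : R, 0 < e ->
    exists N, forall m n, (N <= m)%N -> (N <= n)%N -> `|u m - u n| < e).
Proof.
split=> [/cauchyP cu e e0|cu].
  have [x] := cu (e / 2) (divr_gt0 e0 (ltr0Sn _ _)).
  move=> [N _ Nu]; exists N => m n Nm Nn.
  rewrite (splitr e); have := Nu _ Nm; have := Nu _ Nn.
  rewrite /= -ball_normE /= => un um; rewrite -(subrKA x).
  by apply: le_lt_trans (ler_normD _ _) _; rewrite ltrD// distrC.
apply/cauchyP => e e0; have [N uN] := cu e e0.
exists (u N); exists N => // n /= Nn; rewrite -ball_normE /=.
exact: uN.
Qed.

Section completion.
Context {R : realType} (E : normedModType R).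
Local Open Scope quotient_scope.

Definition cauchy_sequences : {pred nat -> E} :=
  mem [set u : nat -> E | cauchy (u @ \oo)].

Lemma cauchy_sequences_submod_closed : submod_closed cauchy_sequences.
Proof.
split.
  rewrite inE /=; apply/cauchy_seqP => e e0.
  by exists 0%N => m n _ _; rewrite subrr normr0.
move=> a u v; rewrite !inE /= => /cauchy_seqP cu /cauchy_seqP cv.
apply/cauchy_seqP => e e0.
have a0 : 0 < `|a| + 1 by rewrite ltr_wpDl.
have [N1 uN] := cu (e / 2 / (`|a| + 1)) (divr_gt0 (divr_gt0 e0 (ltr0Sn _ _)) a0).
have [N2 vN] := cv (e / 2) (divr_gt0 e0 (ltr0Sn _ _)).
exists (maxn N1 N2) => m n; rewrite !geq_max => /andP[m1 m2] /andP[n1 n2].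
rewrite !fctE opprD addrACA -scalerBr (le_lt_trans (ler_normD _ _))//.
rewrite normrZ (splitr e) ltrD ?vN//.
have := uN _ _ m1 n1; rewrite ltr_pdivlMr//; apply: le_lt_trans.
by rewrite mulrC ler_wpM2l// lerDl.
Qed.

HB.instance Definition _ := GRing.isSubmodClosed.Build R (nat -> E)
  cauchy_sequences cauchy_sequences_submod_closed.

Record cauchy_sequence := CauchySequence {
  cauchy_seq_fun :> nat -> E;
  cauchy_seq_funP : cauchy_seq_fun \in cauchy_sequences }.

HB.instance Definition _ := [isSub for cauchy_seq_fun].
HB.instance Definition _ := [Choice of cauchy_sequence by <:].
HB.instance Definition _ := [SubChoice_isSubLmodule of cauchy_sequence by <:].

Lemma cauchy_sequence_cauchy (u : cauchy_sequence) : forall e : R, 0 < e ->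
  exists N, forall m n, (N <= m)%N -> (N <= n)%N -> `|u m - u n| < e.
Proof.
by apply/cauchy_seqP; case: u => u /=; rewrite inE.
Qed.

Definition null_sequences : {pred cauchy_sequence} :=
  mem [set u : cauchy_sequence | u n @[n --> \oo] --> (0 : E)].

Lemma null_sequences_zmod_closed : zmod_closed null_sequences.
Proof.
split; first by rewrite inE /=; exact: cvg_cst.
move=> u v; rewrite !inE /= => u0 v0.
by rewrite -(subrr 0); exact: cvgB.
Qed.

HB.instance Definition _ := GRing.isZmodClosed.Build cauchy_sequence
  null_sequences null_sequences_zmod_closed.

(** Cauchy sequences modulo null sequences, normed by [lim `|u n|] *)
Definition completion : Type := Quotient.quot null_sequences.

HB.instance Definition _ := GRing.Zmodule.on completion.
HB.instance Definition _ := EqQuotient.on completion.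

Definition completion_class (u : cauchy_sequence) : completion := \pi u.

Lemma completion_classP (u v : cauchy_sequence) :
  completion_class u = completion_class v <->
  u n - v n @[n --> \oo] --> (0 : E).
Proof.
rewrite /completion_class.
split.
  by move/eqP; rewrite -[_ == _]Quotient.idealrBE inE.
by move=> uv; apply/eqP; rewrite -[_ == _]Quotient.idealrBE inE.
Qed.

Lemma completion_classD (u v : cauchy_sequence) :
  completion_class (u + v) = completion_class u + completion_class v.
Proof. by rewrite /completion_class raddfD. Qed.

Lemma completion_class_repr (x : completion) : completion_class (repr x) = x.
Proof. exact: reprK. Qed.

Lemma completion_ind (P : completion -> Prop) :
  (forall u, P (completion_class u)) -> forall x, P x.
Proof. by move=> Pu x; rewrite -(completion_class_repr x). Qed.

Definition completion_scale (a : R) (x : completion) : completion :=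
  completion_class (a *: repr x).

Lemma completion_scaleE (a : R) (u : cauchy_sequence) :
  completion_scale a (completion_class u) = completion_class (a *: u).
Proof.
apply/completion_classP.
have /completion_classP h := completion_class_repr (completion_class u).
rewrite -(scaler0 _ a).
under eq_fun do rewrite -scalerBr.
by apply: cvgZ => //; exact: cvg_cst.
Qed.

Lemma completion_scaleA (a b : R) (x : completion) :
  completion_scale a (completion_scale b x) = completion_scale (a * b) x.
Proof. by elim/completion_ind: x => u; rewrite !completion_scaleE scalerA. Qed.

Lemma completion_scale1 : left_id 1 completion_scale.
Proof. by elim/completion_ind => u; rewrite completion_scaleE scale1r. Qed.

Lemma completion_scaleDr : right_distributive completion_scale +%R.
Proof.
move=> a; elim/completion_ind => u; elim/completion_ind => v.
by rewrite -completion_classD !completion_scaleE scalerDr completion_classD.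
Qed.

Lemma completion_scaleDl (x : completion) :
  {morph completion_scale^~ x : a b / a + b}.
Proof.
move=> a b; elim/completion_ind: x => u.
by rewrite !completion_scaleE scalerDl completion_classD.
Qed.

HB.instance Definition _ := GRing.Zmodule_isLmodule.Build R completion
  completion_scaleA completion_scale1 completion_scaleDr completion_scaleDl.

Lemma completion_classZ (a : R) (u : cauchy_sequence) :
  completion_class (a *: u) = a *: completion_class u.
Proof. by rewrite -completion_scaleE. Qed.

Definition completion_norm (x : completion) : R :=
  lim (`|repr x n| @[n --> \oo]).

Lemma cauchy_sequence_norm_cvg (u : cauchy_sequence) :
  cvg (`|u n| @[n --> \oo]).
Proof.
apply/cauchy_cvgP/(@cauchy_seqP R R^o) => e e0.
have [N uN] := cauchy_sequence_cauchy u e0.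
exists N => m n Nm Nn; apply: le_lt_trans (uN _ _ Nm Nn).
exact: ler_dist_dist.
Qed.

Lemma completion_normE (u : cauchy_sequence) :
  `|u n| @[n --> \oo] --> completion_norm (completion_class u).
Proof.
have /completion_classP h := completion_class_repr (completion_class u).
rewrite /completion_norm.
set r := repr _ in h *.
have rl := @cauchy_sequence_norm_cvg r.
rewrite -[lim _]addr0.
have hn : `|u n| - `|r n| @[n --> \oo] --> (0 : R).
  apply/norm_cvg0P.
  apply: (squeeze_cvgr (h := fun n => `|r n - u n|) (f := cst 0)).
  - near=> n; rewrite /= normr_ge0 /= -(distrC (u n)).
    exact: ler_dist_dist.
  - exact: cvg_cst.
  - by rewrite -(normr0 E); apply: cvg_norm.
rewrite (_ : (fun n => `|u n|) = (fun n => `|r n| + (`|u n| - `|r n|))).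
  exact: cvgD.
by apply/funext => n; rewrite addrC subrK.
Unshelve. all: by end_near. Qed.

Lemma completion_normD (x y : completion) :
  completion_norm (x + y) <= completion_norm x + completion_norm y.
Proof.
elim/completion_ind: x => u; elim/completion_ind: y => v.
rewrite -completion_classD.
apply: (ler_cvg_to (@completion_normE (u + v))
  (cvgD (@completion_normE u) (@completion_normE v))).
by apply: nearW => n; exact: ler_normD.
Qed.

Lemma completion_normZ (a : R) (x : completion) :
  completion_norm (a *: x) = `|a| * completion_norm x.
Proof.
elim/completion_ind: x => u; rewrite -completion_classZ.
apply: (cvg_unique _ (@completion_normE (a *: u))) => //.
rewrite (_ : (fun n => _) = (fun n => `|a| * `|u n|)).
  by apply: cvgMl_tmp; exact: completion_normE.
by apply/funext => n; rewrite -normrZ.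
Qed.

Lemma completion_norm_eq0 (x : completion) : completion_norm x = 0 -> x = 0.
Proof.
elim/completion_ind: x => u u0; rewrite -(raddf0 (\pi_completion)).
apply/completion_classP; under eq_fun do rewrite subr0.
by apply/norm_cvg0P; rewrite -u0; exact: completion_normE.
Qed.

HB.instance Definition _ := Lmodule_isNormed.Build R completion
  completion_normD completion_normZ completion_norm_eq0.

Lemma cst_cauchy_sequence (x : E) : (fun=> x) \in cauchy_sequences.
Proof.
rewrite inE; apply/cauchy_seqP => e e0.
by exists 0%N => m n _ _; rewrite subrr normr0.
Qed.

Definition to_completion (x : E) : completion :=
  completion_class (CauchySequence (cst_cauchy_sequence x)).

Lemma to_completion_linear : linear to_completion.
Proof.
move=> a x y; rewrite /to_completion -completion_classZ -completion_classD.
by congr completion_class; apply/val_inj.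
Qed.

HB.instance Definition _ := GRing.isLinear.Build R E completion *:%R
  to_completion to_completion_linear.

Lemma to_completion_norm (x : E) : `|to_completion x| = `|x|.
Proof.
change (completion_norm (to_completion x) = `|x|).
have := @completion_normE (CauchySequence (cst_cauchy_sequence x)).
move/cvg_lim => <- //; apply: cvg_lim; first by [].
exact: (@cvg_cst R `|x|).
Qed.

Lemma to_completion_close (u : cauchy_sequence) (e : R) (N : nat) :
  (forall m n, (N <= m)%N -> (N <= n)%N -> `|u m - u n| < e) ->
  forall n, (N <= n)%N -> `|completion_class u - to_completion (u n)| <= e.
Proof.
move=> uN n Nn; rewrite -[- _]scaleN1r -completion_classZ.
rewrite -completion_classD.
apply: (ler_cvg_to (@completion_normE _) (@cvg_cst _ e _ _ _)).
exists N => // m /= Nm; apply/ltW.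
by have := uN _ _ Nm Nn; rewrite scaleN1r.
Qed.

Lemma to_completion_approx (x : completion) (e : R) : 0 < e ->
  exists y : E, `|x - to_completion y| <= e.
Proof.
elim/completion_ind: x => u e0.
have [N uN] := cauchy_sequence_cauchy u e0.
by exists (u N); exact: (to_completion_close uN).
Qed.

Lemma to_completion_dense : closure (range to_completion) = setT.
Proof.
apply/seteqP; split=> // x _ A /nbhs_ballP[e /= e0 eA].
have [y xy] := to_completion_approx x (divr_gt0 e0 (ltr0Sn _ 1)).
exists (to_completion y); split; first by exists y.
apply: eA; rewrite -ball_normE /=; apply: le_lt_trans xy _.
by rewrite ltr_pdivrMr// ltr_pMr// ltr1n.
Qed.

Lemma completion_complete (F : set_system completion) :
  ProperFilter F -> cauchy F -> cvg F.
Proof.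
move=> FF /cauchyP cF.
have /choice[w wP] : forall k : nat, exists w : E,
    F (ball (to_completion w) (k.+1%:R^-1 : R)).
  move=> k; have k0 : (0 : R) < k.+1%:R^-1 / 2.
    by rewrite divr_gt0// invr_gt0.
  have [x Fx] := cF _ k0; have [w xw] := to_completion_approx x k0.
  exists w; apply: filterS Fx => z; rewrite -ball_normE /= => xz.
  rewrite -(subrKA x) (splitr k.+1%:R^-1).
  by apply: le_lt_trans (ler_normD _ _) _; rewrite ler_ltD// distrC.
have ww k l : `|w k - w l| < k.+1%:R^-1 + l.+1%:R^-1.
  have [z] := filter_ex (filterI (wP k) (wP l)).
  rewrite -!ball_normE /= => -[kz lz].
  rewrite -to_completion_norm linearB /= -(subrKA z).
  by apply: le_lt_trans (ler_normD _ _) _; rewrite ltrD// distrC.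
have small (e : R) : 0 < e -> exists N, forall n, (N <= n)%N -> n.+1%:R^-1 < e.
  move=> e0; exists (Num.truncn e^-1) => n Nn.
  rewrite invf_plt ?posrE// (lt_le_trans (truncnS_gt _))//.
  by rewrite ler_nat ltnS.
have wc : w \in cauchy_sequences.
  rewrite inE; apply/cauchy_seqP => e e0.
  have [N Ne] := small _ (divr_gt0 e0 (ltr0Sn _ 1)).
  exists N => m n Nm Nn; apply: lt_trans (ww m n) _.
  by rewrite (splitr e) ltrD// Ne.
pose u := CauchySequence wc.
apply/cvg_ex; exists (completion_class u).
apply/cvgrPdist_le => e e0.
have e20 : 0 < e / 2 by rewrite divr_gt0.
have [N uN] := cauchy_sequence_cauchy u e20.
have [M Me] := small _ e20.
have := wP (maxn N M); apply: filterS => z.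
rewrite -ball_normE /= => wz; rewrite -(subrKA (to_completion (w (maxn N M)))).
apply: le_trans (ler_normD _ _) _; rewrite (splitr e) lerD//.
  exact: (to_completion_close uN (leq_maxl _ _)).
by apply/ltW/(lt_trans wz)/Me; exact: leq_maxr.
Qed.

HB.instance Definition _ := Uniform_isComplete.Build completion
  completion_complete.

End completion.

Section trees.
Context {d : Order.disp_t} {T : porderType d}.
Implicit Types (A B s : set T).

Definition well_ordered A :=
  forall B, B `<=` A -> B !=set0 ->
    exists2 m, B m & forall x, B x -> (m <= x)%O.

Definition chain A := forall x y, A x -> A y -> (x >=< y)%O.

Definition segment s :=
  chain s /\ forall x y z, s x -> s z -> (x < y)%O -> (y < z)%O -> s y.

Lemma segment1 (t : T) : segment [set t].
Proof.
split=> [_ _ -> ->|x y z -> -> ty yt]; first exact: comparablexx.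
by have := lt_trans ty yt; rewrite ltxx.
Qed.

End trees.

Definition is_tree {d : Order.disp_t} (T : porderType d) :=
  forall t : T, well_ordered [set s | (s < t)%O].

Section finitely_supported.
Context {R : realType} {T : choiceType}.

Definition finitely_supported : {pred T -> R^o} :=
  mem [set f : T -> R^o | finite_set (f @^-1` [set~ 0])].

Lemma finitely_supported_submod_closed : submod_closed finitely_supported.
Proof.
split.
  rewrite inE /= (_ : _ @^-1` _ = set0); first exact: finite_set0.
  by apply/seteqP; split=> // t; apply.
move=> a f g; rewrite !inE /= => ff fg.
have : finite_set ((f @^-1` [set~ 0]) `|` (g @^-1` [set~ 0])).
  by rewrite finite_setU.
apply: sub_finite_set => t /= afg0.
have [ft0|] := pselect (f t = 0); last by left.
by right=> gt0; apply: afg0; rewrite !fctE ft0 gt0 scaler0 addr0.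
Qed.

HB.instance Definition _ := GRing.isSubmodClosed.Build R (T -> R^o)
  finitely_supported finitely_supported_submod_closed.

End finitely_supported.

Section c00_space.
Context (R : realType) {d : Order.disp_t} (T : porderType d).

Record c00 := C00 {
  c00_fun :> T -> R^o;
  c00_funP : c00_fun \in finitely_supported }.

HB.instance Definition _ := [isSub for c00_fun].
HB.instance Definition _ := [Choice of c00 by <:].
HB.instance Definition _ := [SubChoice_isSubLmodule of c00 by <:].

(** [\sum_(t \in s)] ranges over the points of [s] where [f] is nonzero, hence
    is a finite sum for [f : c00] even when [s] is infinite. *)
Definition set_sum (f : T -> R) (s : set T) : R := \sum_(t \in s) f t.

Definition l2_sum (f : T -> R) n (s : 'I_n -> set T) : R :=
  Num.sqrt (\sum_(i < n) set_sum f (s i) ^+ 2).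

Definition disjoint_segments n (s : 'I_n -> set T) :=
  (forall i, segment (s i)) /\ trivIset setT s.

(** Empty segments are allowed; they contribute 0. The set is bounded for
    [f : c00], see [jt_sums_has_sup] below. *)
Definition jt_sums (f : T -> R) : set R :=
  [set r | exists n (s : 'I_n -> set T), disjoint_segments s /\ r = l2_sum f s].

Definition jt_norm (f : c00) : R := sup (jt_sums f).

Lemma c00_finite (f : c00) : finite_set (f @^-1` [set~ 0]).
Proof. by case: f => f /=; rewrite inE. Qed.

Definition c00_supp (f : c00) : {fset T} := fset_set (f @^-1` [set~ 0]).

Lemma c00_supp0 (f : c00) t : t \notin c00_supp f -> f t = 0.
Proof.
rewrite /c00_supp in_fset_set; last exact: c00_finite.
by move=> h; apply: contrapT => ft; move/negP: h; apply; rewrite inE.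
Qed.

Lemma set_sumE (X : {fset T}) (f : T -> R) s :
  (forall t, t \notin X -> f t = 0) ->
  set_sum f s = \sum_(t <- X) (if t \in s then f t else 0).
Proof.
move=> f0; rewrite /set_sum fsbig_mkcond (@fsbigTE _ _ _ _ X).
  by apply: eq_bigr => t _; rewrite patchE.
by move=> t tX; rewrite patchE f0//; case: ifP.
Qed.

Lemma set_sumD (f g : c00) s :
  set_sum (f + g) s = set_sum f s + set_sum g s.
Proof.
pose X := (c00_supp f `|` c00_supp g)%fset.
have Xf t : t \notin X -> f t = 0.
  by rewrite in_fsetU negb_or => /andP[/c00_supp0].
have Xg t : t \notin X -> g t = 0.
  by rewrite in_fsetU negb_or => /andP[_ /c00_supp0].
rewrite !(@set_sumE X)//; last by move=> t tX; change (f t + g t = 0); rewrite Xf// Xg// addr0.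
by rewrite -big_split; apply: eq_bigr => t _ /=; case: ifP => // _; rewrite addr0.
Qed.

Lemma set_sumZ (a : R) (f : c00) s :
  set_sum (a *: f) s = a * set_sum f s.
Proof.
rewrite /set_sum mulr_fsumr.
by apply: eq_fsbigr.
Qed.

Lemma l2_triangle n (x y : 'I_n -> R) :
  Num.sqrt (\sum_i (x i + y i) ^+ 2) <=
  Num.sqrt (\sum_i x i ^+ 2) + Num.sqrt (\sum_i y i ^+ 2).
Proof.
set A := Num.sqrt (\sum_i x i ^+ 2); set B := Num.sqrt (\sum_i y i ^+ 2).
have A0 : 0 <= A by exact: sqrtr_ge0.
have B0 : 0 <= B by exact: sqrtr_ge0.
have AE : A ^+ 2 = \sum_i x i ^+ 2.
  by rewrite sqr_sqrtr// sumr_ge0// => i _; exact: sqr_ge0.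
have BE : B ^+ 2 = \sum_i y i ^+ 2.
  by rewrite sqr_sqrtr// sumr_ge0// => i _; exact: sqr_ge0.
suff CS : \sum_i x i * y i <= A * B.
  rewrite -(ler_sqr (sqrtr_ge0 _) (addr_ge0 A0 B0)) sqr_sqrtr; last first.
    by apply: sumr_ge0 => i _; exact: sqr_ge0.
  rewrite sqrrD AE BE; under eq_bigr do rewrite sqrrD.
  rewrite !big_split /= lerD2r lerD2l mulr2n.
  exact: lerD.
have zero (z : 'I_n -> R) : \sum_i z i ^+ 2 = 0 -> forall i, z i = 0.
  move=> /eqP; rewrite psumr_eq0; last by move=> i _; exact: sqr_ge0.
  by move/allP => z0 i; apply/eqP; rewrite -sqrf_eq0; apply: z0; rewrite mem_index_enum.
have [A00|A1] := eqVneq A 0.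
  rewrite A00 mul0r big1// => i _.
  by rewrite (zero x) ?mul0r// -AE A00 expr0n.
have [B00|B1] := eqVneq B 0.
  rewrite B00 mulr0 big1// => i _.
  by rewrite (zero y) ?mulr0// -BE B00 expr0n.
have AB0 : 0 < A * B by rewrite mulr_gt0// lt_neqAle eq_sym ?A1 ?B1.
rewrite -(ler_pM2l AB0) -(ler_pM2l (ltr0Sn R 1)).
apply: (@le_trans _ _ (\sum_i (x i ^+ 2 * B ^+ 2 + y i ^+ 2 * A ^+ 2))); last first.
  by rewrite big_split /= -!mulr_suml -AE -BE le_eqVlt; apply/orP; left; apply/eqP; ring.
rewrite !mulr_sumr; apply: ler_sum => i _; rewrite -subr_ge0.
rewrite [leRHS](_ : _ = (x i * B - y i * A) ^+ 2); first exact: sqr_ge0.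
by ring.
Qed.

Lemma jt_sums_ub (f : c00) r :
  jt_sums f r -> r <= \sum_(t <- c00_supp f) `|f t|.
Proof.
move=> [n [s [[_ /trivIsetP disj] ->]]].
set M := \sum_(t <- _) _.
have M0 : 0 <= M by apply: sumr_ge0 => t _; exact: normr_ge0.
have xM : \sum_(i < n) `|set_sum f (s i)| <= M.
  apply: (@le_trans _ _ (\sum_(i < n) \sum_(t <- c00_supp f)
      (if t \in s i then `|f t| else 0))).
    apply: ler_sum => i _; rewrite (set_sumE _ (@c00_supp0 f)).
    apply: le_trans (ler_norm_sum _ _ _) _.
    by apply: ler_sum => t _; case: ifP => // _; rewrite normr0.
  rewrite exchange_big /=; apply: ler_sum => t _.
  have [[i ti]|nti] := pselect (exists i, t \in s i).
    rewrite (bigD1 i)//= ti big1 ?addr0// => j ji; case: ifPn => // tj.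
    have := disj i j I I; rewrite eq_sym => /(_ ji) /seteqP[+ _] => /(_ t).
    by case; split; apply: set_mem.
  rewrite big1 ?normr_ge0// => i _; case: ifPn => // ti.
  by exfalso; apply: nti; exists i.
rewrite -(ler_sqr (sqrtr_ge0 _) M0) sqr_sqrtr; last first.
  by apply: sumr_ge0 => i _; exact: sqr_ge0.
set N := \sum_(i < n) `|set_sum f (s i)| in xM.
have N0 : 0 <= N by apply: sumr_ge0 => i _; exact: normr_ge0.
apply: (@le_trans _ _ (N ^+ 2)); last by rewrite ler_sqr.
rewrite expr2 {1}/N mulr_suml; apply: ler_sum => i _.
rewrite -real_normK ?num_real// expr2 ler_wpM2l//.
rewrite /N (bigD1 i)//= lerDl; apply: sumr_ge0 => j _; exact: normr_ge0.
Qed.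

Lemma jt_sums_has_sup (f : c00) : has_sup (jt_sums f).
Proof.
split; last by exists (\sum_(t <- c00_supp f) `|f t|) => r; exact: jt_sums_ub.
exists (l2_sum f (fun i : 'I_0 => set0)), 0%N, (fun=> set0); split => //.
by split=> [[]//|[]].
Qed.

Lemma jt_norm_ub (f : c00) n (s : 'I_n -> set T) :
  disjoint_segments s -> l2_sum f s <= jt_norm f.
Proof.
move=> ds; apply: sup_upper_bound; first exact: jt_sums_has_sup.
by exists n, s.
Qed.

Lemma jt_norm_le (f : c00) (M : R) :
  (forall n (s : 'I_n -> set T), disjoint_segments s -> l2_sum f s <= M) ->
  jt_norm f <= M.
Proof.
move=> fM; apply: ge_sup; first by case: (jt_sums_has_sup f).
by move=> _ [n [s [ds ->]]]; exact: fM.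
Qed.

Lemma jt_normD (f g : c00) : jt_norm (f + g) <= jt_norm f + jt_norm g.
Proof.
apply: jt_norm_le => n s ds; rewrite {1}/l2_sum.
under eq_bigr do rewrite set_sumD.
apply: le_trans (l2_triangle _ _) _.
by apply: lerD; exact: jt_norm_ub.
Qed.

Lemma l2_sumZ (a : R) (f : c00) n (s : 'I_n -> set T) :
  l2_sum (a *: f) s = `|a| * l2_sum f s.
Proof.
rewrite /l2_sum; under eq_bigr do rewrite set_sumZ exprMn.
by rewrite -mulr_sumr sqrtrM ?sqr_ge0// sqrtr_sqr.
Qed.

Lemma jt_norm_ge0 (f : c00) : 0 <= jt_norm f.
Proof.
apply: (@le_trans _ _ (l2_sum f (fun i : 'I_0 => set0))); first exact: sqrtr_ge0.
by apply: jt_norm_ub; split=> [[]//|[]].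
Qed.

Lemma jt_normZ (a : R) (f : c00) : jt_norm (a *: f) = `|a| * jt_norm f.
Proof.
apply/eqP; rewrite eq_le; apply/andP; split.
  apply: jt_norm_le => n s ds.
  by rewrite l2_sumZ ler_wpM2l ?jt_norm_ub.
have [->|a0] := eqVneq a 0; first by rewrite normr0 mul0r jt_norm_ge0.
rewrite mulrC -ler_pdivlMr ?normr_gt0//.
apply: jt_norm_le => n s ds; rewrite ler_pdivlMr ?normr_gt0// mulrC -l2_sumZ.
exact: jt_norm_ub.
Qed.

Lemma jt_norm_eq0 (f : c00) : jt_norm f = 0 -> f = 0.
Proof.
move=> f0; apply/val_inj/funext => t /=; change (f t = 0).
have ds : disjoint_segments (fun i : 'I_1 => [set t]).
  split=> [_|i j _ _ _]; first exact: segment1.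
  by rewrite !ord1.
have := jt_norm_ub f ds; rewrite f0 /l2_sum big_ord1 sqrtr_sqr.
by rewrite normr_le0 /set_sum fsbig_set1 => /eqP.
Qed.

HB.instance Definition _ := Lmodule_isNormed.Build R c00
  jt_normD jt_normZ jt_norm_eq0.

End c00_space.

(** The James tree space of [T], meant for [is_tree T] *)
Definition JT (R : realType) {d : Order.disp_t} (T : porderType d) :
  completeNormedModType R := completion (c00 R T).

Definition sigmaQ : Type :=
  {t : set rat | t \in
     [set t : set rat | well_ordered t /\ exists2 m, t m & forall x, t x -> x <= m]}.

Section sigmaQ_tree.
Implicit Types t s : sigmaQ.

HB.instance Definition _ := Choice.on sigmaQ.

Definition initial_segment (t s : set rat) :=
  t `<=` s /\ forall x y, s x -> t y -> x < y -> t x.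

Definition sigmaQ_lt t s : bool :=
  `[< initial_segment (val t) (val s) /\ val t <> val s >].

Lemma sigmaQ_lt_irr : irreflexive sigmaQ_lt.
Proof. by move=> t; apply/asboolPn => -[]. Qed.

Lemma sigmaQ_lt_trans : transitive sigmaQ_lt.
Proof.
move=> s t u /asboolP[[ts its] nts] /asboolP[[su isu] nsu].
apply/asboolP; split; first split.
- exact: subset_trans su.
- move=> x y ux ty xy; apply: (its x y) => //.
  by apply: (isu x y) => //; exact: ts.
- move=> tu; apply: nts; apply/seteqP; split => // x sx.
  by rewrite tu; exact: su.
Qed.

Fact sigmaQ_display : Order.disp_t. Proof. exact: Order.Disp tt tt. Qed.

HB.instance Definition _ := Order.Lt_isPOrder.Build sigmaQ_display sigmaQ
  sigmaQ_lt_irr sigmaQ_lt_trans.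

Lemma sigmaQ_ltE t s : (t < s)%O =
  `[< initial_segment (val t) (val s) /\ val t <> val s >].
Proof. by []. Qed.

Lemma sigmaQ_is_tree : is_tree sigmaQ.
Proof.
have maxP (t : sigmaQ) : exists2 m, val t m & forall x, val t x -> x <= m.
  by have := valP t; rewrite inE => -[].
have ini (t u : sigmaQ) : (t < u)%O -> initial_segment (val t) (val u).
  by move=> /asboolP[].
move=> u B Bu [b Bb].
have : well_ordered (val u) by have := valP u; rewrite inE => -[].
move=> /(_ [set m | exists2 t, B t & val t m /\ forall x, val t x -> x <= m]).
case.
- by move=> m [t /Bu /ini[tu _] [/tu]].
- by have [m bm mb] := maxP b; exists m, b.
move=> m [t0 Bt0 [t0m mt0]] mmin; exists t0 => // t Bt.
rewrite le_eqVlt; have [//|nt] := eqVneq t0 t; apply/asboolP; split; last first.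
  by move/val_inj => tt; rewrite tt eqxx in nt.
have [[t0u it0] [tu it]] := (ini _ _ (Bu _ Bt0), ini _ _ (Bu _ Bt)).
split=> [x t0x|x y tx t0y xy]; last by apply: (it0 x y) => //; exact: tu.
have [k tk kt] := maxP t.
have mk : m <= k by apply: mmin; exists t.
have := le_trans (mt0 _ t0x) mk; rewrite le_eqVlt => /orP[/eqP->//|xk].
by apply: (it x k) => //; exact: t0u.
Qed.

End sigmaQ_tree.

(* Main.v *)
From HB Require Import structures.
Require Import Defs.
From mathcomp Require Import all_boot all_order all_algebra finmap.
From mathcomp Require Import all_classical all_reals all_analysis ring lra.

Set Implicit Arguments.
Unset Strict Implicit.
Unset Printing Implicit Defensive.

Import Order.TTheory GRing.Theory Num.Theory.
Import numFieldNormedType.Exports.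

Local Open Scope classical_set_scope.
Local Open Scope ring_scope.

(** The nodes of the tree with a given maximum form an antichain, and there are
    countably many of them; on an antichain the James tree norm is the Hilbert
    norm. Hence for a functional [f] the family of the [f (JT_unit t)], [t] of a
    given maximum, is square summable with sum at most [`|f| ^+ 2]
    ([antichain_l2_le]). Scaling the unit vectors by factors tending to 0 with the
    rank of the maximum makes them a weakly null family, which together with 0 is
    a weakly compact set spanning a dense subspace ([JT_wcg]). Dually, the
    coefficients of a functional embed the dual into a Hilbert space, and adding
    the square of that Hilbert norm to the square of the dual norm gives a strictly
    convex norm ([JT_dual_strictly_convex]).

    The space of any tree contains no l1 ([JT_no_ell1]). The point is that every
    bounded sequence has absolutely convex combinations, as far out as desired,
    whose sums over all segments are uniformly small ([small_segment_comb]);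
    vectors chosen successively in this way are almost orthogonal
    ([norm_add_small]), so that the norm of a sum of [n] of them has order
    [sqrt n], which no l1 sequence allows. To find the combinations, take a maximal
    filter of convex sets containing the convex hulls of the tails of the sequence.
    Every segment functional has a limit [l] along it, and the difference of two
    vectors from a suitable member of the filter is small on all segments if the
    convergence to [l] is uniform up to a small error. What may prevent this are the jumps of [l], the limits of
    [l (Q `\` P)] as the path [P] grows to the path [Q]. The jumps are square
    summable because distinct paths have disjoint ends ([jumps_exist]); by the
    parallelogram identity a sum or difference of two halves, taken along disjoint
    subsequences, halves the sum of their squares ([tame_half]), so they may be
    assumed small. Then the convergence is uniform up to a small error on all paths
    ([paths_uniform]): along a single path by well-founded induction
    ([subpaths_step]), and in general because only finitely many paths carry nodes
    above which uniformity fails ([bad_paths_uniform]); both steps rest on taking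
    averages inside the filter ([averaging]).

    Suppose that the dual had an equivalent Kadec norm [N]. For a set [a] of
    rationals let [P_a] be the sum over the nodes which are initial segments of
    [a]. If [b_n] extends [a] by first adding [q_n], with distinct [q_n] above [a],
    the functionals [P_(b_n) - P_a] are sums over disjoint segments, hence weakly
    null, while their norms are at least 1. Therefore [N P_b] exceeds [N P_a] by a
    fixed positive amount whenever [b] extends [a] by first adding some [q] outside
    a finite set ([kadec_gap]). Choose a rational number [h a] in this gap, outside
    the finite set. Starting from the empty set and adding [h a] to [a] again and
    again, transfinitely, always yields a number larger than the previous ones, and
    the recursion never stops: this is absurd, as the rationals form a set
    ([no_gap_function]). *)

(** * Maximal filters of convex sets *)

Section convex_filters.
Context {R : realType} {E : lmodType R}.
Implicit Types (A B D : set E) (F : set (set E)).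

Definition is_convex A := forall x y (t : R),
  A x -> A y -> 0 <= t <= 1 -> A (t *: x + (1 - t) *: y).

Definition is_affine (p : E -> R) := forall x y (t : R),
  p (t *: x + (1 - t) *: y) = t * p x + (1 - t) * p y.

Record convex_filter F : Prop := ConvexFilter {
  cf_convex : forall D, F D -> is_convex D;
  cf_nonempty : forall D, F D -> D !=set0;
  cf_setI : forall A B, F A -> F B -> F (A `&` B) }.

(** For affine functions such a family plays the part of an ultrafilter: every
    bounded one has a limit along it. Unlike those of an ultrafilter, its members
    can be averaged. *)
Record convex_ultrafilter F : Prop := ConvexUltrafilter {
  cuf_filter : convex_filter F;
  cuf_max : forall A, is_convex A ->
    (forall D, F D -> (A `&` D) !=set0) -> F A }.

Lemma is_convexI A B : is_convex A -> is_convex B -> is_convex (A `&` B).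
Proof.
by move=> cA cB x y t [Ax Bx] [Ay By] t01; split; [exact: cA|exact: cB].
Qed.

Lemma is_convex_slab1 (p : E -> R) (l e : R) : is_affine p ->
  is_convex [set y | `|p y - l| <= e].
Proof.
move=> ap x y t /= Ax Ay /andP[t0 t1]; rewrite ap.
have -> : t * p x + (1 - t) * p y - l = t * (p x - l) + (1 - t) * (p y - l).
  by ring.
apply: le_trans (ler_normD _ _) _; rewrite !normrM (ger0_norm t0).
rewrite (@ger0_norm _ (1 - t)) ?subr_ge0//.
have -> : e = t * e + (1 - t) * e by ring.
by apply: lerD; apply: ler_wpM2l; rewrite ?subr_ge0.
Qed.

Lemma is_convex_slab (I : Type) (G : set I) (p : I -> E -> R) (l : I -> R)
    (e : R) : (forall i, is_affine (p i)) ->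
  is_convex [set y | forall i, G i -> `|p i y - l i| <= e].
Proof.
move=> ap x y t Ax Ay t01 i Gi.
exact: (@is_convex_slab1 (p i) (l i) e (ap i) x y t (Ax i Gi) (Ay i Gi) t01).
Qed.

Lemma cufS F A B : convex_ultrafilter F -> F A -> A `<=` B -> is_convex B -> F B.
Proof.
move=> [[_ F0 FI] Fmax] FA AB cB; apply: Fmax => // D FD.
have [x [Ax Dx]] := F0 _ (FI _ _ FA FD).
by exists x; split => //; exact: AB.
Qed.

Lemma convex_ultrafilter_exists (B : set (set E)) :
  B !=set0 -> (forall D, B D -> is_convex D) -> (forall D, B D -> D !=set0) ->
  (forall D1 D2, B D1 -> B D2 -> exists2 D3, B D3 & D3 `<=` D1 `&` D2) ->
  exists2 F, convex_ultrafilter F & B `<=` F.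
Proof.
move=> [B0 BB0] cB neB dB.
pose base : set (set E) := [set A | is_convex A /\ exists2 D, B D & D `<=` A].
have base_cf : convex_filter base.
  split; first by move=> D [].
    by move=> D [_ [D' /neB[x D'x] D'D]]; exists x; exact: D'D.
  move=> A1 A2 [cA1 [D1 BD1 D1A]] [cA2 [D2 BD2 D2A]]; split.
    exact: is_convexI.
  have [D3 BD3 D3s] := dB _ _ BD1 BD2; exists D3 => // x /D3s[? ?].
  by split; [exact: D1A|exact: D2A].
have Bbase : B `<=` base by move=> D BD; split; [exact: cB|exists D].
(* the empty family is allowed so that the empty chain has an upper bound *)
pose P F := F = set0 \/ (convex_filter F /\ B `<=` F).
have [F0 [PF0 maxF0]] : exists F, P F /\ forall G, F `<` G -> ~ P G.
  apply: Zorn_bigcup => C CP tot.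
  have [[G CG G0]|allempty] := pselect (exists2 G, C G & G !=set0); last first.
    left; apply/seteqP; split => // A [G CG GA]; exfalso; apply: allempty.
    by exists G => //; exists A.
  have filt G' A : C G' -> G' A -> convex_filter G' /\ B `<=` G'.
    by move=> /CP [->|].
  right; split; last first.
    by case: G0 => A GA D BD; exists G => //; apply: (filt _ _ CG GA).2.
  split.
  - by move=> D [G1 CG1 GD]; exact: (cf_convex (filt _ _ CG1 GD).1).
  - by move=> D [G1 CG1 GD]; exact: (cf_nonempty (filt _ _ CG1 GD).1).
  - move=> A1 A2 [G1 CG1 GA1] [G2 CG2 GA2].
    have [G12|G21] := tot _ _ CG1 CG2.
      exists G2 => //; apply: (cf_setI (filt _ _ CG2 GA2).1) => //.
      exact: G12.
    exists G1 => //; apply: (cf_setI (filt _ _ CG1 GA1).1) => //.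
    exact: G21.
have [F00|[cF BF]] := PF0.
  exfalso; apply: (maxF0 base); last by right.
  rewrite F00; split; first by [].
  by move=> /(_ B0 (Bbase _ BB0)).
exists F0 => //; split => // A cA meetA.
pose F1 : set (set E) := [set X | is_convex X /\ exists2 D, F0 D & A `&` D `<=` X].
have F01 : F0 `<=` F1.
  move=> D FD; split; first exact: (cf_convex cF).
  by exists D => // x [].
have F1A : F1 A by split => //; exists B0; [exact: BF|move=> x []].
apply: contrapT => nFA; apply: (maxF0 F1).
  by split => // /(_ _ F1A).
right; split; last by move=> D /BF /F01.
split; first by move=> D [].
  by move=> D [_ [D' /meetA[x D'x] D'D]]; exists x; exact: D'D.
move=> A1 A2 [cA1 [D1 BD1 D1A]] [cA2 [D2 BD2 D2A]]; split.
  exact: is_convexI.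
exists (D1 `&` D2); first exact: (cf_setI cF).
by move=> x [Ax [D1x D2x]]; split; [apply: D1A|apply: D2A].
Qed.

(** Sublevel sets of an affine function are convex, so maximality decides which
    of them belong to the filter; the limit is the infimum of their levels. *)
Lemma cuf_limit F (p : E -> R) D (M : R) : convex_ultrafilter F -> is_affine p ->
  F D -> (forall y, D y -> `|p y| <= M) ->
  exists l, forall e, 0 < e -> F [set y | `|p y - l| <= e].
Proof.
move=> cF ap FD pM; have [[cvF F0 FI] Fmax] := cF.
have cle r : is_convex [set y | p y <= r].
  move=> x y t /= px py /andP[t0 t1]; rewrite ap.
  have -> : r = t * r + (1 - t) * r by ring.
  by apply: lerD; apply: ler_wpM2l; rewrite ?subr_ge0.
have cge r : is_convex [set y | r <= p y].
  move=> x y t /= px py /andP[t0 t1]; rewrite ap.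
  have -> : r = t * r + (1 - t) * r by ring.
  by apply: lerD; apply: ler_wpM2l; rewrite ?subr_ge0.
pose S : set R := [set r | F [set y | p y <= r]].
have SM : S M.
  by apply: (cufS cF FD) => // y /pM /=; apply: le_trans; exact: ler_norm.
have lbS : lbound S (- M).
  move=> r Sr; have [y [Dy /= pr]] := F0 _ (FI _ _ FD Sr).
  by have := pM _ Dy; rewrite ler_norml => /andP[+ _] => /le_trans; exact.
have hS : has_inf S by split; [exists M|exists (- M)].
exists (inf S) => e e0.
have [r Sr rl] : exists2 r, S r & r < inf S + e.
  have [r Sr rl] := inf_adherent e0 hS; by exists r.
have Fge : F [set y | inf S - e <= p y].
  apply: Fmax => // D1 FD1; apply: contrapT => /set0P/negP; rewrite negbK => /eqP ne.
  have : S (inf S - e).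
    apply: (cufS cF FD1) => // y D1y /=; rewrite leNgt; apply/negP => py.
    have : ([set y | inf S - e <= p y] `&` D1) y by split => //=; exact: ltW.
    by rewrite ne.
  move=> /(ge_inf (ex_intro _ _ lbS)).
  by rewrite leNgt ltrBlDr ltrDl e0.
apply: (cufS cF (FI _ _ Sr Fge)) => [y /= [py1 py2]|].
  rewrite ler_norml lerBrDl py2 lerBlDl /=.
  by apply: le_trans py1 (ltW rl).
exact: is_convex_slab1.
Qed.

Section averaging.
Context (F : set (set E)) (I : Type) (p : I -> E -> R) (l : I -> R).
Hypotheses (cF : convex_ultrafilter F) (ap : forall i, is_affine (p i)).

Definition uniform_on (G : set I) (e : R) :=
  F [set y | forall i, G i -> `|p i y - l i| <= e].

Lemma uniform_onU G1 G2 e :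
  uniform_on G1 e -> uniform_on G2 e -> uniform_on (G1 `|` G2) e.
Proof.
move=> u1 u2; apply: (cufS cF (cf_setI (cuf_filter cF) u1 u2)).
  by move=> y [h1 h2] i [/h1|/h2].
exact: is_convex_slab.
Qed.

Lemma uniform_onS G1 G2 e1 e2 :
  G2 `<=` G1 -> e1 <= e2 -> uniform_on G1 e1 -> uniform_on G2 e2.
Proof.
move=> G21 e12 u1; apply: (cufS cF u1); last exact: is_convex_slab.
by move=> y h i /G21 /h /= hi; exact: le_trans hi e12.
Qed.

(** Choose [y_1, y_2, ...] successively in [D], each in the sets provided by
    [uGy] for the previous ones. An index [i] is then exceptional for at most one
    of them, so that this single error bounded by [M] is absorbed by a long
    average. *)
Lemma averaging (G : set I) (Gy : E -> set I) D (e M : R) :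
  F D -> 0 <= M ->
  (forall y i, D y -> G i -> `|p i y - l i| <= M) ->
  (forall y, D y -> uniform_on (Gy y) e) ->
  (forall y i, D y -> G i -> ~ Gy y i -> `|p i y - l i| <= e) ->
  forall e', e < e' -> uniform_on G e'.
Proof.
move=> FD M0 pM uGy good e' ee'.
have [[cvF F0 FI] Fmax] := cF.
apply: Fmax; first exact: is_convex_slab.
move=> D' FD'.
have FDD := FI _ _ FD FD'.
have [n nM] : exists n, M < n.+1%:R * (e' - e).
  exists (Num.truncn (M / (e' - e))).
  by rewrite -ltr_pdivrMr ?subr_gt0//; exact: truncnS_gt.
(* [v] is an average of [n.+1] vectors, [H] the set of the indices which are
   exceptional for one of them *)
have [v [H [[Dv D'v] uH vH]]] : exists v (H : set I),
    [/\ (D `&` D') v, uniform_on H e & forall i, G i ->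
    (H i -> n.+1%:R * `|p i v - l i| <= n.+1%:R * e + M) /\
    (~ H i -> n.+1%:R * `|p i v - l i| <= n.+1%:R * e)].
  elim: n {nM} => [|n [v [H [[Dv D'v] uH vH]]]].
    have [v [Dv D'v]] := F0 _ FDD.
    exists v, (Gy v); split => //; first exact: uGy.
    move=> i Gi; rewrite !mul1r; split => ?; last exact: good.
    have [Gv|nGv] := pselect (0 <= e).
      by apply: le_trans (pM _ _ Dv Gi) _; rewrite lerDr.
    exfalso; have [w [Hw Dw]] := F0 _ (FI _ _ (uGy _ Dv) FD).
    by apply: nGv; exact: le_trans (normr_ge0 _) (Hw i _).
  have [y [yH [Dy D'y]]] := F0 _ (FI _ _ uH FDD).
  pose t : R := n.+1%:R / n.+2%:R.
  have n2 : n.+2%:R != 0 :> R by rewrite pnatr_eq0.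
  have t01 : 0 <= t <= 1.
    by rewrite divr_ge0//= ler_pdivrMr// mul1r ler_nat.
  exists (t *: v + (1 - t) *: y), (H `|` Gy y); split.
  - by split; apply: cvF.
  - by apply: uniform_onU => //; exact: uGy.
  move=> i Gi; have [vH1 vH2] := vH i Gi.
  have est : n.+2%:R * `|p i (t *: v + (1 - t) *: y) - l i| <=
      n.+1%:R * `|p i v - l i| + `|p i y - l i|.
    rewrite ap -[n.+2%:R]normr_nat -[n.+1%:R in leRHS]normr_nat -!normrM.
    have -> : n.+2%:R * (t * p i v + (1 - t) * p i y - l i) =
        n.+1%:R * (p i v - l i) + (p i y - l i).
      by rewrite /t -[n.+2]addn1 natrD; field; rewrite -natr1 in n2; rewrite addrC.
    exact: ler_normD.
  have nS : n.+2%:R * e = n.+1%:R * e + e by rewrite -[n.+2]addn1 natrD mulrDl mul1r.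
  rewrite nS; split => [_|nHG].
    have [Hi|nHi] := pselect (H i).
      apply: le_trans est _; rewrite -addrA [e + M]addrC addrA.
      by apply: lerD; [exact: vH1|exact: yH].
    apply: le_trans est _.
    have [Gyi|nGyi] := pselect (Gy y i).
      have e0 : 0 <= e.
        have [w [Hw _]] := F0 _ (FI _ _ (uGy _ Dy) FD).
        exact: le_trans (normr_ge0 _) (Hw i _).
      rewrite -addrA; apply: lerD; first exact: vH2.
      by apply: le_trans (pM _ _ Dy Gi) _; rewrite lerDr.
    rewrite -addrA; apply: lerD; first exact: vH2.
    by apply: le_trans (good _ _ Dy Gi nGyi) _; rewrite lerDl.
  apply: le_trans est _; apply: lerD; first by apply: vH2 => ?; apply: nHG; left.
  by apply: good => // ?; apply: nHG; right.
exists v; split => // i Gi.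
have n1 : 0 < n.+1%:R :> R by [].
rewrite -(ler_pM2l n1); have [vH1 vH2] := vH i Gi.
apply: (@le_trans _ _ (n.+1%:R * e + M)).
  have [Hi|nHi] := pselect (H i); first exact: vH1.
  by apply: le_trans (vH2 nHi) _; rewrite lerDl.
by rewrite -lerBrDl -mulrBr ltW.
Qed.

End averaging.

End convex_filters.

(** * Segments, paths and set sums *)

Section paths.
Context {d : Order.disp_t} {T : porderType d}.
Implicit Types (A B P Q : set T) (s t u : T).

(** The segments are the differences of two paths ([segment_path_diff]). *)
Definition path P := chain P /\ forall s t, P t -> (s <= t)%O -> P s.

Lemma path_segment P : path P -> segment P.
Proof.
by move=> [cP dP]; split => // x y z _ Pz _ yz; apply: dP Pz _; exact: ltW.
Qed.

Lemma path0 : path (set0 : set T).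
Proof. by split. Qed.

Lemma path_diff_segment P Q : path P -> path Q -> segment (P `\` Q).
Proof.
move=> [cP dP] [cQ dQ]; split; first by move=> x y [Px _] [Py _]; exact: cP.
move=> x y z [Px nQx] [Pz nQz] xy yz; split; first exact: dP Pz (ltW yz).
by move=> Qy; apply: nQx; exact: dQ Qy (ltW xy).
Qed.

Lemma path_total R P Q : path R -> path P -> path Q -> P `<=` R -> Q `<=` R ->
  P `<=` Q \/ Q `<=` P.
Proof.
move=> [cR dR] [cP dP] [cQ dQ] PR QR.
have [|nPQ] := pselect (P `<=` Q); first by left.
right => u Qu; move/existsNP : nPQ => [t /not_implyP[Pt nQt]].
have /orP[ut|tu] : (u >=< t)%O by apply: cR; [exact: QR|exact: PR].
  exact: dP Pt ut.
by exfalso; apply: nQt; exact: dQ Qu tu.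
Qed.

Lemma path_bigU P Q R : path R -> path P -> path Q -> P `<` R -> Q `<` R ->
  exists P', [/\ path P', P' `<` R, P `<=` P' & Q `<=` P'].
Proof.
move=> pR pP pQ PR QR.
have [PQ|QP] := path_total pR pP pQ PR.1 QR.1.
  by exists Q; split.
by exists P; split.
Qed.

Definition below t : set T := [set s | (s < t)%O].
Definition above t : set T := [set s | (t <= s)%O].

Hypothesis treeT : is_tree T.

Lemma tree_comparable s t u : (s <= u)%O -> (t <= u)%O -> (s >=< t)%O.
Proof.
rewrite le_eqVlt => /predU1P[->|su]; first by move=> tu; rewrite /Order.comparable tu orbT.
rewrite le_eqVlt => /predU1P[->|tu]; first by rewrite /Order.comparable (ltW su).
have [||m [->|->] m1] := treeT (t := u) (B := [set x | x = s \/ x = t]).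
- by move=> _ [->|->].
- by exists s; left.
- by rewrite /Order.comparable m1 //; right.
- by rewrite /Order.comparable (m1 s) ?orbT //; left.
Qed.

(** The downward closure and the part strictly below recover a segment as a
    difference of two paths. *)
Lemma segment_path_diff A : segment A ->
  exists P Q, [/\ path P, path Q & A = P `\` Q /\ Q `<=` P].
Proof.
move=> [cA mA].
pose P := [set s | exists2 u, A u & (s <= u)%O].
have pP : path P.
  split.
    move=> s t [u Au su] [v Av tv].
    have /orP[uv|vu] := cA _ _ Au Av.
      by apply: (@tree_comparable s t v) => //; exact: le_trans uv.
    by apply: (@tree_comparable s t u) => //; exact: le_trans vu.
  by move=> s t [u Au tu] st; exists u => //; exact: le_trans tu.
exists P, (P `\` A); split => //.
  split; first by move=> s t [Ps _] [Pt _]; exact: pP.1.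
  move=> s t [Pt nAt] st; split; first exact: pP.2 st.
  move=> As; have [u Au tu] := Pt; apply: nAt.
  move: st; rewrite le_eqVlt => /predU1P[<-//|st].
  move: tu; rewrite le_eqVlt => /predU1P[->//|tu].
  exact: mA Au st tu.
split; last by move=> x [].
apply/seteqP; split.
  by move=> s As; split; [exists s|case].
by move=> s [Ps /not_andP[//|/contrapT]].
Qed.

Lemma path_below t : path (below t).
Proof.
split; first by move=> x y xt yt; apply: tree_comparable (ltW xt) (ltW yt).
by move=> x y /= yt xy; exact: le_lt_trans yt.
Qed.

Lemma chain_min A B : chain A -> B `<=` A -> B !=set0 ->
  exists2 m, B m & forall x, B x -> (m <= x)%O.
Proof.
move=> cA BA [b Bb].
have [[c [Bc cb]]|nB] := pselect (exists c, B c /\ (c < b)%O); last first.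
  exists b => // x Bx; have /orP[//|] := cA _ _ (BA _ Bb) (BA _ Bx).
  rewrite le_eqVlt => /predU1P[->//|xb].
  by exfalso; apply: nB; exists x.
have [||m [Bm mb] mmin] := treeT (t := b) (B := B `&` below b).
- by move=> x [].
- by exists c.
exists m => // x Bx; have /orP[bx|] := cA _ _ (BA _ Bb) (BA _ Bx).
  exact: le_trans (ltW mb) bx.
rewrite le_eqVlt => /predU1P[->//|xb]; first exact: ltW.
by apply: mmin.
Qed.

Lemma path_proper P R : path P -> path R -> P `<` R ->
  exists2 t, R t & P = below t.
Proof.
move=> [cP dP] [cR dR] [PR /existsNP[r /not_implyP[Rr nPr]]].
have [||t [Rt nPt] tmin] := @chain_min R (R `\` P) cR.
- by move=> x [].
- by exists r.
exists t => //; apply/seteqP; split => s.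
  move=> Ps; have /orP[ts|st] := cR _ _ Rt (PR _ Ps).
    by exfalso; apply: nPt; exact: dP ts.
  rewrite /below /= lt_neqAle st andbT; apply/eqP => st'.
  by apply: nPt; rewrite -st'.
move=> st; apply: contrapT => nPs.
have ts : (t <= s)%O by apply: tmin; split => //; apply: dR Rt (ltW st).
by have := le_lt_trans ts st; rewrite ltxx.
Qed.

Lemma below_proper t R : path R -> R t -> below t `<` R.
Proof.
move=> [cR dR] Rt; split; first by move=> s st; apply: dR Rt (ltW st).
by move=> /(_ t Rt); rewrite /below /= ltxx.
Qed.

Lemma tree_ind (Q : T -> Prop) :
  (forall t, (forall s, (s < t)%O -> Q s) -> Q t) -> forall t, Q t.
Proof.
move=> H t; apply: contrapT => nQt.
have [[s [st nQs]]|h] := pselect (exists s, (s < t)%O /\ ~ Q s); last first.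
  by apply: nQt; apply: H => s st; apply: contrapT => nQs; apply: h; exists s.
have [||m [mt nQm] mmin] := treeT (t := t) (B := [set u | (u < t)%O /\ ~ Q u]).
- by move=> x [].
- by exists s.
apply: nQm; apply: H => u um; apply: contrapT => nQu.
have mu : (m <= u)%O by apply: mmin; split => //; exact: lt_trans mt.
by have := le_lt_trans mu um; rewrite ltxx.
Qed.

End paths.

Section set_sums.
Context {R : realType} {d : Order.disp_t} {T : porderType d}.
Implicit Types (y : c00 R T) (A B : set T).

Lemma set_sum_affine A : is_affine (fun y : c00 R T => set_sum y A).
Proof. by move=> x y t; rewrite set_sumD !set_sumZ. Qed.

Lemma set_sumB y z A : set_sum (y - z) A = set_sum y A - set_sum z A.
Proof. by rewrite -scaleN1r set_sumD set_sumZ mulN1r. Qed.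

Lemma set_sum_disjoint y A : (forall t, A t -> y t = 0) -> set_sum y A = 0.
Proof. by move=> yA; rewrite /set_sum fsbig1. Qed.

Lemma set_sum_sum (I : Type) (r : seq I) (a : I -> R) (f : I -> c00 R T) A :
  set_sum (\sum_(i <- r) a i *: f i) A = \sum_(i <- r) a i * set_sum (f i) A.
Proof.
elim: r => [|i r IH]; last by rewrite !big_cons set_sumD set_sumZ IH.
by rewrite !big_nil set_sum_disjoint.
Qed.

Lemma set_sum_split y A B : B `<=` A ->
  set_sum y A = set_sum y B + set_sum y (A `\` B).
Proof.
move=> BA; rewrite !(set_sumE _ (@c00_supp0 _ _ _ y)) -big_split /=.
apply: eq_bigr => t _.
have [At|nAt] := pselect (A t); have [Bt|nBt] := pselect (B t).
- by rewrite (mem_set At) (mem_set Bt) memNset ?addr0// => -[].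
- by rewrite (mem_set At) (memNset nBt) mem_set ?add0r.
- by exfalso; exact: nAt (BA _ Bt).
- by rewrite (memNset nAt) (memNset nBt) memNset ?addr0// => -[].
Qed.

Lemma segment_l2_le (I : eqType) (r : seq I) (A : I -> set T) y :
  uniq r -> (forall i, i \in r -> segment (A i)) ->
  (forall i j, i \in r -> j \in r -> i <> j -> A i `&` A j = set0) ->
  \sum_(i <- r) set_sum y (A i) ^+ 2 <= `|y| ^+ 2.
Proof.
move=> ur sA dA.
have ds : disjoint_segments (fun k : 'I_(size r) => A (tnth (in_tuple r) k)).
  split; first by move=> k; apply: sA; exact: mem_tnth.
  apply/trivIsetP => k k' _ _ kk'; apply: dA; [exact: mem_tnth..|].
  by move=> e; move/eqP: kk'; apply; apply/tuple_uniqP: e.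
have := jt_norm_ub y ds; rewrite /l2_sum.
have s0 : 0 <= \sum_(i < size r) set_sum y (A (tnth (in_tuple r) i)) ^+ 2.
  by apply: sumr_ge0 => i _; exact: sqr_ge0.
rewrite -(ler_sqr (sqrtr_ge0 _) (normr_ge0 y)) sqr_sqrtr//.
by rewrite [X in _ -> X <= _](big_tnth _ _ r).
Qed.

Lemma segment_le A y : segment A -> `|set_sum y A| <= `|y|.
Proof.
move=> sA; rewrite -(ler_sqr (normr_ge0 _) (normr_ge0 y)) real_normK ?num_real//.
have := @segment_l2_le unit [:: tt] (fun=> A) y isT.
by rewrite big_seq1; apply => // -[] [] _ _.
Qed.

Lemma jt_norm_sqr_le y (M : R) : 0 <= M ->
  (forall n (A : 'I_n -> set T), disjoint_segments A ->
    \sum_i set_sum y (A i) ^+ 2 <= M ^+ 2) -> `|y| <= M.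
Proof.
move=> M0 yM; apply: jt_norm_le => n A ds.
rewrite -(ler_sqr (sqrtr_ge0 _) M0) sqr_sqrtr ?yM//.
by apply: sumr_ge0 => i _; exact: sqr_ge0.
Qed.

End set_sums.

(** * Limits and jumps along a maximal filter of convex sets *)

Lemma sum_sqr_perturb (R : realType) (I : eqType) (r : seq I) (u v : I -> R) (M : R) :
  (forall i, i \in r -> `|u i - v i| <= (size r).+1%:R^-1) ->
  \sum_(i <- r) u i ^+ 2 <= M -> \sum_(i <- r) v i ^+ 2 <= 2 * M + 2.
Proof.
set e : R := _^-1 => uv uM; have e0 : 0 < e by rewrite invr_gt0.
apply: (@le_trans _ _ (\sum_(i <- r) (2 * u i ^+ 2 + 2 * e ^+ 2))).
  rewrite big_seq [leRHS]big_seq; apply: ler_sum => i /uv.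
  rewrite -(ler_sqr (normr_ge0 _) (ltW e0)) real_normK ?num_real// => h.
  have := sqr_ge0 (2 * u i - v i); nra.
rewrite big_split /= -mulr_sumr big_const_seq iter_addr_0 count_predT.
apply: lerD; first by rewrite ler_pM2l.
rewrite -[leLHS]mulr_natr -[leRHS]mulr1 -mulrA ler_pM2l//.
rewrite expr2 -mulrA; apply: mulr_ile1; rewrite ?mulr_ge0 ?(ltW e0)//.
  by rewrite invf_le1// ler1n.
by rewrite ler_pdivrMl// mulr1 ler_nat.
Qed.

Section limits.
Context {R : realType} {d : Order.disp_t} {T : porderType d}.
Implicit Types (y : c00 R T) (A B P Q : set T) (F : set (set (c00 R T))).

Definition unit_ball : set (c00 R T) := [set y | `|y| <= 1].

(** The limit functional [l] is only used on segments, where the sums are bounded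
    on the unit ball. *)
Definition limit_along F (l : set T -> R) := forall A, segment A ->
  forall e, 0 < e -> F [set y | `|set_sum y A - l A| <= e].

(** [j] is the jump of [l] at the end of [Q]: the limit of [l (Q `\` P)] as the
    path [P] increases to [Q]. *)
Definition is_jump (l : set T -> R) Q (j : R) := forall e, 0 < e ->
  exists P0, [/\ path P0, P0 `<` Q & forall P, path P -> P0 `<=` P -> P `<` Q ->
    `|l (Q `\` P) - j| <= e].

Definition jumps_l2_le (l J : set T -> R) (a : R) :=
  (forall Q, path Q -> Q !=set0 -> is_jump l Q (J Q)) /\
  forall s : seq (set T), uniq s -> (forall Q, Q \in s -> path Q /\ Q !=set0) ->
    \sum_(Q <- s) J Q ^+ 2 <= a.

Lemma is_convex_ball : is_convex unit_ball.
Proof.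
move=> x y t x1 y1 /andP[t0 t1]; rewrite /unit_ball /=.
apply: le_trans (ler_normD _ _) _; rewrite !normrZ (ger0_norm t0).
rewrite (@ger0_norm _ (1 - t)) ?subr_ge0//.
by move: x1 y1; rewrite /unit_ball /= => x1 y1; nra.
Qed.

Section fixed_filter.
Variables (F : set (set (c00 R T))) (l : set T -> R).
Hypotheses (cF : convex_ultrafilter F) (Fball : F unit_ball)
  (Fl : limit_along F l).

Let near (e : R) (G : set (set T)) :=
  uniform_on F (fun A y => set_sum y A) l G e.

Lemma near1 A (e : R) : segment A -> 0 < e -> near e [set A].
Proof.
move=> sA e0; apply: (cufS cF (Fl sA e0)) => [y h _ ->//|].
by apply: is_convex_slab => B; exact: set_sum_affine.
Qed.

Lemma near_seq (I : eqType) (r : seq I) (A : I -> set T) (e : R) :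
  (forall i, i \in r -> segment (A i)) -> 0 < e ->
  near e [set B | exists2 i, i \in r & B = A i].
Proof.
move=> sA e0; elim: r sA => [|i r IH] sA.
  apply: (cufS cF Fball) => [y _ _ [] //|].
  by apply: is_convex_slab => B; exact: set_sum_affine.
apply: (@uniform_onS _ _ _ _ _ _ cF (fun=> @set_sum_affine _ _ _ _)
  ([set A i] `|` [set B | exists2 i, i \in r & B = A i]) _ e e) => //.
  move=> _ [k + ->]; rewrite inE => /predU1P[->|kr]; first by left.
  by right; exists k.
apply: uniform_onU => //; first by move=> B; exact: set_sum_affine.
  by apply: near1 => //; apply: sA; rewrite mem_head.
by apply: IH => k kr; apply: sA; rewrite inE kr orbT.
Qed.

(** The sums of a single vector of the ball approximate the finitely many limits
    involved; the constant is not optimal. *)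
Lemma limit_l2_le (I : eqType) (r : seq I) (A : I -> set T) :
  uniq r -> (forall i, i \in r -> segment (A i)) ->
  (forall i j, i \in r -> j \in r -> i <> j -> A i `&` A j = set0) ->
  \sum_(i <- r) l (A i) ^+ 2 <= 4.
Proof.
move=> ur sA dA; pose e : R := (size r).+1%:R^-1.
have e0 : 0 < e by rewrite invr_gt0.
have [y [y1 yl]] := cf_nonempty (cuf_filter cF) (cf_setI (cuf_filter cF) Fball (near_seq sA e0)).
have := segment_l2_le y ur sA dA.
have y1' : `|y| ^+ 2 <= 1 by rewrite expr_le1.
move=> /le_trans /(_ y1') S1.
have -> : 4 = 2 * 1 + 2 :> R by ring.
apply: sum_sqr_perturb S1 => i ir.
exact: yl (A i) (ex_intro2 _ _ i ir erefl).
Qed.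

Lemma limit_le A : segment A -> `|l A| <= 2.
Proof.
move=> sA; have : \sum_(i <- [:: tt]) l A ^+ 2 <= 4.
  by apply: limit_l2_le => // -[] [] _ _.
rewrite big_seq1.
rewrite -(ler_sqr (normr_ge0 _)) ?nnegrE// real_normK ?num_real// => h.
by apply: le_trans h _; rewrite expr2; lra.
Qed.

Lemma limit_split A B : segment A -> segment B -> segment (A `\` B) ->
  B `<=` A -> l A = l B + l (A `\` B).
Proof.
move=> sA sB sAB BA; apply/eqP; rewrite -subr_eq0 -normr_le0.
apply/ler_addgt0Pr => e e0; rewrite add0r.
have e3 : 0 < e / 3 by rewrite divr_gt0.
have [y [[yA yB] yAB]] := cf_nonempty (cuf_filter cF) (cf_setI (cuf_filter cF)
  (cf_setI (cuf_filter cF) (Fl sA e3) (Fl sB e3)) (Fl sAB e3)).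
move: yA yB yAB; rewrite /= (set_sum_split y BA) !ler_norml.
by move=> /andP[? ?] /andP[? ?] /andP[? ?]; apply/andP; split; lra.
Qed.

Lemma limit0 : l set0 = 0.
Proof.
have s0 := path_segment (@path0 _ T).
apply/eqP; rewrite -normr_le0; apply/ler_addgt0Pr => e e0; rewrite add0r.
have [y] := cf_nonempty (cuf_filter cF) (Fl s0 e0).
by rewrite /= set_sum_disjoint// sub0r normrN.
Qed.

Lemma limit_diff R0 P Q : path R0 -> path P -> path Q -> P `<=` Q -> Q `<=` R0 ->
  l (R0 `\` P) = l (Q `\` P) + l (R0 `\` Q).
Proof.
move=> pR pP pQ PQ QR.
rewrite (@limit_split (R0 `\` P) (Q `\` P)).
- congr (_ + l _); apply/seteqP; split => x.
    by move=> [[Rx nPx] nQP]; split => // Qx; apply: nQP.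
  by move=> [Rx nQx]; split; [split => // /PQ|case].
- exact: path_diff_segment.
- exact: path_diff_segment.
- have -> : (R0 `\` P) `\` (Q `\` P) = R0 `\` Q.
    apply/seteqP; split => x.
      by move=> [[Rx nPx] nQP]; split => // Qx; apply: nQP.
    by move=> [Rx nQx]; split; [split => // /PQ|case].
  exact: path_diff_segment.
- by move=> x [/QR Rx nPx].
Qed.

(** Otherwise infinitely many disjoint segments of [Q] would have limits larger
    than [e] in absolute value. *)
Lemma limit_cauchy Q (e : R) : path Q -> Q !=set0 -> 0 < e ->
  exists P0, [/\ path P0, P0 `<` Q & forall P P', path P -> path P' ->
    P0 `<=` P -> P `<=` P' -> P' `<` Q -> `|l (P' `\` P)| <= e].
Proof.
move=> pQ [q Qq] e0; apply: contrapT => nex.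
have step P0 : path P0 -> P0 `<` Q -> exists P P', [/\ path P, path P',
    P0 `<=` P, P `<=` P' & P' `<` Q /\ e < `|l (P' `\` P)| ].
  move=> pP0 P0Q; apply: contrapT => nP; apply: nex; exists P0; split => //.
  move=> P P' pP pP' P0P PP' P'Q; rewrite leNgt; apply/negP => lt.
  by apply: nP; exists P, P'.
have build n : exists P (A : nat -> set T), [/\ path P, P `<` Q,
    forall i, (i < n)%N -> [/\ segment (A i), A i `<=` P & e < `|l (A i)|] &
    forall i j, (i < j)%N -> (j < n)%N -> A i `&` A j = set0].
  elim: n => [|n [P [A [pP PQ Ai Aij]]]].
    exists set0, (fun=> set0); split => //; first exact: path0.
    by split => // /(_ q Qq).
  have [P1 [P' [pP1 pP' PP1 P1P' [P'Q le]]]] := step _ pP PQ.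
  exists P', (fun i => if (i < n)%N then A i else P' `\` P1); split => //.
    move=> i; rewrite ltnS leq_eqVlt => /predU1P[->|il]; last first.
      rewrite il; have [? AP ?] := Ai _ il; split => //.
      by move=> x /AP /PP1 /P1P'.
    by rewrite ltnn; split => //; exact: path_diff_segment.
  move=> i j ij; rewrite ltnS leq_eqVlt => /predU1P[jn|jl]; last first.
    by rewrite jl (ltn_trans ij jl); exact: Aij.
  rewrite jn ltnn -jn ij; apply/seteqP; split => // x [].
  have [|_ AP _] := Ai i; first by rewrite -jn.
  by move=> /AP /PP1 ? [].
pose n := (Num.truncn (4 / e ^+ 2)).+1.
have [P [A [_ _ Ai Aij]]] := build n.
have : \sum_(i <- iota 0 n) l (A i) ^+ 2 <= 4.
  apply: limit_l2_le; [exact: iota_uniq| |].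
    by move=> i; rewrite mem_iota => /andP[_ /Ai[]].
  move=> i j; rewrite !mem_iota !add0n /= => il jl /eqP.
  rewrite neq_ltn => /orP[ij|ji]; first exact: Aij.
  by rewrite setIC; exact: Aij.
apply/negP; rewrite -ltNge.
apply: (@lt_le_trans _ _ (\sum_(i <- iota 0 n) e ^+ 2)).
  rewrite big_const_seq iter_addr_0 count_predT size_iota -[ltRHS]mulr_natl -ltr_pdivrMr ?exprn_gt0//.
  exact: truncnS_gt.
rewrite big_seq [leRHS]big_seq; apply: ler_sum => i.
rewrite mem_iota add0n => /andP[_ /Ai[_ _ le]].
by rewrite -[leRHS]real_normK ?num_real// ler_sqr ?nnegrE ?normr_ge0 ?(ltW e0)// ltW.
Qed.

Lemma jump_exists Q : path Q -> Q !=set0 -> exists j, is_jump l Q j.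
Proof.
move=> pQ Q0; pose S : set R := [set r | exists P0, [/\ path P0, P0 `<` Q &
  forall P, path P -> P0 `<=` P -> P `<` Q -> r <= l (Q `\` P)]].
exists (sup S) => e e0; have e2 : 0 < e / 2 by rewrite divr_gt0.
have [P0 [pP0 P0Q P0e]] := limit_cauchy pQ Q0 e2.
have close P : path P -> P0 `<=` P -> P `<` Q ->
    `|l (Q `\` P) - l (Q `\` P0)| <= e / 2.
  move=> pP P0P PQ; rewrite distrC.
  rewrite (@limit_diff Q P0 P)//; last exact: PQ.1.
  by rewrite addrK; apply: P0e.
have Slow : S (l (Q `\` P0) - e / 2).
  exists P0; split => // P pP P0P PQ.
  have := close _ pP P0P PQ; rewrite ler_norml => /andP[+ _].
  by rewrite lerBrDl.
have ubS : ubound S (l (Q `\` P0) + e / 2).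
  move=> r [P1 [pP1 P1Q rP]].
  have [P' [pP' P'Q P0P' P1P']] := path_bigU pQ pP0 pP1 P0Q P1Q.
  apply: le_trans (rP _ pP' P1P' P'Q) _.
  have := close _ pP' P0P' P'Q; rewrite ler_norml => /andP[_].
  by rewrite lerBlDl.
have hS : has_sup S by split; [exists (l (Q `\` P0) - e / 2)|exists (l (Q `\` P0) + e / 2)].
have s1 := sup_upper_bound hS Slow.
have s2 : sup S <= l (Q `\` P0) + e / 2 by apply: ge_sup => //; exact: hS.1.
exists P0; split => // P pP P0P PQ.
have := close _ pP P0P PQ; rewrite !ler_norml => /andP[? ?].
by apply/andP; split; lra.
Qed.

(** A point of [Q] outside another path bounds the part of that path in [Q]; take
    the largest of finitely many such points. *)
Lemma separate_path Q (s : seq (set T)) : is_tree T -> path Q -> Q !=set0 ->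
  (forall Q', Q' \in s -> path Q') ->
  exists P, [/\ path P, P `<` Q & forall Q', Q' \in s -> ~ Q `<=` Q' ->
    (Q `\` P) `&` Q' = set0].
Proof.
move=> treeT pQ [q Qq]; elim: s => [|Q1 s IH] sp.
  by exists set0; split => //; [exact: path0|split => // /(_ q Qq)].
have [|P [pP PQ Ps]] := IH; first by move=> Q' Q's; apply: sp; rewrite inE Q's orbT.
have [QQ1|/existsNP[t /not_implyP[Qt nQ1t]]] := pselect (Q `<=` Q1).
  by exists P; split => // Q'; rewrite inE => /predU1P[->//|]; exact: Ps.
have [P' [pP' P'Q PP' P1P']] := path_bigU pQ pP (path_below treeT t) PQ (below_proper pQ Qt).
exists P'; split => // Q'; rewrite inE => /predU1P[->|Q's] nQQ'.
  apply/seteqP; split => // x [[Qx nP'x] Q1x]; apply: nQ1t.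
  have pQ1 : path Q1 by apply: sp; rewrite mem_head.
  apply: pQ1.2 Q1x _; have /orP[//|xt] := pQ.1 _ _ Qt Qx.
  move: xt; rewrite le_eqVlt => /predU1P[->//|xt].
  by exfalso; apply: nP'x; exact: P1P'.
apply/seteqP; split => // x [[Qx nP'x] Q'x].
by rewrite -(Ps _ Q's nQQ'); split => //; split => // /PP'.
Qed.

(** The ends of distinct paths are disjoint segments, so that the jumps inherit
    the square summability of the limits. *)
Lemma jumps_exist : is_tree T -> exists J, jumps_l2_le l J 10.
Proof.
move=> treeT.
have /choice[J HJ] : forall Q, exists j, path Q -> Q !=set0 -> is_jump l Q j.
  move=> Q; have [[pQ Q0]|n] := pselect (path Q /\ Q !=set0).
    by have [j jP] := jump_exists pQ Q0; exists j.
  by exists 0 => pQ Q0; exfalso; apply: n.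
exists J; split => // s us sp; pose e : R := (size s).+1%:R^-1.
have e0 : 0 < e by rewrite invr_gt0.
have /choice[P HP] : forall Q, exists P, Q \in s -> [/\ path P, P `<` Q,
    `|l (Q `\` P) - J Q| <= e &
    forall Q', Q' \in s -> ~ Q `<=` Q' -> (Q `\` P) `&` Q' = set0].
  move=> Q; have [Qs|nQs] := boolP (Q \in s); last by exists set0.
  have [pQ Q0] := sp _ Qs.
  have [|P1 [pP1 P1Q P1s]] := separate_path (s := s) treeT pQ Q0.
    by move=> Q' /sp[].
  have [P0 [pP0 P0Q P0e]] := HJ _ pQ Q0 _ e0.
  have [P' [pP' P'Q PP' P1P']] := path_bigU pQ pP0 pP1 P0Q P1Q.
  exists P' => _; split => //; first exact: P0e.
  move=> Q' Q's nQQ'; apply/seteqP; split => // x [[Qx nP'x] Q'x].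
  by rewrite -(P1s _ Q's nQQ'); split => //; split => // /P1P'.
have : \sum_(Q <- s) l (Q `\` P Q) ^+ 2 <= 4.
  apply: limit_l2_le => //.
    move=> Q Qs; have [pP _ _ _] := HP _ Qs.
    by apply: path_diff_segment => //; case: (sp _ Qs).
  move=> Q Q' Qs Q's QQ'.
  have [QsQ'|nQQ'] := pselect (Q `<=` Q').
    have nQ'Q : ~ Q' `<=` Q by move=> Q'Q; apply: QQ'; apply/seteqP.
    have [_ _ _ h] := HP _ Q's; have := h _ Qs nQ'Q.
    by move=> h'; apply/seteqP; split => // x [[Qx _] Q'x]; rewrite -h'.
  have [_ _ _ h] := HP _ Qs; have := h _ Q's nQQ'.
  by move=> h'; apply/seteqP; split => // x [Qx [Q'x _]]; rewrite -h'.
move=> S4; have -> : 10 = 2 * 4 + 2 :> R by ring.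
apply: sum_sqr_perturb S4 => Q Qs.
by have [] := HP _ Qs.
Qed.

End fixed_filter.

End limits.

(** * Uniform convergence on paths *)

Section uniform_convergence.
Context {R : realType} {d : Order.disp_t} {T : porderType d}.
Implicit Types (y : c00 R T) (A B P Q : set T) (s t u : T).

Definition small_jumps (l : set T -> R) (k : R) := forall Q, path Q -> Q !=set0 ->
  forall e, k < e -> exists P0, [/\ path P0, P0 `<` Q &
    forall P, path P -> P0 `<=` P -> P `<` Q -> `|l (Q `\` P)| <= e].

Definition subpaths Q : set (set T) := [set P | path P /\ P `<=` Q].

(** The minimum of a segment in the cone need not be [t], which makes the cones
    decrease along the tree. *)
Definition cone t : set (set T) := [set A | segment A /\ A `<=` above t].

(** If [Q i] does not contain [P], the points of [P] beyond one outside [Q i] are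
    covered by the other sets, and so is all of [P], by downward closure. *)
Lemma path_cover (I : eqType) (r : seq I) (Q : I -> set T) P : path P ->
  (forall i s t, Q i t -> (s <= t)%O -> Q i s) ->
  (forall t, P t -> exists2 i, i \in r & Q i t) ->
  P = set0 \/ exists2 i, i \in r & P `<=` Q i.
Proof.
move=> [cP dP] dQ; elim: r => [|i r IH] PQ.
  by left; apply/seteqP; split => // t /PQ[].
have [PQi|/existsNP[u /not_implyP[Pu nQu]]] := pselect (P `<=` Q i).
  by right; exists i => //; rewrite mem_head.
have [j jr Qju] : exists2 j, j \in r & Q j u.
  by have [j] := PQ _ Pu; rewrite inE => /predU1P[->//|jr] Qj; exists j.
case: IH => [t Pt|P0|[k kr PQk]]; last 2 first.
- by left.
- by right; exists k => //; rewrite inE kr orbT.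
have /orP[tu|ut] := cP _ _ Pt Pu; first by exists j => //; exact: dQ Qju tu.
have [k] := PQ _ Pt; rewrite inE => /predU1P[->|kr] Qk; last by exists k.
by exfalso; apply: nQu; exact: dQ Qk ut.
Qed.

Variables (F : set (set (c00 R T))) (l : set T -> R).
Hypotheses (treeT : is_tree T) (cF : convex_ultrafilter F) (Fball : F unit_ball)
  (Fl : limit_along F l).

Local Notation unif := (uniform_on F (fun A y => set_sum y A) l).

Let affS A : is_affine (fun y : c00 R T => set_sum y A).
Proof. exact: set_sum_affine. Qed.

Let convS (G : set (set T)) (e : R) :
  is_convex [set y : c00 R T | forall A, G A -> `|set_sum y A - l A| <= e].
Proof. exact: (@is_convex_slab _ _ _ G (fun A y => set_sum y A) l e affS). Qed.

Let unif0 (e : R) : unif set0 e.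
Proof.
apply: (cufS cF Fball); last exact: convS.
by move=> y _ A []. Qed.

Let unif_seq (I : eqType) (r : seq I) (G : I -> set (set T)) (e : R) :
  (forall i, i \in r -> unif (G i) e) ->
  unif [set A | exists2 i, i \in r & G i A] e.
Proof.
elim: r => [|i r IH] ur.
  by apply: (uniform_onS cF affS _ _ (unif0 e)) => // A [].
apply: (@uniform_onS _ _ _ _ _ _ cF affS
    (G i `|` [set A | exists2 i, i \in r & G i A]) _ e e) => //.
  move=> A [j]; rewrite inE => /predU1P[->|jr] GA; first by left.
  by right; exists j.
apply: uniform_onU => //; first by apply: ur; rewrite mem_head.
by apply: IH => j jr; apply: ur; rewrite inE jr orbT.
Qed.

Let bound3 y A : unit_ball y -> segment A -> `|set_sum y A - l A| <= 3.
Proof.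
move=> y1 sA; apply: le_trans (ler_normB _ _) _.
have -> : 3 = 1 + 2 :> R by ring.
apply: lerD; first by apply: le_trans (segment_le y sA) y1.
exact (limit_le cF Fball Fl sA).
Qed.

Section chains.
Variable (k : R).
Hypotheses (k0 : 0 <= k) (hk : small_jumps l k).

(** Averaging, where [P] is exceptional for [y] if it misses a point of the
    support of [y] on [Q] or ends too early. All other [P] have the same sum as [Q],
    and their limit differs from that of [Q] by little more than the jump. *)
Lemma subpaths_step Q : path Q ->
  (forall P, path P -> P `<` Q -> forall e, k < e -> unif (subpaths P) e) ->
  forall e, k < e -> unif (subpaths Q) e.
Proof.
move=> pQ IH e ke.
have [Q0|/set0P Q0] := eqVneq Q set0.
  apply: (uniform_onS cF affS _ (lexx e) (near1 cF Fl (path_segment path0) (le_lt_trans k0 ke))).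
  by move=> P [_]; rewrite Q0 subset0.
pose h := (e - k) / 4.
have h0 : 0 < h by rewrite /h; lra.
have [|P0 [pP0 P0Q HP0]] := hk pQ Q0 (e := k + h); first by rewrite ltrDl.
pose Gy y : set (set T) := [set P | subpaths Q P /\
  [\/ P = Q, P `<=` P0 | exists2 t, t \in c00_supp y & Q t /\ ~ P t]].
have sQ := path_segment pQ.
apply: (@averaging _ _ _ _ _ _ cF affS (subpaths Q) Gy
   (unit_ball `&` [set y | `|set_sum y Q - l Q| <= h]) (k + h + h) 3 _ _ _ _ _ e) => //.
- by apply: (cf_setI (cuf_filter cF)) => //; exact: Fl.
- by move=> y P [y1 _] [pP _]; apply: bound3 => //; exact: path_segment.
- move=> y _; have kh : k < k + h + h by lra.
  pose G1 t := [set P | Q t /\ subpaths (below t) P].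
  have u1 : unif [set P | exists2 t, t \in (c00_supp y : seq T) & G1 t P] (k + h + h).
    apply: unif_seq => t _; have [Qt|nQt] := pselect (Q t).
      apply: (uniform_onS cF affS _ (lexx _) (IH _ (path_below treeT t) (below_proper pQ Qt) _ kh)).
      by move=> P [].
    by apply: (uniform_onS cF affS _ (lexx _) (unif0 _)) => P [].
  have u2 := IH _ pP0 P0Q _ kh.
  have u3 := near1 cF Fl sQ (le_lt_trans k0 kh).
  have := uniform_onU cF affS u3 (uniform_onU cF affS u2 u1).
  apply: (uniform_onS cF affS) => // P [[pP PQ] [->|PP0|[t ty [Qt nPt]]]].
  + by left.
  + by right; left.
  + right; right; exists t => //; split => //; split => // s Ps.
    have /orP[ts|] := pQ.1 _ _ Qt (PQ _ Ps).
      by exfalso; apply: nPt; exact: pP.2 ts.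
    rewrite le_eqVlt => /predU1P[st|//].
    by exfalso; apply: nPt; rewrite -st.
- move=> y P [y1 yQ] [pP PQ] nG.
  have PneQ : P <> Q by move=> PQ'; apply: nG; split => //; constructor 1.
  have P0P : P0 `<=` P.
    have [|//] := path_total pQ pP pP0 PQ P0Q.1.
    by move=> PP0; exfalso; apply: nG; split => //; constructor 2.
  have PltQ : P `<` Q.
    by split => // QP; apply: PneQ; apply/seteqP.
  have := HP0 _ pP P0P PltQ.
  have -> : l P = l Q - l (Q `\` P).
    rewrite (limit_split cF Fl sQ (path_segment pP) (path_diff_segment pQ pP) PQ).
    by rewrite addrK.
  have -> : set_sum y P = set_sum y Q.
    rewrite (set_sum_split y PQ) [X in _ + X]set_sum_disjoint ?addr0// => t [Qt nPt].
    apply: c00_supp0; apply/negP => ty; apply: nG; split => //.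
    by constructor 3; exists t.
  move: yQ; rewrite /= !ler_norml => /andP[? ?] /andP[? ?].
  by apply/andP; split; lra.
- by rewrite /h; lra.
Qed.

Lemma subpaths_uniform Q : path Q -> forall e, k < e -> unif (subpaths Q) e.
Proof.
have ub t : forall e, k < e -> unif (subpaths (below t)) e.
  elim/(tree_ind treeT) : t => t IH; apply: subpaths_step; first exact: path_below.
  move=> P pP Pt; have [s st ->] := path_proper treeT pP (path_below treeT t) Pt.
  exact: IH.
move=> pQ; apply: subpaths_step => // P pP PQ.
by have [s _ ->] := path_proper treeT pP pQ PQ; exact: ub.
Qed.

End chains.

Section branching.
Variable (dl : R).
Hypothesis dl0 : 0 < dl.

(** The second condition makes a segment of the cone harmless for vectors whose
    support it does not meet. *)
Definition good_node t :=
  (forall e, dl < e -> unif (cone t) e) /\ forall A, cone t A -> `|l A| <= dl.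

Definition bad_node t := ~ good_node t.

Lemma cone_sub s t : (s <= t)%O -> cone t `<=` cone s.
Proof.
by move=> st A [sA At]; split => // x /At; exact: le_trans.
Qed.

Lemma bad_node_le s t : (s <= t)%O -> bad_node t -> bad_node s.
Proof.
move=> st bt [us ls]; apply: bt; split.
  by move=> e de; apply: (uniform_onS cF affS (cone_sub st) (lexx _) (us _ de)).
by move=> A /(cone_sub st); exact: ls.
Qed.

Lemma bad_node_witness t : bad_node t -> exists2 D, F D &
  forall y, D y -> exists2 A, cone t A & dl ^+ 2 <= (set_sum y A - l A) ^+ 2 + l A ^+ 2.
Proof.
move=> /not_andP[/existsNP[e /not_implyP[de nu]]|/existsNP[A /not_implyP[cA lA]]].
  apply: contrapT => nD; apply: nu; apply: (cuf_max cF); first exact: convS.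
  move=> D FD; apply: contrapT => /set0P/negP; rewrite negbK => /eqP ED.
  apply: nD; exists D => // y Dy.
  have /existsNP[A /not_implyP[cA]] :
      ~ (forall A, cone t A -> `|set_sum y A - l A| <= e).
    move=> h; have : ([set y : c00 R T | forall A, cone t A -> `|set_sum y A - l A| <= e] `&` D) y by split.
    by rewrite ED.
  move=> /negP; rewrite -ltNge => lt; exists A => //.
  apply: (@le_trans _ _ ((set_sum y A - l A) ^+ 2)); last by rewrite lerDl sqr_ge0.
  rewrite -[leRHS]real_normK ?num_real// ler_sqr ?nnegrE ?normr_ge0 ?(ltW dl0)//.
  by apply: ltW; exact: lt_trans lt.
exists unit_ball => // y _; exists A => //.
move/negP: lA; rewrite -ltNge => lt.
apply: (@le_trans _ _ (l A ^+ 2)); last by rewrite lerDr sqr_ge0.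
by rewrite -[leRHS]real_normK ?num_real// ler_sqr ?nnegrE ?normr_ge0 ?(ltW dl0)// ltW.
Qed.

Definition bad_antichain (r : seq T) := [/\ uniq r, forall t, t \in r -> bad_node t &
  forall s t, s \in r -> t \in r -> s <> t -> ~ (s >=< t)%O].

Lemma bad_antichain_size (r : seq T) :
  bad_antichain r -> (size r)%:R * dl ^+ 2 <= 14.
Proof.
move=> [ur br ar].
have [D FD HD] : exists2 D, F D & forall y, D y -> forall t, t \in r ->
    exists2 A, cone t A & dl ^+ 2 <= (set_sum y A - l A) ^+ 2 + l A ^+ 2.
  elim: r br {ur ar} => [|t r IH] br; first by exists unit_ball.
  have [|D FD HD] := IH; first by move=> u ur; apply: br; rewrite inE ur orbT.
  have [D1 FD1 HD1] := bad_node_witness (br _ (mem_head _ _)).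
  exists (D `&` D1); first exact: (cf_setI (cuf_filter cF)).
  by move=> y [Dy D1y] u; rewrite inE => /predU1P[->|]; [exact: HD1|exact: HD].
have [y [y1 Dy]] := cf_nonempty (cuf_filter cF) (cf_setI (cuf_filter cF) Fball FD).
have /choice[A HA] : forall t, exists A, t \in r ->
    cone t A /\ dl ^+ 2 <= (set_sum y A - l A) ^+ 2 + l A ^+ 2.
  move=> t; have [tr|ntr] := boolP (t \in r); last by exists set0.
  by have [A cA lA] := HD _ Dy _ tr; exists A.
have sA t : t \in r -> segment (A t) by move=> /HA[[]].
have dA s t : s \in r -> t \in r -> s <> t -> A s `&` A t = set0.
  move=> sr tr st; apply/seteqP; split => // x [xs xt].
  apply: (ar _ _ sr tr st); have [[_ As] _] := HA _ sr; have [[_ At] _] := HA _ tr.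
  exact: (tree_comparable treeT (As _ xs) (At _ xt)).
have S1 := segment_l2_le y ur sA dA.
have S2 := limit_l2_le cF Fball Fl ur sA dA.
have y1' : `|y| ^+ 2 <= 1 by rewrite expr_le1.
have -> : (size r)%:R * dl ^+ 2 = \sum_(t <- r) dl ^+ 2.
  by rewrite big_const_seq iter_addr_0 count_predT -[RHS]mulr_natl.
(* the sums of the two squares are at most 1 and 4, whence 14 = 2 * 1 + 3 * 4 *)
apply: (@le_trans _ _ (\sum_(t <- r) (2 * set_sum y (A t) ^+ 2 + 3 * l (A t) ^+ 2))).
  rewrite big_seq [leRHS]big_seq; apply: ler_sum => t tr.
  apply: le_trans (HA _ tr).2 _.
  by have := sqr_ge0 (set_sum y (A t) + l (A t)); nra.
rewrite big_split /= -!mulr_sumr.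
by move: S1 S2 y1'; set X := \sum_(t <- r) _; set Y := \sum_(t <- r) _; lra.
Qed.

Lemma max_bad_antichain : exists2 r, bad_antichain r &
  forall r', bad_antichain r' -> (size r' <= size r)%N.
Proof.
pose p n := `[< exists2 r, bad_antichain r & size r = n >].
have p0 : exists n, p n by exists 0%N; apply/asboolP; exists [::].
have pb n : p n -> (n <= Num.truncn (14 / dl ^+ 2))%N.
  move=> /asboolP[r /bad_antichain_size br <-].
  rewrite -ltnS -(ltr_nat R); apply: le_lt_trans (truncnS_gt _).
  by rewrite ler_pdivlMr ?exprn_gt0.
case: (ex_maxnP p0 pb) => n /asboolP[r br <-] nmax; exists r => // r' br'.
by apply: nmax; apply/asboolP; exists r'.
Qed.

(** Bad nodes form finitely many paths: incomparable bad nodes carry disjoint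
    segments on which [l], or the difference between [l] and a single vector of the
    unit ball, is large. *)
Lemma bad_paths_uniform (k : R) : 0 <= k -> small_jumps l k ->
  forall e, k < e -> unif [set P | path P /\ forall t, P t -> bad_node t] e.
Proof.
move=> k0 hk e ke; have [r [ur br ar] rmax] := max_bad_antichain.
pose Q t : set T := [set s | bad_node s /\ (s >=< t)%O].
have dQ t s u : Q t u -> (s <= u)%O -> Q t s.
  move=> [bu /orP[ut|tu]] su; split; first exact: bad_node_le bu.
  - by rewrite /Order.comparable (le_trans su ut).
  - exact: bad_node_le bu.
  - exact: (tree_comparable treeT su tu).
have pQ t : t \in r -> path (Q t).
  move=> tr; split; last by move=> s u; exact: dQ.
  move=> x z [bx xt] [bz zt]; apply: contrapT => nxz.
  have [tx tz] : (t <= x)%O /\ (t <= z)%O.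
    move: xt zt => /orP[xt|tx] /orP[zt|tz].
    - by exfalso; apply: nxz; exact: (tree_comparable treeT xt zt).
    - by exfalso; apply: nxz; rewrite /Order.comparable (le_trans xt tz).
    - by exfalso; apply: nxz; rewrite /Order.comparable (le_trans zt tx) orbT.
    - by [].
  have inc u v : (t <= v)%O -> u \in r -> u <> t -> ~ (u >=< v)%O.
    move=> tv uor ut /orP[uv|vu]; apply: (ar u t) => //.
      exact: (tree_comparable treeT uv tv).
    by rewrite /Order.comparable (le_trans tv vu) orbT.
  have notin v : (t <= v)%O -> v \notin rem t r.
    move=> tv; rewrite mem_rem_uniq// inE; apply/negP => /andP[vt vr].
    by apply: (inc v v tv vr) => //; [exact/eqP|exact: comparablexx].
  suff /rmax : bad_antichain [:: x, z & rem t r].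
    by rewrite /= size_rem//; case: (r) tr => //= ? ?; rewrite ltnn.
  split.
  - rewrite /= inE negb_or notin// notin// rem_uniq// !andbT.
    by apply/eqP => xz; apply: nxz; rewrite xz comparablexx.
  - move=> u; rewrite !inE => /predU1P[->//|/predU1P[->//|/mem_rem]]; exact: br.
  - have far u v : (t <= v)%O -> u \in rem t r -> ~ (u >=< v)%O.
      move=> tv; rewrite mem_rem_uniq// inE => /andP[/eqP ut uor].
      exact: inc.
    move=> u v; rewrite !inE => /predU1P[->|/predU1P[->|ur']] /predU1P[->|/predU1P[->|vr']] uv //.
    + by rewrite comparable_sym; exact: far.
    + by rewrite comparable_sym.
    + by rewrite comparable_sym; exact: far.
    + exact: far.
    + exact: far.
    + by apply: ar => //; [exact: mem_rem ur'|exact: mem_rem vr'].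
have cover s : bad_node s -> exists2 t, t \in r & Q t s.
  move=> bs; apply: contrapT => ncov.
  have inc t : t \in r -> ~ (s >=< t)%O.
    by move=> tr st; apply: ncov; exists t.
  suff /rmax : bad_antichain (s :: r) by rewrite /= ltnn.
  split.
  - by rewrite /= ur andbT; apply/negP => /inc; apply; exact: comparablexx.
  - by move=> u; rewrite inE => /predU1P[->//|]; exact: br.
  - move=> u v; rewrite !inE => /predU1P[->|ur'] /predU1P[->|vr'] uv //.
    + exact: inc.
    + by rewrite comparable_sym; exact: inc.
    + exact: ar.
have u1 : unif [set P | exists2 t, t \in r & subpaths (Q t) P] e.
  by apply: unif_seq => t tr; exact (subpaths_uniform k0 hk (pQ t tr) ke).
have u0 := near1 cF Fl (path_segment (@path0 _ T)) (le_lt_trans k0 ke).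
apply: (uniform_onS cF affS _ (lexx _) (uniform_onU cF affS u0 u1)).
move=> P [pP Pb]; have [|P0|[t tr PQ]] := path_cover (r := r) (Q := Q) pP dQ.
- by move=> t /Pb /cover.
- by left.
- by right; exists t.
Qed.

(** The nodes [t] in question form an antichain, so that the support of [y] meets
    the cones of finitely many of them; those are the exceptional ones for [y] in
    the averaging. *)
Lemma good_cones_uniform e : dl < e ->
  unif [set A | segment A /\ exists2 t, A `<=` above t &
    good_node t /\ forall s, (s < t)%O -> bad_node s] e.
Proof.
move=> de.
pose W : set T := [set t | good_node t /\ forall s, (s < t)%O -> bad_node s].
pose e1 := (dl + e) / 2.
pose Gy y : set (set T) := [set A | exists2 u, u \in (c00_supp y : seq T) &
   exists t, [/\ W t, (t <= u)%O & cone t A]].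
apply: (@averaging _ _ _ _ _ _ cF affS _ Gy unit_ball e1 3 _ _ _ _ _ e) => //.
- by move=> y A y1 [sA _]; exact: bound3.
- move=> y _; apply: unif_seq => u _.
  have [[t [Wt tu]]|nt] := pselect (exists t, W t /\ (t <= u)%O); last first.
    apply: (uniform_onS cF affS _ (lexx _) (unif0 _)) => A [t [Wt tu _]].
    by apply: nt; exists t.
  have ee : dl < e1 by rewrite /e1; lra.
  apply: (uniform_onS cF affS _ (lexx _) (Wt.1.1 _ ee)) => A [t' [Wt' t'u cA]].
  suff <- : t' = t by [].
  have /orP[] := tree_comparable treeT t'u tu; rewrite le_eqVlt => /predU1P[//|lt].
    by exfalso; apply: (Wt.2 _ lt); exact: Wt'.1.
  by exfalso; apply: (Wt'.2 _ lt); exact: Wt.1.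
- move=> y A y1 [sA [t At Wt]] nG.
  rewrite set_sum_disjoint; last first.
    move=> u Au; apply: c00_supp0; apply/negP => uy; apply: nG.
    by exists u => //; exists t; split => //; exact: At.
  rewrite sub0r normrN; apply: (@le_trans _ _ dl); last by rewrite /e1; lra.
  by apply: Wt.1.2.
- by rewrite /e1; lra.
Qed.

End branching.

(** A path is its part made of bad nodes, followed by a segment in the cone of a
    minimal good node. *)
Lemma paths_uniform (k : R) : 0 <= k -> small_jumps l k ->
  forall e, k < e -> unif path e.
Proof.
move=> k0 hk e ke; pose h := (e - k) / 3.
have h0 : 0 < h by rewrite /h; lra.
have kh : k < k + h by lra.
have hh : h < h + h by lra.
have u1 := bad_paths_uniform h0 k0 hk kh.
have u2 := good_cones_uniform hh.
apply: (cufS cF (cf_setI (cuf_filter cF) u1 u2)); last exact: convS.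
move=> y [/= y1 y2] P pP.
pose B := [set t | P t /\ bad_node h t].
have pB : path B.
  split; first by move=> s t [Ps _] [Pt _]; exact: pP.1.
  move=> s t [Pt bt] st; split; first exact: pP.2 st.
  exact: bad_node_le bt.
have BP : B `<=` P by move=> t [].
have := y1 B (conj pB (fun t (Bt : B t) => Bt.2)).
have sPB := path_diff_segment pP pB.
rewrite (set_sum_split y BP) (limit_split cF Fl (path_segment pP) (path_segment pB) sPB BP).
have : `|set_sum y (P `\` B) - l (P `\` B)| <= h + h.
  have [PB0|/set0P PB0] := eqVneq (P `\` B) set0.
    rewrite PB0 (limit0 cF Fl) set_sum_disjoint// subr0 normr0.
    by rewrite addr_ge0 ?ltW.
  have [|t [Pt nBt] tmin] := chain_min treeT pP.1 (B := P `\` B) _ PB0.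
    by move=> t [].
  apply: y2; split => //; exists t; first by move=> s /tmin.
  split; first by apply: contrapT => bt; apply: nBt.
  move=> s st; apply: contrapT => gs.
  have ts : (t <= s)%O.
    by apply: tmin; split; [exact: pP.2 (ltW st)|move=> []].
  by have := le_lt_trans ts st; rewrite ltxx.
rewrite !ler_norml => /andP[? ?] /andP[? ?].
have eE : e = k + 3 * h by rewrite /h; lra.
by rewrite eE; apply/andP; split; lra.
Qed.

End uniform_convergence.

(** * Absolutely convex combinations with small segment sums *)

Lemma big_nat_supp (V : nmodType) (f : nat -> V) (M M' : nat) :
  (forall n, (M <= n)%N -> f n = 0) -> (M <= M')%N ->
  \sum_(0 <= n < M') f n = \sum_(0 <= n < M) f n.
Proof.
move=> f0 MM'; rewrite (@big_cat_nat _ _ _ M)//=.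
rewrite [X in _ + X]big_nat_cond [X in _ + X]big1 ?addr0//.
by move=> n /andP[/andP[Mn _] _]; exact: f0.
Qed.

Lemma big_nat_double (V : nmodType) (f : nat -> V) (M : nat) :
  \sum_(0 <= n < M.*2) f n = \sum_(0 <= n < M) (f n.*2 + f n.*2.+1).
Proof.
elim: M => [|M IH]; first by rewrite !big_geq.
by rewrite doubleS !big_nat_recr//= IH addrA.
Qed.

Section combinations.
Context {R : realType} {E : lmodType R}.
Implicit Types (x : nat -> E) (a : nat -> R).

Definition weights_in a (m M : nat) := forall n, ~~ (m <= n < M)%N -> a n = 0.

Definition comb a x (M : nat) : E := \sum_(0 <= n < M) a n *: x n.

Definition hull x m : set E := [set y | exists M a, [/\ weights_in a m M,
  forall n, 0 <= a n, \sum_(0 <= n < M) a n = 1 & y = comb a x M]].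

Lemma weights_inW a m M m' M' : (m' <= m)%N -> (M <= M')%N ->
  weights_in a m M -> weights_in a m' M'.
Proof.
move=> mm MM aw n nn; apply: aw; apply: contra nn => /andP[mn nM].
by rewrite (leq_trans mm mn) (leq_trans nM MM).
Qed.

Lemma weights_in_sum (V : nmodType) a m M M' (f : nat -> V) : weights_in a m M ->
  (M <= M')%N -> (forall n, a n = 0 -> f n = 0) ->
  \sum_(0 <= n < M') f n = \sum_(0 <= n < M) f n.
Proof.
move=> aw MM f0; apply: big_nat_supp => // n Mn; apply: f0; apply: aw.
by rewrite negb_and -leqNgt Mn orbT.
Qed.

Lemma comb_widen a x m M M' : weights_in a m M -> (M <= M')%N ->
  comb a x M' = comb a x M.
Proof.
by move=> aw MM; apply: weights_in_sum aw MM _ => n ->; rewrite scale0r.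
Qed.

Lemma combD a b x M : comb (fun n => a n + b n) x M = comb a x M + comb b x M.
Proof. by rewrite /comb -big_split; apply: eq_bigr => n _; rewrite scalerDl. Qed.

Lemma combZ k a x M : comb (fun n => k * a n) x M = k *: comb a x M.
Proof. by rewrite /comb scaler_sumr; apply: eq_bigr => n _; rewrite scalerA. Qed.

Lemma hull_convex x m : is_convex (hull x m).
Proof.
move=> y z t [M [a [aw a0 a1 ->]]] [N [b [bw b0 b1 ->]]] /andP[t0 t1].
exists (maxn M N), (fun n => t * a n + (1 - t) * b n); split.
- move=> n nn; rewrite (weights_inW (leqnn m) (leq_maxl M N) aw nn).
  by rewrite (weights_inW (leqnn m) (leq_maxr M N) bw nn) !mulr0 addr0.
- by move=> n; rewrite addr_ge0// mulr_ge0// subr_ge0.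
- rewrite big_split /= -!mulr_sumr (weights_in_sum aw (leq_maxl M N))//.
  by rewrite (weights_in_sum bw (leq_maxr M N))// a1 b1; ring.
- rewrite combD !combZ (comb_widen _ aw (leq_maxl M N)).
  by rewrite (comb_widen _ bw (leq_maxr M N)).
Qed.

Lemma hull_nonempty x m : hull x m !=set0.
Proof.
exists (x m); exists m.+1, (fun n => if n == m then 1 else 0); split.
- move=> n; case: eqVneq => // ->; by rewrite leqnn ltnSn.
- by move=> n; case: eqP.
- rewrite big_nat_recr//= eqxx big_nat_cond big1 ?add0r// => n /andP[/andP[_ nm] _].
  by rewrite ltn_eqF.
- rewrite /comb big_nat_recr//= eqxx scale1r big_nat_cond big1 ?add0r// => n /andP[/andP[_ nm] _].
  by rewrite ltn_eqF// scale0r.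
Qed.

Lemma hullS x m n : (m <= n)%N -> hull x n `<=` hull x m.
Proof.
move=> mn y [M [a [aw a0 a1 ->]]]; exists M, a; split => //.
exact: weights_inW mn (leqnn M) aw.
Qed.

Lemma half_sum_convex (th t : R) (y0 y1 z0 z1 : E) :
  t *: (2^-1 *: (y0 + th *: y1)) + (1 - t) *: (2^-1 *: (z0 + th *: z1)) =
  2^-1 *: (t *: y0 + (1 - t) *: z0 + th *: (t *: y1 + (1 - t) *: z1)).
Proof.
rewrite !scalerDr !scalerA addrACA.
by congr ((_ *: _ + _ *: _) + (_ *: _ + _ *: _)); ring.
Qed.

(** The signs of a half sum of two combinations, taken along the even and along
    the odd indices. *)
Definition interleave (e0 e1 : nat -> R) (th : R) n :=
  if odd n then th * e1 n./2 else e0 n./2.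

Lemma hull_half x (e0 e1 : nat -> R) (th : R) m y0 y1 :
  hull (fun n => e0 n *: x n.*2) m y0 -> hull (fun n => e1 n *: x n.*2.+1) m y1 ->
  hull (fun n => interleave e0 e1 th n *: x n) m (2^-1 *: (y0 + th *: y1)).
Proof.
move=> [M0 [a0 [aw0 a00 a01 ->]]] [M1 [a1 [aw1 a10 a11 ->]]].
pose M := maxn M0 M1.
exists M.*2, (fun n => 2^-1 * (if odd n then a1 n./2 else a0 n./2)); split.
- move=> n nn; suff [-> ->] : a0 n./2 = 0 /\ a1 n./2 = 0 by rewrite if_same mulr0.
    suff nn' : ~~ (m <= n./2 < M)%N.
      by split; [apply: (weights_inW (leqnn m) (leq_maxl M0 M1) aw0)|
                 apply: (weights_inW (leqnn m) (leq_maxr M0 M1) aw1)].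
    apply: contra nn => /andP[mn nM]; rewrite ltn_half_double in nM.
    by rewrite nM andbT (leq_trans mn)// -{2}(odd_double_half n) -addnn addnA leq_addl.
- by move=> n; rewrite mulr_ge0//; case: ifP.
- rewrite big_nat_double (eq_bigr (fun n => 2^-1 * a0 n + 2^-1 * a1 n)); last first.
      by move=> n _; rewrite odd_double /= odd_double /= doubleK uphalf_double.
    rewrite big_split /= -!mulr_sumr (weights_in_sum aw0 (leq_maxl M0 M1))//.
    by rewrite (weights_in_sum aw1 (leq_maxr M0 M1))// a01 a11; field.
- rewrite /comb big_nat_double -/M.
    have -> : \sum_(0 <= n < M0) a0 n *: (e0 n *: x n.*2) =
        \sum_(0 <= n < M) a0 n *: (e0 n *: x n.*2).
      by rewrite (weights_in_sum aw0 (leq_maxl M0 M1))// => n ->; rewrite scale0r.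
    have -> : \sum_(0 <= n < M1) a1 n *: (e1 n *: x n.*2.+1) =
        \sum_(0 <= n < M) a1 n *: (e1 n *: x n.*2.+1).
      by rewrite (weights_in_sum aw1 (leq_maxr M0 M1))// => n ->; rewrite scale0r.
    rewrite scaler_sumr -big_split scaler_sumr; apply: eq_bigr => n _.
    rewrite /interleave odd_double /= odd_double /= doubleK uphalf_double.
    by rewrite scalerDr !scalerA; congr (_ *: _ + _ *: _); ring.
Qed.

End combinations.

Lemma comb_norm_le {R : realType} {E : normedModType R} (a : nat -> R)
    (x : nat -> E) M : (forall n, `|x n| <= 1) ->
  `|comb a x M| <= \sum_(0 <= n < M) `|a n|.
Proof.
move=> x1; apply: le_trans (ler_norm_sum _ _ _) _; apply: ler_sum => n _.
by rewrite normrZ ler_piMr.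
Qed.

Section small_segments.
Context {R : realType} {d : Order.disp_t} {T : porderType d}.
Implicit Types (x : nat -> c00 R T) (A P Q : set T).
Hypothesis treeT : is_tree T.

(** The signs [eps] let the jumps of the limits along two subsequences cancel. *)
Definition tame x (a : R) := exists (eps : nat -> R) F l J,
  [/\ forall n, `|eps n| = 1,
      [/\ convex_ultrafilter F, F unit_ball & limit_along F l],
      forall m, F (hull (fun n => eps n *: x n) m) & jumps_l2_le l J a].

Lemma hull_unit_ball x m : (forall n, `|x n| <= 1) -> hull x m `<=` unit_ball.
Proof.
move=> x1 y [M [a [aw a0 a1 ->]]]; rewrite /unit_ball /= -a1.
apply: le_trans (comb_norm_le a M x1) _.
by apply: ler_sum => n _; rewrite ger0_norm.
Qed.

Lemma limit_exists (F : set (set (c00 R T))) : convex_ultrafilter F -> F unit_ball ->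
  exists l, limit_along F l.
Proof.
move=> cF Fb.
have /choice[l Hl] : forall A, exists r, segment A ->
    forall e, 0 < e -> F [set y | `|set_sum y A - r| <= e].
  move=> A; have [sA|] := pselect (segment A); last by exists 0.
  have [|r Hr] := cuf_limit cF (@set_sum_affine _ _ _ A) Fb (M := 1).
    by move=> y y1; exact: le_trans (segment_le y sA) y1.
  by exists r.
by exists l.
Qed.

Lemma tame_start x : (forall n, `|x n| <= 1) -> tame x 10.
Proof.
move=> x1.
have [||||F cF HF] := @convex_ultrafilter_exists R (c00 R T) (range (hull x)).
- by exists (hull x 0), 0%N.
- by move=> _ [m _ <-]; exact: hull_convex.
- by move=> _ [m _ <-]; exact: hull_nonempty.
- move=> _ _ [m _ <-] [n _ <-]; exists (hull x (maxn m n)).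
    by exists (maxn m n).
  by move=> y Hy; split; apply: hullS Hy; [exact: leq_maxl|exact: leq_maxr].
have Fx m : F (hull x m) by apply: HF; exists m.
have Fb : F unit_ball.
  exact: (cufS cF (Fx 0%N) (hull_unit_ball x1) is_convex_ball).
have [l Hl] := limit_exists cF Fb.
have [J HJ] := jumps_exist cF Fb Hl treeT.
exists (fun=> 1), F, l, J; split => //; first by move=> n; rewrite normr1.
move=> m; rewrite (_ : (fun n => _) = x)//.
by apply/funext => n; rewrite scale1r.
Qed.

Lemma sum_sqr_subseq (f : set T -> R) (r s : seq (set T)) : uniq r -> uniq s ->
  {subset r <= s} -> \sum_(Q <- r) f Q ^+ 2 <= \sum_(Q <- s) f Q ^+ 2.
Proof.
move=> ur us rs; have pr : perm_eq r [seq Q <- s | Q \in r].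
  apply: uniq_perm => //; first exact: filter_uniq.
  by move=> Q; rewrite mem_filter; case: (boolP (Q \in r)) => // /rs ->.
rewrite (perm_big _ pr) big_filter /= [leRHS](bigID (mem r)) /= lerDl.
by apply: sumr_ge0 => Q _; exact: sqr_ge0.
Qed.

(** By the parallelogram identity the two signs cannot both fail on one and the
    same finite set of paths. *)
Lemma jumps_half (l0 l1 J0 J1 : set T -> R) (a : R) :
  jumps_l2_le l0 J0 a -> jumps_l2_le l1 J1 a ->
  exists2 th : R, th = 1 \/ th = -1 &
    jumps_l2_le (fun A => (l0 A + th * l1 A) / 2)
      (fun Q => (J0 Q + th * J1 Q) / 2) (a / 2).
Proof.
move=> [j0 s0] [j1 s1].
have jump (th : R) : th = 1 \/ th = -1 -> forall Q, path Q -> Q !=set0 ->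
    is_jump (fun A => (l0 A + th * l1 A) / 2) Q ((J0 Q + th * J1 Q) / 2).
  move=> th1 Q pQ Q0 e e0.
  have [P0 [pP0 P0Q h0]] := j0 Q pQ Q0 e e0.
  have [P1 [pP1 P1Q h1]] := j1 Q pQ Q0 e e0.
  have [P' [pP' P'Q P0P' P1P']] := path_bigU pQ pP0 pP1 P0Q P1Q.
  exists P'; split => // P pP P'P PQ.
  have := h0 P pP (subset_trans P0P' P'P) PQ.
  have := h1 P pP (subset_trans P1P' P'P) PQ.
  rewrite !ler_norml => /andP[? ?] /andP[? ?].
  by case: th1 => ->; apply/andP; split; lra.
pose bound (th : R) := forall s : seq (set T), uniq s ->
  (forall Q, Q \in s -> path Q /\ Q !=set0) ->
  \sum_(Q <- s) ((J0 Q + th * J1 Q) / 2) ^+ 2 <= a / 2.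
have [b1|nb1] := pselect (bound 1).
  by exists 1; [left|split => //; apply: jump; left].
have [b2|nb2] := pselect (bound (-1)).
  by exists (-1); [right|split => //; apply: jump; right].
exfalso.
move/existsNP : nb1 => [r1 /not_implyP[ur1 /not_implyP[pr1 /negP]]]; rewrite -ltNge => big1'.
move/existsNP : nb2 => [r2 /not_implyP[ur2 /not_implyP[pr2 /negP]]]; rewrite -ltNge => big2'.
pose s := undup (r1 ++ r2).
have us : uniq s by exact: undup_uniq.
have ps Q : Q \in s -> path Q /\ Q !=set0.
  by rewrite mem_undup mem_cat => /orP[/pr1|/pr2].
have r1s : {subset r1 <= s} by move=> Q Qr; rewrite mem_undup mem_cat Qr.
have r2s : {subset r2 <= s} by move=> Q Qr; rewrite mem_undup mem_cat Qr orbT.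
have := lt_le_trans big1' (sum_sqr_subseq (fun Q => (J0 Q + 1 * J1 Q) / 2) ur1 us r1s).
have := lt_le_trans big2' (sum_sqr_subseq (fun Q => (J0 Q + -1 * J1 Q) / 2) ur2 us r2s).
have := s0 s us ps; have := s1 s us ps.
have : \sum_(Q <- s) ((J0 Q + 1 * J1 Q) / 2) ^+ 2 +
    \sum_(Q <- s) ((J0 Q + -1 * J1 Q) / 2) ^+ 2 =
    (\sum_(Q <- s) J0 Q ^+ 2 + \sum_(Q <- s) J1 Q ^+ 2) / 2.
  rewrite -!big_split /= mulr_suml; apply: eq_bigr => Q _; by field.
set X1 := \sum_(Q <- s) _; set X2 := \sum_(Q <- s) _.
set X3 := \sum_(Q <- s) _; set X4 := \sum_(Q <- s) _; lra.
Qed.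

(** The filter is generated by the half sums, with the sign [th], of the members
    of two filters for the even and the odd terms. *)
Lemma tame_half (a : R) : (forall x, (forall n, `|x n| <= 1) -> tame x a) ->
  forall x, (forall n, `|x n| <= 1) -> tame x (a / 2).
Proof.
move=> H x x1.
have [|e0 [F0 [l0 [J0 [e01 [cF0 Fb0 Hl0] Fx0 HJ0]]]]] := H (fun n => x n.*2).
  by move=> n; exact: x1.
have [|e1 [F1 [l1 [J1 [e11 [cF1 Fb1 Hl1] Fx1 HJ1]]]]] := H (fun n => x n.*2.+1).
  by move=> n; exact: x1.
have [th th1 HJ] := jumps_half HJ0 HJ1.
have thn : `|th| = 1 by case: th1 => ->; rewrite ?normrN normr1.
pose half (D0 D1 : set (c00 R T)) : set (c00 R T) :=
  [set y | exists y0 y1, [/\ D0 y0, D1 y1 & y = 2^-1 *: (y0 + th *: y1)]].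
have [||||F cF HF] := @convex_ultrafilter_exists R (c00 R T)
   [set D | exists D0 D1, [/\ F0 D0, F1 D1 & D = half D0 D1]].
- by exists (half unit_ball unit_ball), unit_ball, unit_ball.
- move=> _ [D0 [D1 [FD0 FD1 ->]]] _ _ t [y0 [y1 [Dy0 Dy1 ->]]] [z0 [z1 [Dz0 Dz1 ->]]] t01.
  exists (t *: y0 + (1 - t) *: z0), (t *: y1 + (1 - t) *: z1); split.
  + exact: (cf_convex (cuf_filter cF0) FD0).
  + exact: (cf_convex (cuf_filter cF1) FD1).
  + exact: half_sum_convex.
- move=> _ [D0 [D1 [FD0 FD1 ->]]].
  have [y0 Dy0] := cf_nonempty (cuf_filter cF0) FD0.
  have [y1 Dy1] := cf_nonempty (cuf_filter cF1) FD1.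
  by exists (2^-1 *: (y0 + th *: y1)), y0, y1.
- move=> _ _ [D0 [D1 [FD0 FD1 ->]]] [D2 [D3 [FD2 FD3 ->]]].
  exists (half (D0 `&` D2) (D1 `&` D3)).
    exists (D0 `&` D2), (D1 `&` D3); split => //.
      exact: (cf_setI (cuf_filter cF0)).
    exact: (cf_setI (cuf_filter cF1)).
  by move=> _ [y0 [y1 [[? ?] [? ?] ->]]]; split; exists y0, y1.
have Fhalf D0 D1 : F0 D0 -> F1 D1 -> F (half D0 D1).
  by move=> FD0 FD1; apply: HF; exists D0, D1.
exists (interleave e0 e1 th), F, (fun A => (l0 A + th * l1 A) / 2), (fun Q => (J0 Q + th * J1 Q) / 2).
split => //.
- by move=> n; rewrite /interleave; case: ifP => // _; rewrite normrM thn e11 mulr1.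
- split => //.
    apply: (cufS cF (Fhalf _ _ Fb0 Fb1)); last exact: is_convex_ball.
    move=> _ [y0 [y1 [b0 b1 ->]]]; rewrite /unit_ball /= normrZ.
    apply: (@le_trans _ _ (`|2^-1| * (1 + 1))).
      rewrite ler_wpM2l//; apply: le_trans (ler_normD _ _) _.
      by apply: lerD => //; rewrite normrZ thn mul1r.
    by rewrite ger0_norm// mulVf.
  move=> A sA e e_gt0.
  apply: (cufS cF (Fhalf _ _ (Hl0 A sA e e_gt0) (Hl1 A sA e e_gt0))).
    move=> _ [y0 [y1 [/= + + ->]]].
    rewrite set_sumZ set_sumD set_sumZ !ler_norml => /andP[? ?] /andP[? ?].
    by case: th1 => ->; apply/andP; split; lra.
  by apply: is_convex_slab1; exact: set_sum_affine.
- move=> m; apply: (cufS cF (Fhalf _ _ (Fx0 m) (Fx1 m))); last exact: hull_convex.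
  by move=> _ [y0 [y1 [Hy0 Hy1 ->]]]; exact: hull_half.
Qed.

Lemma tame_small x (k : R) : (forall n, `|x n| <= 1) -> 0 < k ->
  exists eps F l, [/\ forall n, `|eps n| = 1,
      [/\ convex_ultrafilter F, F unit_ball & limit_along F l],
      forall m, F (hull (fun n => eps n *: x n) m) & small_jumps l k].
Proof.
move=> x1 k0.
have tameN N : forall x, (forall n, `|x n| <= 1) -> tame x (10 / 2 ^+ N).
  elim: N => [|N IH]; first by rewrite expr0 divr1; exact: tame_start.
  by rewrite exprSr invfM mulrA; exact: tame_half.
have [N Nk] : exists N, 10 / 2 ^+ N <= k ^+ 2.
  exists (Num.truncn (10 / k ^+ 2)).
  rewrite ler_pdivrMr ?exprn_gt0// mulrC -ler_pdivrMr ?exprn_gt0//.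
  apply: ltW; apply: lt_le_trans (truncnS_gt _) _.
  by rewrite -natrX ler_nat ltn_expl.
have [eps [F [l [J [e1 [cF Fb Fl] Fx [HJ sJ]]]]]] := tameN N x x1.
exists eps, F, l; split => // Q pQ Q0 e ke.
have ek : 0 < e - k by rewrite subr_gt0.
have [P0 [pP0 P0Q h]] := HJ Q pQ Q0 (e - k) ek.
exists P0; split => // P pP P0P PQ.
have JQ : `|J Q| <= k.
  rewrite -(ler_sqr (normr_ge0 _) (ltW k0)) real_normK ?num_real//.
  have := sJ [:: Q] isT; rewrite big_seq1 => hh.
  apply: le_trans (hh _) Nk => Q'; rewrite inE => /eqP ->; by split.
have := h P pP P0P PQ; move: JQ; rewrite !ler_norml => /andP[? ?] /andP[? ?].
by apply/andP; split; lra.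
Qed.

(** Half the difference of two vectors from a filter with small jumps, the second
    one combining later terms of the sequence than the first. *)
Lemma small_segment_comb x (eta : R) m : (forall n, `|x n| <= 1) -> 0 < eta ->
  exists M a, [/\ weights_in a m M, \sum_(0 <= n < M) `|a n| = 1 &
    forall A, segment A -> `|set_sum (comb a x M) A| <= eta].
Proof.
move=> x1 eta0; have k0 : 0 < eta / 4 by rewrite divr_gt0.
have k1 : eta / 4 < eta / 2 by lra.
have [eps [F [l [e1 [cF Fb Fl] Fx hk]]]] := tame_small x1 k0.
have U := paths_uniform treeT cF Fb Fl (ltW k0) hk k1.
have [y [/= Uy [M [a [aw a0 a1 yE]]]]] := cf_nonempty (cuf_filter cF) (cf_setI (cuf_filter cF) U (Fx m)).
have [z [/= Uz [N [b [bw b0 b1 zE]]]]] := cf_nonempty (cuf_filter cF) (cf_setI (cuf_filter cF) U (Fx (maxn m M))).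
pose K := maxn M N.
have aw' : weights_in a m K by exact: weights_inW (leqnn _) (leq_maxl M N) aw.
have bw' : weights_in b m K by exact: weights_inW (leq_maxl m M) (leq_maxr M N) bw.
pose c n := 2^-1 * (eps n * (a n - b n)).
have cE : comb c x K = 2^-1 *: (y - z).
  rewrite yE zE -(comb_widen _ aw (leq_maxl M N)) -(comb_widen _ bw (leq_maxr M N)) -/K.
  rewrite /comb -sumrB scaler_sumr; apply: eq_bigr => n _.
  by rewrite /c !scalerA -scalerBl scalerA; congr (_ *: _); ring.
exists K, c; split.
- by move=> n nn; rewrite /c aw'// bw'// subr0 !mulr0.
- rewrite (eq_bigr (fun n => 2^-1 * a n + 2^-1 * b n)); last first.
    move=> n _; rewrite /c normrM normrM e1 mul1r ger0_norm// -mulrDr; congr (_ * _).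
    have [nM|Mn] := ltnP n M.
      rewrite [b n]bw ?subr0 ?addr0 ?ger0_norm//.
      by rewrite negb_and -ltnNge (leq_trans nM (leq_maxr m M)).
    by rewrite [a n]aw ?sub0r ?add0r ?normrN ?ger0_norm// negb_and -!ltnNge ltnS Mn orbT.
  rewrite big_split /= -!mulr_sumr (weights_in_sum aw (leq_maxl M N))//.
  by rewrite (weights_in_sum bw (leq_maxr M N))// a1 b1; field.
move=> A sA; have [P [Q [pP pQ [-> QP]]]] := segment_path_diff treeT sA.
have small P' : path P' -> `|set_sum (y - z) P'| <= eta.
  move=> pP'; rewrite set_sumB; have := Uy _ pP'; have := Uz _ pP'.
  by rewrite !ler_norml => /andP[? ?] /andP[? ?]; apply/andP; split; lra.
rewrite cE set_sumZ; have := small _ pP; have := small _ pQ.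
rewrite (set_sum_split (y - z) QP) !ler_norml => /andP[? ?] /andP[? ?].
by apply/andP; split; lra.
Qed.

Lemma disjoint_l1_le (v : c00 R T) n (A : 'I_n -> set T) : disjoint_segments A ->
  \sum_i `|set_sum v (A i)| <= \sum_(t <- c00_supp v) `|v t|.
Proof.
move=> [_ /trivIsetP disj].
apply: (@le_trans _ _ (\sum_(i < n) \sum_(t <- c00_supp v)
    (if t \in A i then `|v t| else 0))).
  apply: ler_sum => i _; rewrite (set_sumE _ (@c00_supp0 _ _ _ v)).
  apply: le_trans (ler_norm_sum _ _ _) _.
  by apply: ler_sum => t _; case: ifP => // _; rewrite normr0.
rewrite exchange_big /=; apply: ler_sum => t _.
have [[i ti]|nti] := pselect (exists i, t \in A i).
  rewrite (bigD1 i)//= ti big1 ?addr0// => j ji; case: ifPn => // tj.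
  have := disj j i I I ji; move/seteqP => [/(_ t) + _] => h; exfalso; apply: h.
  by split; exact: set_mem.
by rewrite big1// => i _; case: ifPn => // ti; exfalso; apply: nti; exists i.
Qed.

(** An almost orthogonality: small segment sums of [z] make the cross terms of
    [`|v + z|^2] negligible. *)
Lemma norm_add_small (v : c00 R T) : exists2 eta : R, 0 < eta &
  forall z : c00 R T, (forall A, segment A -> `|set_sum z A| <= eta) ->
    `|v + z| ^+ 2 <= `|v| ^+ 2 + `|z| ^+ 2 + 1.
Proof.
pose S := \sum_(t <- c00_supp v) `|v t|.
have S0 : 0 <= S by apply: sumr_ge0.
exists (2 * S + 1)^-1; first by rewrite invr_gt0 ltr_wpDl// mulr_ge0.
move=> z zA; pose M := Num.sqrt (`|v| ^+ 2 + `|z| ^+ 2 + 1).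
have M0 : 0 <= `|v| ^+ 2 + `|z| ^+ 2 + 1 by rewrite !addr_ge0 ?sqr_ge0.
rewrite -(sqr_sqrtr M0) ler_sqr ?nnegrE ?sqrtr_ge0//.
apply: jt_norm_sqr_le; first exact: sqrtr_ge0.
move=> n A dA; rewrite sqr_sqrtr//.
have dA' i j : i <> j -> A i `&` A j = set0.
  by move=> /eqP ij; move/trivIsetP: dA.2 => /(_ i j I I ij).
have ui : uniq (index_enum 'I_n) by exact: index_enum_uniq.
have Sv := segment_l2_le v ui (fun i _ => dA.1 i) (fun i j _ _ => @dA' i j).
have Sz := segment_l2_le z ui (fun i _ => dA.1 i) (fun i j _ _ => @dA' i j).
have cross : \sum_i 2 * (set_sum v (A i) * set_sum z (A i)) <= 1.
  apply: (@le_trans _ _ (\sum_i 2 * (2 * S + 1)^-1 * `|set_sum v (A i)|)).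
    apply: ler_sum => i _; rewrite -mulrA ler_pM2l//.
    apply: le_trans (ler_norm _) _; rewrite normrM mulrC ler_wpM2r//.
    by apply: zA; exact: dA.1.
  rewrite -mulr_sumr; apply: (@le_trans _ _ (2 * (2 * S + 1)^-1 * S)).
    rewrite ler_wpM2l//; last exact: disjoint_l1_le.
    by rewrite mulr_ge0// invr_ge0 addr_ge0// mulr_ge0.
  rewrite mulrAC ler_pdivrMr ?mul1r; first by rewrite lerDl.
  by rewrite ltr_wpDl// mulr_ge0.
have -> : \sum_i set_sum (v + z) (A i) ^+ 2 = \sum_i set_sum v (A i) ^+ 2 +
    \sum_i set_sum z (A i) ^+ 2 + \sum_i 2 * (set_sum v (A i) * set_sum z (A i)).
  by rewrite -!big_split /=; apply: eq_bigr => i _; rewrite set_sumD; ring.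
by apply: lerD => //; apply: lerD.
Qed.

(** The square of the norm of a sum of [n] successive combinations from
    [small_segment_comb] is at most [2 * n]: each new one, of norm at most 1, is
    chosen almost orthogonal to the previous sum. *)
Theorem no_l1_sequence x (c : R) : 0 < c -> (forall n, `|x n| <= 1) ->
  ~ (forall M a, c * (\sum_(0 <= n < M) `|a n|) <= `|comb a x M|).
Proof.
move=> c0 x1 low.
have build N : exists M a, [/\ weights_in a 0 M, \sum_(0 <= n < M) `|a n| = N%:R
    & `|comb a x M| ^+ 2 <= 2 * N%:R].
  elim: N => [|N [M [a [aw aN an]]]].
    exists 0%N, (fun=> 0); split => //; first by rewrite big_geq.
    by rewrite /comb big_geq// normr0 expr0n mulr0.
  have [eta eta0 Heta] := norm_add_small (comb a x M).
  have [K [b [bw b1 bs]]] := small_segment_comb M x1 eta0.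
  pose L := maxn M K.
  have aL := comb_widen x aw (leq_maxl M K).
  have bL := comb_widen x bw (leq_maxr M K).
  exists L, (fun n => a n + b n); split.
  - move=> n nn; rewrite (weights_inW (leqnn _) (leq_maxl M K) aw nn).
    by rewrite (weights_inW (leq0n _) (leq_maxr M K) bw nn) addr0.
  - rewrite -natr1 -aN -b1 -(weights_in_sum aw (leq_maxl M K) (f := fun n => `|a n|)); last first.
      by move=> n ->; rewrite normr0.
    rewrite -(weights_in_sum bw (leq_maxr M K) (f := fun n => `|b n|)); last first.
      by move=> n ->; rewrite normr0.
    rewrite -big_split; apply: eq_bigr => n _ /=.
    have [nM|Mn] := ltnP n M.
      by rewrite [b n]bw ?normr0 ?addr0// negb_and -ltnNge nM.
    by rewrite [a n]aw ?normr0 ?add0r// negb_and -!ltnNge ltnS Mn orbT.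
  - rewrite combD aL bL; apply: le_trans (Heta _ bs) _.
    have : `|comb b x K| ^+ 2 <= 1.
      by rewrite expr_le1// -b1 comb_norm_le.
    by rewrite -natr1; move: an; set u := `|comb a x M|; set w := `|comb b x K|; lra.
pose N := (Num.truncn (2 / c ^+ 2)).+1.
have [M [a [aw aN an]]] := build N.
have := low M a; rewrite aN => cN.
have N0 : 0 < N%:R :> R by rewrite ltr0n.
have : (c * N%:R) ^+ 2 <= 2 * N%:R.
  apply: le_trans an; rewrite ler_sqr ?nnegrE ?normr_ge0// mulr_ge0 ?ltW//.
rewrite exprMn [N%:R ^+ 2]expr2 mulrA ler_pM2r//.
rewrite mulrC -ler_pdivlMr ?exprn_gt0// leNgt => /negP; apply.
exact: truncnS_gt.
Qed.

End small_segments.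

(** * Dual spaces and weak convergence *)

Section dual_facts.
Context {R : realType} {V : normedModType R}.
Implicit Types (f : dual V) (x : V).

Lemma dual_le f x : `|f x| <= `|f| * `|x|.
Proof.
have [->|x0] := eqVneq x 0; first by rewrite linear0 !normr0 mulr0.
have nx : `|x| != 0 by rewrite normr_eq0.
have := dual_norm_ub f (x := `|x|^-1 *: x).
rewrite normrZ normfV normr_id mulVf// => /(_ (lexx _)).
rewrite linearZ /= normrM normfV normr_id mulrC ler_pdivrMr ?normr_gt0//.
Qed.

Lemma dual_norm_le_bound f (M : R) : 0 <= M ->
  (forall x, `|f x| <= M * `|x|) -> `|f| <= M.
Proof.
move=> M0 fM; apply: dual_norm_le => x x1; apply: le_trans (fM x) _.
by rewrite ler_piMr.
Qed.

(** If the norm of the span of the [v i] is dominated by the Hilbert norm of the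
    coefficients, test [f] on the vector with coefficients [f (v i)]. *)
Lemma dual_bessel f (I : eqType) (r : seq I) (v : I -> V) :
  (forall a : I -> R, `|\sum_(i <- r) a i *: v i| ^+ 2 <= \sum_(i <- r) a i ^+ 2) ->
  \sum_(i <- r) f (v i) ^+ 2 <= `|f| ^+ 2.
Proof.
move=> hv; set S := \sum_(i <- r) _.
have S0 : 0 <= S by apply: sumr_ge0 => i _; exact: sqr_ge0.
pose h := \sum_(i <- r) f (v i) *: v i.
have fh : f h = S.
  by rewrite /h linear_sum /=; apply: eq_bigr => i _; rewrite linearZ /= expr2.
have hS : `|h| ^+ 2 <= S by exact: hv.
have := dual_le f h; rewrite fh ger0_norm// => fle.
have h2 : S ^+ 2 <= `|f| ^+ 2 * S.
  apply: (@le_trans _ _ ((`|f| * `|h|) ^+ 2)).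
    by rewrite ler_sqr// ?nnegrE ?mulr_ge0.
  by rewrite exprMn ler_wpM2l// sqr_ge0.
have [->|S1] := eqVneq S 0; first exact: sqr_ge0.
by move: h2; rewrite expr2 ler_pM2r// lt_neqAle eq_sym S1.
Qed.

Lemma weak_cvg (F : set_system V) (x : V) : Filter F ->
  (forall f, f y @[y --> F] --> (f x : R^o)) -> F --> (x : weak V).
Proof.
move=> FF h; apply/cvg_sup => f A [B [[C oC <-] Cfx] BA].
apply: filterS BA _; apply: (h f); exact: open_nbhs_nbhs.
Qed.

(** A norm neighbourhood of [u] is a weak neighbourhood relative to the sphere. *)
Lemma kadec_cvg (N : V -> R) (x : nat -> V) (u : V) : kadec_norm N ->
  N u = 1 -> (forall n, N (x n) = 1) ->
  (forall f, f (x n) @[n --> \oo] --> (f u : R^o)) ->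
  x n @[n --> \oo] --> u.
Proof.
move=> kN Nu Nx xu A; rewrite nbhsE /= => -[B [oB Bu] BA].
have [+ _] := kN (B `&` [set y | N y = 1]).
move=> /(_ (ex_intro2 _ _ B oB erefl)) [U oU BU].
have Uu : U u.
  by have : (B `&` [set y | N y = 1]) u by []; rewrite BU => -[].
have xw : x n @[n --> \oo] --> (u : weak V) by apply: weak_cvg => f; exact: xu.
have nU : nbhs (u : weak V) U by apply: open_nbhs_nbhs.
have [K _ KU] := xw _ nU; exists K => // n Kn; apply: BA.
have : (U `&` [set y | N y = 1]) (x n) by split; [exact: KU|exact: Nx].
by rewrite -BU => -[].
Qed.

End dual_facts.

Section completion_functionals.
Context {R : realType} {E : normedModType R}.
Local Notation toc := (@to_completion R E).

(** The value at [v] is the only number within [C * `|v - toc y|] of [g y] for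
    all [y]; linearity and boundedness are read off these inequalities. *)
Lemma completion_functional (g : E -> R) (C : R) : 0 <= C ->
  (forall a x y, g (a *: x + y) = a * g x + g y) ->
  (forall x, `|g x| <= C * `|x|) ->
  exists f : dual (completion E), forall x, f (toc x) = g x.
Proof.
move=> C0 gl gC.
have gB x y : g (x - y) = g x - g y.
  by rewrite addrC -scaleN1r gl mulN1r addrC.
have /choice[h hP] : forall v : completion E, exists r, forall y, `|r - g y| <= C * `|v - toc y|.
  move=> v; elim/(@completion_ind R E) : v => u; have cg : cvg (g (u n) @[n --> \oo]).
    apply/cauchy_cvgP/(@cauchy_seqP R R^o) => e e0.
    have C1 : 0 < C + 1 by rewrite ltr_wpDl.
    have [K uK] := cauchy_sequence_cauchy u (divr_gt0 e0 C1).
    exists K => m n Km Kn; rewrite -gB; apply: le_lt_trans (gC _) _.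
    apply: (@le_lt_trans _ _ ((C + 1) * `|u m - u n|)).
      by rewrite ler_wpM2r// lerDl.
    by rewrite mulrC -ltr_pdivlMr// uK.
  exists (lim (g (u n) @[n --> \oo])) => y.
  have n1 : `|g (u n) - g y| @[n --> \oo] --> `|lim (g (u n) @[n --> \oo]) - g y|.
    by apply: cvg_norm; apply: cvgB => //; exact: cvg_cst.
  have n2 := @completion_normE _ _ (u - CauchySequence (cst_cauchy_sequence y)).
  have n3 : C * `|u n - y| @[n --> \oo] -->
     C * `|completion_class u - toc y|.
    apply: cvgMl_tmp; move: n2; rewrite -[u - _]/(u + - _) completion_classD.
    have -> : completion_class (- CauchySequence (cst_cauchy_sequence y)) = - toc y.
      by rewrite -scaleN1r completion_classZ scaleN1r.
    by [].
  apply: (ler_cvg_to n1 n3); apply: nearW => n; rewrite -gB; exact: gC.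
have hl : linear_for *%R (h : completion E -> R^o).
  move=> a x y; apply/eqP; rewrite -subr_eq0 -normr_le0; apply/ler_addgt0Pr => e e0.
  rewrite add0r.
  pose K := C * (2 * `|a| + 2) + 1.
  have K0 : 0 < K by rewrite ltr_wpDl// mulr_ge0// addr_ge0// mulr_ge0.
  have [x' xx'] := to_completion_approx x (divr_gt0 e0 K0).
  have [y' yy'] := to_completion_approx y (divr_gt0 e0 K0).
  have H1 := hP (a *: x + y) (a *: x' + y').
  have H2 := hP x x'; have H3 := hP y y'.
  have H4 : `|a *: x + y - toc (a *: x' + y')| <= `|a| * (e / K) + e / K.
    rewrite linearP opprD addrACA -scalerBr.
    apply: le_trans (ler_normD _ _) _; rewrite normrZ.
    by apply: lerD => //; rewrite ler_wpM2l.
  have -> : h (a *: x + y) - (a * h x + h y) = (h (a *: x + y) - g (a *: x' + y'))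
     - a * (h x - g x') - (h y - g y') by rewrite gl; ring.
  have ek0 : 0 <= e / K by rewrite ltW// divr_gt0.
  have S1 : `|h (a *: x + y) - g (a *: x' + y')| <= C * (`|a| * (e / K) + e / K).
    by apply: le_trans H1 _; rewrite ler_wpM2l.
  have S2 : `|a * (h x - g x')| <= `|a| * (C * (e / K)).
    rewrite normrM ler_wpM2l//; apply: le_trans H2 _; by rewrite ler_wpM2l.
  have S3 : `|h y - g y'| <= C * (e / K).
    by apply: le_trans H3 _; rewrite ler_wpM2l.
  apply: le_trans (ler_normB _ _) _; apply: le_trans (lerD (ler_normB _ _) (lexx _)) _.
  apply: le_trans (lerD (lerD S1 S2) S3) _.
  have -> : C * (`|a| * (e / K) + e / K) + `|a| * (C * (e / K)) + C * (e / K) =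
     (K - 1) * (e / K) by rewrite /K; ring.
  rewrite mulrBl mul1r; have -> : K * (e / K) = e by rewrite mulrC divfK// gt_eqF.
  by rewrite lerBlDr lerDl.
have hC v : `|h v| <= C * `|v|.
  have := hP v 0; rewrite linear0 subr0.
  have -> : g 0 = 0 by rewrite -(subrr 0) gB subrr.
  by rewrite subr0.
pose hL := GRing.isLinear.Build R (completion E) R^o *%R h hl.
pose hf : {linear completion E -> R^o | *%R} := HB.pack h hL.
have hm : h \in @continuous_scalar R (completion E).
  rewrite inE; split => //; apply: (@bounded_linear_continuous _ _ _ hf).
  apply/bounded_funP => r; exists (C * r) => v vr.
  by apply: le_trans (hC v) _; rewrite ler_wpM2l.
exists (Dual hm) => x /=.
have := hP (toc x) x; rewrite subrr normr0 mulr0 normr_le0 subr_eq0.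
by move=> /eqP.
Qed.

Lemma dual_dense_le (f : dual (completion E)) (C : R) : 0 <= C ->
  (forall x, `|f (toc x)| <= C * `|x|) -> `|f| <= C.
Proof.
move=> C0 fC; apply: dual_norm_le_bound => // v.
apply/ler_addgt0Pr => e e0.
have K0 : 0 < `|f| + C + 1 by rewrite ltr_wpDl// addr_ge0.
have [y vy] := to_completion_approx v (divr_gt0 e0 K0).
have -> : f v = f (v - toc y) + f (toc y) by rewrite linearB subrK.
apply: le_trans (ler_normD _ _) _.
have h1 := dual_le f (v - toc y); have h2 := fC y.
have h3 : `|y| <= `|v| + `|v - toc y|.
  rewrite -(to_completion_norm y) -{1}(subKr v (toc y)); exact: ler_normB.
have h4 : (`|f| + C + 1) * `|v - toc y| <= e.
  by rewrite mulrC -ler_pdivlMr.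
have h5 := ler_wpM2l C0 h3; have h6 := normr_ge0 (v - toc y).
by move: h1 h2 h4 h5; rewrite !mulrDl !mulrDr mul1r; lra.
Qed.

Lemma dual_dense_eq (f g : dual (completion E)) :
  (forall x, f (toc x) = g (toc x)) -> f = g.
Proof.
move=> fg; apply/eqP; rewrite -subr_eq0 -normr_le0.
apply: dual_dense_le => // x; rewrite mul0r.
by rewrite -[(f - g) _]/(f (toc x) - g (toc x)) fg subrr normr0.
Qed.

End completion_functionals.

(** * James tree spaces do not contain l1 *)

Section ell1_vectors.
Context {R : realType}.

Lemma finite_support_summable (a : nat -> R^o) (M : nat) :
  (forall n, (M <= n)%N -> a n = 0) ->
  series (fun n => `|a n|) n @[n --> \oo] --> \sum_(0 <= n < M) `|a n|.
Proof.
move=> a0; apply: cvg_near_cst; exists M => // n /= Mn.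
by rewrite /series /=; apply: big_nat_supp => // k Mk; rewrite a0 ?normr0.
Qed.

Lemma ell1_unit_summable (n : nat) :
  (fun m => (m == n)%:R : R^o) \in @summable_seq R.
Proof.
rewrite inE; apply/cvg_ex; eexists; apply: (@finite_support_summable _ n.+1).
by move=> m nm; rewrite gtn_eqF.
Qed.

Definition ell1_unit n : ell1 R := Ell1 (ell1_unit_summable n).

Lemma ell1_combE (a : nat -> R) M m :
  (\sum_(0 <= n < M) a n *: ell1_unit n) m = if (m < M)%N then a m else 0.
Proof.
elim: M => [|M IH]; first by rewrite big_geq.
rewrite big_nat_recr//= -[LHS]/((\sum_(0 <= n < M) a n *: ell1_unit n) m +
  a M * (m == M)%:R) IH [in RHS]ltnS [in RHS]leq_eqVlt.
by case: eqVneq => [->|_] /=; rewrite ?ltnn ?mulr1n ?mulr0n ?mulr1 ?mulr0 ?add0r ?addr0.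
Qed.

Lemma ell1_comb_norm (a : nat -> R) M :
  `|\sum_(0 <= n < M) a n *: ell1_unit n| = \sum_(0 <= n < M) `|a n|.
Proof.
rewrite -[LHS]/(ell1_norm _); apply: cvg_lim; first exact: norm_hausdorff.
have -> : \sum_(0 <= n < M) `|a n| =
    \sum_(0 <= n < M) `|(\sum_(0 <= n < M) a n *: ell1_unit n) n|.
  by apply: eq_big_nat => n /andP[_ nM]; rewrite ell1_combE nM.
apply: (@finite_support_summable (fun n => (\sum_(0 <= n < M) a n *: ell1_unit n) n)).
by move=> n Mn; rewrite ell1_combE ltnNge Mn.
Qed.

End ell1_vectors.

(** The images of the unit vectors are perturbed into the dense subspace of finitely
    supported functions, at the cost of half the lower bound. *)
Theorem JT_no_ell1 (R : realType) (d : Order.disp_t) (T : porderType d) :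
  is_tree T -> ~ contains_ell1 (JT R T).
Proof.
move=> treeT [J [c [C [c0 C0 HJ]]]].
have c2 : 0 < c / 2 by rewrite divr_gt0.
have unit1 n : `|ell1_unit n : ell1 R| = 1.
  have := ell1_comb_norm (fun m => (m == n)%:R : R) n.+1.
  rewrite !big_nat_recr//= eqxx normr1 scale1r big_nat_cond big1 ?add0r => [->|m]; last first.
    by move=> /andP[/andP[_ mn] _]; rewrite ltn_eqF// scale0r.
  rewrite big_nat_cond big1 ?add0r// => m /andP[/andP[_ mn] _].
  by rewrite ltn_eqF// normr0.
have /choice[w Hw] : forall n, exists y : c00 R T,
    `|J (ell1_unit n) - to_completion y| <= c / 2.
  by move=> n; exact: to_completion_approx.
pose B := C + c / 2; have B0 : 0 < B by rewrite addr_gt0.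
have wB n : `|B^-1 *: w n| <= 1.
  rewrite normrZ ger0_norm ?invr_ge0 ?(ltW B0)// ler_pdivrMl// mulr1.
  rewrite -to_completion_norm -(subKr (J (ell1_unit n)) (to_completion (w n))).
  apply: le_trans (ler_normB _ _) _; apply: lerD => //.
  by have /andP[_] := HJ (ell1_unit n); rewrite unit1 mulr1.
apply: (@no_l1_sequence R _ T treeT (fun n => B^-1 *: w n) (B^-1 * (c / 2))) => //.
  by rewrite mulr_gt0// invr_gt0.
move=> M a; have -> : comb a (fun n => B^-1 *: w n) M = B^-1 *: comb a w M.
  by rewrite /comb scaler_sumr; apply: eq_bigr => n _; rewrite !scalerA mulrC.
rewrite normrZ ger0_norm ?invr_ge0 ?(ltW B0)// -mulrA ler_pM2l ?invr_gt0//.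
pose S := \sum_(0 <= n < M) `|a n|; rewrite -/S.
have /andP[low _] := HJ (\sum_(0 <= n < M) a n *: ell1_unit n).
rewrite ell1_comb_norm -/S in low.
have near : `|J (\sum_(0 <= n < M) a n *: ell1_unit n) - to_completion (comb a w M)|
    <= S * (c / 2).
  rewrite /comb (linear_sum J) (linear_sum (@to_completion R (c00 R T))) -sumrB; apply: le_trans (ler_norm_sum _ _ _) _.
  rewrite /S mulr_suml; apply: ler_sum => n _.
  by rewrite [J (_ *: _)]linearZ linearZ /= -scalerBr normrZ ler_wpM2l.
rewrite -to_completion_norm.
have := ler_normD (J (\sum_(0 <= n < M) a n *: ell1_unit n) - to_completion (comb a w M))
  (to_completion (comb a w M)).
rewrite subrK; move: low near; move: (`|J _|) (`|J _ - _|) (`|to_completion _|).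
by move=> p q u; lra.
Qed.

(** * Trees that are countable unions of antichains *)

Section unit_vectors.
Context {R : realType} {d : Order.disp_t} {T : porderType d}.
Implicit Types (t : T) (f : dual (JT R T)).
Local Notation toc := (@to_completion R (c00 R T)).

Lemma c00_unit_subproof t :
  (fun s => (s == t)%:R : R^o) \in @finitely_supported R T.
Proof.
rewrite inE /=; apply: (@sub_finite_set _ _ [set t]); last exact: finite_set1.
by move=> s /=; case: eqVneq.
Qed.

Definition c00_unit t : c00 R T := C00 (c00_unit_subproof t).

Definition JT_unit t : JT R T := toc (c00_unit t).

Lemma set_sum_unit t A : set_sum (c00_unit t) A = (t \in A)%:R.
Proof.
rewrite (@set_sumE _ _ _ [fset t]%fset); last first.
  by move=> s; rewrite inE => /negbTE /= ->.
by rewrite big_seq_fset1 /= eqxx; case: (t \in A).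
Qed.

Lemma c00_sum_units (y : c00 R T) :
  y = \sum_(t <- c00_supp y) y t *: c00_unit t.
Proof.
have sumE (r : seq T) s : (\sum_(t <- r) y t *: c00_unit t : c00 R T) s =
    \sum_(t <- r) y t * (s == t)%:R.
  by elim: r => [|t r IH]; rewrite ?big_nil// !big_cons -IH.
apply/val_inj/funext => s /=; rewrite [RHS](sumE (c00_supp y) s).
have [sy|nsy] := boolP (s \in c00_supp y).
  rewrite (bigD1_seq s) ?fset_uniq//= eqxx mulr1 big1 ?addr0// => t ts.
  by rewrite eq_sym (negbTE ts) mulr0.
rewrite big_seq big1 ?c00_supp0// => t ty.
by case: eqVneq => [st|_]; [rewrite st ty in nsy|rewrite mulr0].
Qed.

Lemma JT_unit_ext (f g : dual (JT R T)) : (forall t, f (JT_unit t) = g (JT_unit t)) -> f = g.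
Proof.
move=> fg; apply: dual_dense_eq => y; rewrite (c00_sum_units y) !linear_sum /=.
by apply: eq_bigr => t _; rewrite !linearZ /= fg.
Qed.

(** A segment contains at most one point of an antichain. *)
Lemma antichain_norm_le (X : seq T) (a : T -> R) : uniq X ->
  (forall s t, s \in X -> t \in X -> (s >=< t)%O -> s = t) ->
  `|\sum_(t <- X) a t *: c00_unit t| ^+ 2 <= \sum_(t <- X) a t ^+ 2.
Proof.
move=> uX aX; set S := \sum_(t <- X) a t ^+ 2.
have S0 : 0 <= S by apply: sumr_ge0 => t _; exact: sqr_ge0.
rewrite -(sqr_sqrtr S0) ler_sqr ?nnegrE ?sqrtr_ge0//.
apply: jt_norm_sqr_le; first exact: sqrtr_ge0.
move=> n A [sA /trivIsetP disj]; rewrite sqr_sqrtr//.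
have sumA i : set_sum (\sum_(t <- X) a t *: c00_unit t) (A i) ^+ 2 =
    \sum_(t <- X) a t ^+ 2 * (t \in A i)%:R.
  rewrite set_sum_sum; under eq_bigr do rewrite set_sum_unit.
  have [[t tX tA]|nA] := pselect (exists2 t, t \in X & t \in A i); last first.
    rewrite !big_seq !big1 ?expr0n// => t tX; case: (boolP (t \in A i)) => tA;
      rewrite ?mulr0//; by exfalso; apply: nA; exists t.
  have other s : s \in X -> s != t -> (s \in A i) = false.
    move=> sX st; apply/negbTE/negP => sAi; move/eqP: st; apply.
    by apply: aX => //; apply: (sA i).1; exact: set_mem.
  have zero (F : T -> R) : \sum_(s <- X | s != t) F s * (s \in A i)%:R = 0.
    by rewrite big_seq_cond big1// => s /andP[sX st]; rewrite other// mulr0.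
  by rewrite !(bigD1_seq t)//= tA !mulr1 !zero !addr0.
under eq_bigr do rewrite sumA.
rewrite exchange_big /=; apply: ler_sum => t _; rewrite -mulr_sumr.
rewrite ler_piMr ?sqr_ge0//.
have [[i ti]|nti] := pselect (exists i, t \in A i); last first.
  rewrite big1// => i _; case: (boolP (t \in A i)) => // ti.
  by exfalso; apply: nti; exists i.
rewrite (bigD1 i)//= ti big1 ?addr0// => j ji.
case: (boolP (t \in A j)) => // tj; exfalso.
have := disj j i I I ji; move/seteqP => [/(_ t) + _] => h; apply: h.
by split; exact: set_mem.
Qed.

Lemma JT_unit_norm_le1 t : `|JT_unit t : JT R T| <= 1.
Proof.
have : `|\sum_(s <- [:: t]) 1 *: c00_unit s| ^+ 2 <= \sum_(s <- [:: t]) (1 : R) ^+ 2.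
  apply: (@antichain_norm_le [:: t] (fun=> 1)) => // s u.
  by rewrite !inE => /eqP -> /eqP ->.
rewrite !big_seq1 scale1r expr1n /JT_unit to_completion_norm.
by rewrite -[X in _ <= X -> _](expr1n R 2) ler_sqr ?nnegrE.
Qed.

Lemma antichain_l2_le f (X : seq T) : uniq X ->
  (forall s t, s \in X -> t \in X -> (s >=< t)%O -> s = t) ->
  \sum_(t <- X) f (JT_unit t) ^+ 2 <= `|f| ^+ 2.
Proof.
move=> uX aX; apply: dual_bessel => a.
have -> : \sum_(t <- X) a t *: JT_unit t = toc (\sum_(t <- X) a t *: c00_unit t).
  by rewrite linear_sum; apply: eq_bigr => t _; rewrite linearZ.
by rewrite to_completion_norm; exact: antichain_norm_le.
Qed.

End unit_vectors.

Section special_trees.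
Context {R : realType} {d : Order.disp_t} {T : porderType d} (r : T -> nat).
Hypothesis hr : forall s t : T, (s < t)%O -> r s <> r t.
Implicit Types (f g : dual (JT R T)).
Local Notation toc := (@to_completion R (c00 R T)).

Lemma level_antichain s t : r s = r t -> (s >=< t)%O -> s = t.
Proof.
move=> rst /orP[]; rewrite le_eqVlt => /predU1P[//|/hr]; first by rewrite rst.
by rewrite rst.
Qed.

Lemma level_finite f n (e : R) : 0 < e ->
  finite_set [set t | r t = n /\ e < `|f (JT_unit t)| ].
Proof.
move=> e0; apply: contrapT => /(infinite_set_fset (Num.truncn (`|f| ^+ 2 / e ^+ 2)).+1).
move=> [X XA cX].
have : \sum_(t <- X) f (JT_unit t) ^+ 2 <= `|f| ^+ 2.
  apply: antichain_l2_le; first exact: fset_uniq.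
  by move=> s t /XA [rs _] /XA [rt _]; apply: level_antichain; rewrite rs rt.
apply/negP; rewrite -ltNge.
apply: (@lt_le_trans _ _ (\sum_(t <- X) e ^+ 2)); last first.
  rewrite big_seq [leRHS]big_seq; apply: ler_sum => t /XA [_ te].
  by rewrite -[leRHS]real_normK ?num_real// ler_sqr ?nnegrE ?normr_ge0 ?(ltW e0)// ltW.
rewrite big_const_seq iter_addr_0 count_predT -[ltRHS]mulr_natl -ltr_pdivrMr ?exprn_gt0//.
apply: lt_le_trans (truncnS_gt _) _; by rewrite ler_nat.
Qed.

Definition JT_scaled_unit (t : T) : JT R T := (r t).+1%:R^-1 *: JT_unit t.

(** The scaling leaves finitely many levels to consider, and on each of them a
    functional is larger than [e] at finitely many unit vectors only. *)
Lemma scaled_units_weak_null (U : set (JT R T)) :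
  nbhs (0 : weak (JT R T)) U -> finite_set [set t | ~ U (JT_scaled_unit t)].
Proof.
pose G : set_system (JT R T) := [set W | finite_set [set t | ~ W (JT_scaled_unit t)]].
have FG : Filter G.
  split.
  - by apply: (sub_finite_set _ (finite_set0 T)) => t /=; apply.
  - move=> A B GA GB; apply: (@sub_finite_set _ _ ([set t | ~ A (JT_scaled_unit t)]
      `|` [set t | ~ B (JT_scaled_unit t)])); last by rewrite finite_setU.
    by move=> t /= /not_andP.
  - by move=> A B AB GA; apply: (sub_finite_set _ GA) => t /= nB At; apply/nB/AB.
have G0 : G --> (0 : weak (JT R T)).
  apply: weak_cvg => f; rewrite linear0; apply/cvgrPdist_le => e e0.
  change (G [set y | `|0 - f y| <= e]); rewrite /G /=.
  pose n := (Num.truncn (`|f| / e)).+1.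
  apply: (@sub_finite_set _ _ (\bigcup_(k in `I_n) [set t | r t = k /\ e < `|f (JT_unit t)| ])); last first.
    by apply: bigcup_finite => [|k _]; [exact: finite_II|exact: level_finite].
  move=> t /= /negP; rewrite -ltNge sub0r normrN /JT_scaled_unit linearZ normrM.
  rewrite ger0_norm ?invr_ge0// ltr_pdivlMl// => lt.
  have f1 : `|f (JT_unit t)| <= `|f|.
    by apply: le_trans (dual_le _ _) _; rewrite ler_piMr// JT_unit_norm_le1.
  have e1 : (r t).+1%:R * e < `|f| by exact: lt_le_trans lt f1.
  exists (r t).
    rewrite /= /n ltnS -ltnS -(ltr_nat R); apply: lt_trans (truncnS_gt _).
    by rewrite ltr_pdivlMr//; apply: le_lt_trans e1; rewrite ler_pM2r// ler_nat.
  split => //; apply: le_lt_trans lt; rewrite ler_peMl ?(ltW e0)//.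
  by rewrite ler1n.
by move=> /G0.
Qed.

(** Each weak neighbourhood of 0 contains all but finitely many points of [K], which
    makes [K] compact. *)
Theorem JT_wcg : weakly_compactly_generated (JT R T).
Proof.
pose K : set (JT R T) := range JT_scaled_unit `|` [set 0].
exists K; split.
  move=> F FF FK.
  have [cl0|] := pselect (@cluster (weak (JT R T)) F 0).
    by exists 0; split => //; right.
  move=> /existsNP[A /existsNP[U /not_implyP[FA /not_implyP[U0 /nonemptyPn AU]]]].
  have fin : finite_set (K `\` U).
    apply: (@sub_finite_set _ _ (JT_scaled_unit @` [set t | ~ U (JT_scaled_unit t)])).
      move=> _ [[[t _ <-]|->] nU]; first by exists t.
      by exfalso; apply: nU; exact: nbhs_singleton U0.
    by apply: finite_image; exact: scaled_units_weak_null.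
  have FKU : F (K `\` U).
    apply: filterS (filterI FA FK) => x [Ax Kx]; split => // Ux.
    by have : (A `&` U) x by []; rewrite AU.
  have [x [[Kx _] cx]] := @finite_compact (weak (JT R T)) _ fin F FF FKU.
  by exists x.
apply/seteqP; split => // x _ A /nbhs_ballP[e /= e0 eA].
have [y xy] := to_completion_approx x (divr_gt0 e0 (ltr0Sn _ 1)).
exists (toc y); split; last first.
  apply: eA; rewrite -ball_normE /=; apply: le_lt_trans xy _.
  by rewrite ltr_pdivrMr// ltr_pMr// ltr1n.
pose X : seq T := c00_supp y.
exists (size X), (fun i => y (tnth (in_tuple X) i) * (r (tnth (in_tuple X) i)).+1%:R),
  (fun i => JT_scaled_unit (tnth (in_tuple X) i)); split.
  by move=> i; left; exists (tnth (in_tuple X) i).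
rewrite {1}(c00_sum_units y) linear_sum /= (big_tnth _ _ (c00_supp y)) /=.
by apply: eq_bigr => i _; rewrite linearZ /= /JT_scaled_unit scalerA -mulrA mulfV ?mulr1//.
Qed.

Let w (t : T) : R := 2^-1 ^+ (r t).+1.

(** The supremum over the finite lists [X] replaces an infinite sum. *)
Definition weighted_sqr f (X : seq T) : R :=
  `|f| ^+ 2 + \sum_(t <- X) (w t * f (JT_unit t)) ^+ 2.

Lemma geometric_le1 (M : nat) : \sum_(0 <= k < M) (2^-1 ^+ k.+1 : R) <= 1.
Proof.
suff -> : \sum_(0 <= k < M) (2^-1 ^+ k.+1 : R) = 1 - 2^-1 ^+ M.
  by rewrite gerDl oppr_le0 exprn_ge0.
elim: M => [|M IH]; first by rewrite big_geq// expr0 subrr.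
by rewrite big_nat_recr//= IH exprS; field.
Qed.

(** Each level contributes at most [`|f| ^+ 2] times the square of its weight, and
    the squares of the weights of distinct levels have sum at most 1. *)
Lemma weighted_sqr_le f (X : seq T) : uniq X -> weighted_sqr f X <= 2 * `|f| ^+ 2.
Proof.
move=> uX; have -> : 2 * `|f| ^+ 2 = `|f| ^+ 2 + `|f| ^+ 2 by ring.
rewrite /weighted_sqr lerD2l.
pose M := (\max_(t <- X) r t).+1.
have rM t : t \in X -> (r t < M)%N by move=> tX; rewrite ltnS leq_bigmax_seq.
apply: (@le_trans _ _ (\sum_(t <- X) \sum_(0 <= k < M)
    (if r t == k then 2^-1 ^+ k.+1 * f (JT_unit t) ^+ 2 else 0))).
  rewrite big_seq [leRHS]big_seq; apply: ler_sum => t tX.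
  rewrite (bigD1_seq (r t)) ?iota_uniq ?mem_iota ?subn0 ?add0n ?rM//= eqxx.
  rewrite exprMn; apply: (@le_trans _ _ (2^-1 ^+ (r t).+1 * f (JT_unit t) ^+ 2)).
    rewrite ler_wpM2r ?sqr_ge0// /w expr2 ler_piMr ?exprn_ge0//.
    by rewrite exprn_ile1// invf_le1// ler1n.
  by rewrite lerDl big1// => k /negbTE; rewrite eq_sym => ->.
rewrite exchange_big /=.
apply: (@le_trans _ _ (\sum_(0 <= k < M) 2^-1 ^+ k.+1 * `|f| ^+ 2)); last first.
  by rewrite -mulr_suml ler_piMl ?sqr_ge0// geometric_le1.
apply: ler_sum => k _; rewrite -big_mkcond /= -mulr_sumr ler_wpM2l ?exprn_ge0//.
rewrite -big_filter; apply: antichain_l2_le; first exact: filter_uniq.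
move=> s t; rewrite !mem_filter => /andP[/eqP rs _] /andP[/eqP rt _].
by apply: level_antichain; rewrite rs rt.
Qed.

Lemma weighted_sqr_ge0 f X : 0 <= weighted_sqr f X.
Proof.
by rewrite addr_ge0 ?sqr_ge0// sumr_ge0// => t _; exact: sqr_ge0.
Qed.

Definition weighted_norm f : R :=
  sup [set Num.sqrt (weighted_sqr f X) | X in [set X : seq T | uniq X]].

Lemma weighted_norm_ub f X : uniq X -> Num.sqrt (weighted_sqr f X) <= weighted_norm f.
Proof.
move=> uX; apply: sup_upper_bound; last by exists X.
split; first by exists (Num.sqrt (weighted_sqr f [::])), [::].
exists (Num.sqrt (2 * `|f| ^+ 2)) => _ [Y uY <-].
by rewrite ler_wsqrtr// weighted_sqr_le.
Qed.

Lemma weighted_norm_le f (M : R) :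
  (forall X, uniq X -> Num.sqrt (weighted_sqr f X) <= M) -> weighted_norm f <= M.
Proof.
move=> fM; apply: ge_sup; first by exists (Num.sqrt (weighted_sqr f [::])), [::].
by move=> _ [X uX <-]; exact: fM.
Qed.

Lemma weighted_norm_ge f : `|f| <= weighted_norm f.
Proof.
apply: le_trans (weighted_norm_ub f (X := [::]) isT).
by rewrite /weighted_sqr big_nil addr0 sqrtr_sqr normr_id.
Qed.

Lemma weighted_normD f g : weighted_norm (f + g) <= weighted_norm f + weighted_norm g.
Proof.
apply: weighted_norm_le => X uX.
apply: le_trans (lerD (weighted_norm_ub f uX) (weighted_norm_ub g uX)).
pose z f (o : option T) : R := if o is Some t then w t * f (JT_unit t) else `|f|.
have zE f' : weighted_sqr f' X = \sum_(o <- None :: map Some X) z f' o ^+ 2.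
  by rewrite big_cons big_map.
have zT f' : weighted_sqr f' X =
    \sum_(i < size (None :: map Some X)) z f' (tnth (in_tuple (None :: map Some X)) i) ^+ 2.
  by rewrite zE (big_tnth _ _ (None :: map Some X)).
apply: (@le_trans _ _ (Num.sqrt (\sum_(i < size (None :: map Some X))
   (z f (tnth (in_tuple (None :: map Some X)) i) +
    z g (tnth (in_tuple (None :: map Some X)) i)) ^+ 2))); last first.
  by rewrite !zT; exact: l2_triangle.
rewrite ler_wsqrtr// -(big_tnth _ _ (None :: map Some X) xpredT (fun o => (z f o + z g o) ^+ 2)) zE.
rewrite !big_cons !big_map; apply: lerD.
  by rewrite /= ler_sqr ?nnegrE ?addr_ge0// ler_normD.
by apply: ler_sum => t _; rewrite /= -mulrDr.
Qed.

Lemma weighted_normZ (a : R) f : weighted_norm (a *: f) = `|a| * weighted_norm f.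
Proof.
have le b g : weighted_norm (b *: g) <= `|b| * weighted_norm g.
  apply: weighted_norm_le => X uX.
  apply: le_trans (ler_wpM2l (normr_ge0 b) (weighted_norm_ub g uX)).
  have -> : weighted_sqr (b *: g) X = b ^+ 2 * weighted_sqr g X.
    rewrite /weighted_sqr mulrDr normrZ exprMn real_normK ?num_real//; congr (_ + _).
    rewrite mulr_sumr; apply: eq_bigr => t _.
    by rewrite -[(b *: g) _]/(b * g (JT_unit t)); ring.
  by rewrite sqrtrM ?sqr_ge0// sqrtr_sqr.
apply/eqP; rewrite eq_le le /=.
have [->|a0] := eqVneq a 0.
  rewrite normr0 mul0r; apply: le_trans (normr_ge0 _) (weighted_norm_ge _).
rewrite -ler_pdivlMl ?normr_gt0//; have := le a^-1 (a *: f).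
by rewrite scalerA mulVf// scale1r normfV.
Qed.

(** By the parallelogram identity of the Hilbert part, unit vectors [f] and [g]
    with different coefficients at [t] satisfy
    [weighted_norm (f + g) ^+ 2 <= 4 - dt] with [dt > 0]. *)
Theorem JT_dual_strictly_convex : exists N : dual (JT R T) -> R,
  equivalent_norm N /\ strictly_convex_norm N.
Proof.
exists weighted_norm; split.
  split; [exact: weighted_normD|exact: weighted_normZ|].
  exists 1, 2; split => // f; rewrite mul1r weighted_norm_ge /=.
  apply: weighted_norm_le => X uX.
  rewrite -[leRHS]ger0_norm ?mulr_ge0// -sqrtr_sqr ler_wsqrtr//.
  apply: le_trans (weighted_sqr_le f uX) _; rewrite exprMn ler_wpM2r ?sqr_ge0//.
  by rewrite expr2; lra.
move=> f g /eqP fg N1.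
have Nf : weighted_norm f = 1.
  by have := N1 0; rewrite lexx ler01 subr0 scale1r scale0r addr0 => ->.
have Ng : weighted_norm g = 1.
  by have := N1 1; rewrite lexx ler01 subrr scale1r scale0r add0r => ->.
have h01 : 0 <= (2^-1 : R) <= 1 by rewrite invr_ge0 ler0n invf_le1 ?ler1n.
have Nfg : weighted_norm (f + g) = 2.
  have := N1 _ h01; have -> : 1 - 2^-1 = 2^-1 :> R by field.
  rewrite -scalerDr weighted_normZ ger0_norm ?invr_ge0// => /(congr1 ( *%R 2)).
  by rewrite mulrA mulfV// mul1r mulr1.
have [t ft] : exists t, f (JT_unit t) != g (JT_unit t).
  apply: contrapT => nt; apply: fg; apply: JT_unit_ext => t.
  by apply/eqP/negPn/negP => tfg; apply: nt; exists t.
pose dt := (w t * (f (JT_unit t) - g (JT_unit t))) ^+ 2.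
have dt0 : 0 < dt.
  by rewrite exprn_even_gt0//= mulf_neq0 ?subr_eq0// expf_neq0.
have sq1 h X : weighted_norm h = 1 -> uniq X -> weighted_sqr h X <= 1.
  move=> Nh uX; have := weighted_norm_ub h uX; rewrite Nh => h1.
  rewrite -(sqr_sqrtr (weighted_sqr_ge0 h X)) expr_le1 ?sqrtr_ge0//.
have bound X : uniq X -> weighted_sqr (f + g) X <= 4 - dt.
  move=> uX; pose Y := if t \in X then X else t :: X.
  have uY : uniq Y by rewrite /Y; case: ifPn => //= ->.
  have tY : t \in Y by rewrite /Y; case: ifPn => // _; rewrite mem_head.
  apply: (@le_trans _ _ (weighted_sqr (f + g) Y)).
    rewrite /weighted_sqr lerD2l /Y; case: ifPn => // _.
    by rewrite big_cons lerDr sqr_ge0.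
  have := sq1 _ _ Nf uY; have := sq1 _ _ Ng uY.
  have : dt <= \sum_(s <- Y) (w s * (f (JT_unit s) - g (JT_unit s))) ^+ 2.
    rewrite (bigD1_seq t)//= lerDl; apply: sumr_ge0 => s _; exact: sqr_ge0.
  have : \sum_(s <- Y) (w s * dual_fun (f + g) (JT_unit s)) ^+ 2 +
      \sum_(s <- Y) (w s * (f (JT_unit s) - g (JT_unit s))) ^+ 2 =
      2 * \sum_(s <- Y) (w s * f (JT_unit s)) ^+ 2 +
      2 * \sum_(s <- Y) (w s * g (JT_unit s)) ^+ 2.
    rewrite !mulr_sumr -!big_split /=; apply: eq_bigr => s _.
    by rewrite fctE; ring.
  have : `|f + g| ^+ 2 <= 2 * `|f| ^+ 2 + 2 * `|g| ^+ 2.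
    apply: (@le_trans _ _ ((`|f| + `|g|) ^+ 2)).
      by rewrite ler_sqr ?nnegrE ?addr_ge0// ler_normD.
    by have := sqr_ge0 (`|f| - `|g|); nra.
  rewrite /weighted_sqr; set a1 := `|f + g| ^+ 2; set a2 := \sum_(s <- Y) _.
  set a3 := \sum_(s <- Y) _; set a4 := \sum_(s <- Y) _; set a5 := \sum_(s <- Y) _.
  by lra.
have b0 : 0 <= 4 - dt by apply: le_trans (bound [::] isT); exact: weighted_sqr_ge0.
have : weighted_norm (f + g) <= Num.sqrt (4 - dt).
  by apply: weighted_norm_le => X uX; rewrite ler_wsqrtr// bound.
rewrite Nfg => h2; have : 2 ^+ 2 <= Num.sqrt (4 - dt) ^+ 2 by rewrite ler_sqr ?nnegrE ?sqrtr_ge0.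
by rewrite sqr_sqrtr// expr2; lra.
Qed.

End special_trees.

(** * Disjoint segments in the dual *)

Section disjoint_functionals.
Context {R : realType} {d : Order.disp_t} {T : porderType d}.
Local Notation toc := (@to_completion R (c00 R T)).
Implicit Types (f : dual (JT R T)) (A : set T).

Lemma segment_functional A : segment A ->
  exists f : dual (JT R T), forall y, f (toc y) = set_sum y A.
Proof.
move=> sA; apply: (@completion_functional _ _ _ 1) => //.
  by move=> a x y; rewrite set_sumD set_sumZ.
by move=> x; rewrite mul1r; exact: segment_le.
Qed.

Variables (f : nat -> dual (JT R T)) (A : nat -> set T).
Hypotheses (fA : forall n y, f n (toc y) = set_sum y (A n))
  (sA : forall n, segment (A n)) (dA : forall m n, m <> n -> A m `&` A n = set0).

(** Cauchy-Schwarz against the segment sums of a vector. *)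
Lemma disjoint_comb_norm_le (r : seq nat) (a : nat -> R) : uniq r ->
  `|\sum_(n <- r) a n *: f n| ^+ 2 <= \sum_(n <- r) a n ^+ 2.
Proof.
move=> ur; set S := \sum_(n <- r) a n ^+ 2.
have S0 : 0 <= S by apply: sumr_ge0 => n _; exact: sqr_ge0.
rewrite -(sqr_sqrtr S0) ler_sqr ?nnegrE ?sqrtr_ge0//.
apply: dual_dense_le; first exact: sqrtr_ge0.
move=> y; have -> : dual_fun (\sum_(n <- r) a n *: f n) (toc y) =
    \sum_(n <- r) a n * set_sum y (A n).
  elim: (r) => [|n s IH]; first by rewrite !big_nil.
  by rewrite !big_cons -IH -fA.
rewrite -ler_sqr ?nnegrE ?mulr_ge0 ?sqrtr_ge0// exprMn sqr_sqrtr// real_normK ?num_real//.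
have Sy : \sum_(n <- r) set_sum y (A n) ^+ 2 <= `|y| ^+ 2.
  by apply: segment_l2_le => // i j _ _; exact: dA.
apply: (@le_trans _ _ (S * \sum_(n <- r) set_sum y (A n) ^+ 2)); last by rewrite ler_wpM2l.
(* Cauchy-Schwarz, from the discriminant of a nonnegative square *)
set P := \sum_(n <- r) a n * _; set Q := \sum_(n <- r) set_sum y (A n) ^+ 2.
have Q0 : 0 <= Q by apply: sumr_ge0 => n _; exact: sqr_ge0.
have key t : 0 <= S + 2 * t * P + t ^+ 2 * Q.
  have -> : S + 2 * t * P + t ^+ 2 * Q = \sum_(n <- r) (a n + t * set_sum y (A n)) ^+ 2.
    by rewrite /S /P /Q !mulr_sumr -!big_split /=; apply: eq_bigr => n _; ring.
  by apply: sumr_ge0 => n _; exact: sqr_ge0.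
have [Q00|Q1] := eqVneq Q 0.
  have P0 : P = 0.
    apply/eqP/negPn/negP => P1; have := key (- (S + 1) / (2 * P)).
    rewrite Q00 mulr0 addr0; have -> : 2 * (- (S + 1) / (2 * P)) * P = - (S + 1) by field.
    by lra.
  by rewrite P0 expr0n mulr_ge0.
have Qp : 0 < Q by rewrite lt_neqAle eq_sym Q1.
have := key (- P / Q).
have -> : S + 2 * (- P / Q) * P + (- P / Q) ^+ 2 * Q = (S * Q - P ^+ 2) / Q by field.
by rewrite pmulr_lge0 ?invr_gt0// subr_ge0.
Qed.

Lemma disjoint_l2_le (g : dual (dual (JT R T))) (r : seq nat) : uniq r ->
  \sum_(n <- r) g (f n) ^+ 2 <= `|g| ^+ 2.
Proof. by move=> ur; apply: dual_bessel => a; exact: disjoint_comb_norm_le. Qed.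

(** A set of indices whose finite subsets have bounded size is finite. *)
Lemma eventually_not (B : set nat) (b : R) :
  (forall r : seq nat, uniq r -> (forall n, n \in r -> B n) -> (size r)%:R <= b) ->
  \forall n \near \oo, ~ B n.
Proof.
move=> H; have fB : finite_set B.
  apply: contrapT => /(infinite_set_fset (Num.truncn b).+1)[X XB cX].
  have := H X (fset_uniq X) (fun n nX => XB n nX).
  apply/negP; rewrite -ltNge; apply: lt_le_trans (truncnS_gt _) _.
  by rewrite ler_nat.
have /finite_seqP[s Bs] := fB.
exists (\max_(n <- s) n).+1 => // n /= sn; rewrite Bs /= => ns.
have : (n <= \max_(k <- s) k)%N by rewrite leq_bigmax_seq.
by rewrite leqNgt sn.
Qed.

Lemma disjoint_weak_null (g : dual (dual (JT R T))) :
  g (f n) @[n --> \oo] --> (0 : R^o).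
Proof.
apply/cvgrPdist_le => e e0; have e20 : 0 < e ^+ 2 by rewrite exprn_gt0.
have : \forall n \near \oo, ~ (e < `|g (f n)|).
  apply: (@eventually_not _ (`|g| ^+ 2 / e ^+ 2)) => r ur Br.
  rewrite ler_pdivlMr//; apply: le_trans (disjoint_l2_le g ur).
  rewrite mulr_natl -count_predT -iter_addr_0 -big_const_seq.
  rewrite big_seq [leRHS]big_seq; apply: ler_sum => n /Br /= lt.
  by rewrite -[leRHS]real_normK ?num_real// ler_sqr ?nnegrE ?normr_ge0 ?(ltW e0)// ltW.
by apply: filterS => n /negP; rewrite -leNgt sub0r normrN.
Qed.

(** If [N (u + f n)] stays below [N u], then so does [N] at the averages
    [u + (f n_1 + ... + f n_k) / k], which tend to [u] in norm. *)
Lemma disjoint_norm_liminf (N : dual (JT R T) -> R) (u : dual (JT R T)) (e : R) :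
  equivalent_norm N -> 0 < e -> \forall n \near \oo, N u - e <= N (u + f n).
Proof.
move=> [ND NZ [c [C [c0 C0 NC]]]] e0.
suff : \forall n \near \oo, ~ (N (u + f n) < N u - e).
  by apply: filterS => n /negP; rewrite -leNgt.
apply: (@eventually_not _ (C ^+ 2 / e ^+ 2)) => r ur Br; rewrite ler_pdivlMr ?exprn_gt0//.
have [->|k0] := eqVneq (size r) 0%N; first by rewrite mul0r sqr_ge0.
have kp : 0 < (size r)%:R :> R by rewrite ltr0n lt0n.
pose k : R := (size r)%:R; rewrite -/k in kp *.
pose s := \sum_(n <- r) f n.
have sk : `|s| ^+ 2 <= k.
  have := disjoint_comb_norm_le (fun=> 1) ur; under eq_bigr do rewrite scale1r.
  by rewrite big_const_seq iter_addr_0 count_predT expr1n.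
have Nsum : N (k *: u + s) <= k * (N u - e).
  rewrite /k /s; elim: (r) Br => [|n r' IH] Br.
    rewrite big_nil scale0r addr0 mul0r -(scale0r 0) NZ normr0 mul0r//.
  rewrite big_cons /= -natr1 scalerDl scale1r [X in N (_ + X)]addrC addrACA mulrDl mul1r.
  apply: le_trans (ND _ _) _; apply: lerD; last by apply/ltW/Br; rewrite mem_head.
  by apply: IH => m mr; apply: Br; rewrite inE mr orbT.
have Nku : k * N u <= N (k *: u + s) + C * `|s|.
  have -> : k * N u = N (k *: u) by rewrite NZ ger0_norm// ltW.
  rewrite -{1}(addrK s (k *: u)); apply: le_trans (ND _ _) _.
  rewrite lerD2l -scaleN1r NZ normrN1 mul1r; by have /andP[] := NC s.
have ke : k * e <= C * `|s| by move: Nku Nsum; rewrite mulrBr; lra.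
have : (k * e) ^+ 2 <= C ^+ 2 * k.
  apply: (@le_trans _ _ ((C * `|s|) ^+ 2)).
    by rewrite ler_sqr ?nnegrE ?mulr_ge0 ?(ltW kp) ?(ltW e0) ?(ltW C0).
  by rewrite exprMn ler_wpM2l ?sqr_ge0.
have -> : (k * e) ^+ 2 = (k * e ^+ 2) * k by ring.
by rewrite ler_pM2r.
Qed.

End disjoint_functionals.

(** * Paths of the tree of well-ordered sets of rationals *)

Section sigmaQ_paths.
Implicit Types (a b : set rat) (t s : sigmaQ) (q x y : rat).

Lemma sigmaQ_max t : exists2 m, val t m & forall x, val t x -> x <= m.
Proof. by have := valP t; rewrite inE => -[]. Qed.

(** The maximum strictly increases along the tree. *)
Lemma sigmaQ_rank : exists r : sigmaQ -> nat, forall s t, (s < t)%O -> r s <> r t.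
Proof.
have /choice[m Hm] : forall t, exists m, val t m /\ forall x, val t x -> x <= m.
  by move=> t; have [m] := sigmaQ_max t; exists m.
exists (fun t => choice.pickle (m t)) => s t /asboolP[[st ist] nst] /(pcan_inj choice.pickleK) e.
apply: nst; apply/seteqP; split => // x tx.
have := (Hm t).2 _ tx; rewrite -e le_eqVlt => /predU1P[->|xs]; first exact: (Hm s).1.
exact: ist tx (Hm s).1 xs.
Qed.

Lemma initial_segment_trans a b (c : set rat) :
  initial_segment a b -> initial_segment b c -> initial_segment a c.
Proof.
move=> [ab iab] [bc ibc]; split; first by move=> x /ab /bc.
by move=> x y cx ay xy; apply: (iab x y) => //; apply: (ibc x y) => //; exact: ab.
Qed.

Definition Qpath a : set sigmaQ := [set t | initial_segment (val t) a].

Lemma Qpath_path a : path (Qpath a).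
Proof.
split; last first.
  move=> s t at_; rewrite le_eqVlt => /predU1P[->//|/asboolP[st _]].
  exact: initial_segment_trans st at_.
move=> s t [sa ia] [ta ita]; have [|nst] := pselect (val s `<=` val t).
  have [/val_inj -> _|nst st] := pselect (val s = val t); first exact: comparablexx.
  apply/orP; left; rewrite le_eqVlt; apply/orP; right; apply/asboolP; split => //.
  by split => // x y tx; apply: ia; exact: ta.
have ts : val t `<=` val s.
  move/existsNP : nst => [x /not_implyP[sx ntx]] y ty.
  have [yx|xy|xy] := ltgtP y x.
  - by apply: ia sx yx; exact: ta.
  - by exfalso; apply: ntx; apply: ita ty xy; exact: sa.
  - by rewrite xy.
apply/orP; right; rewrite le_eqVlt; apply/orP; right; apply/asboolP; split.
  by split => // x y sx; apply: ita; exact: sa.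
by move=> e; apply: nst; rewrite e.
Qed.

Lemma QpathS a b : initial_segment a b -> Qpath a `<=` Qpath b.
Proof. by move=> ab t ta; exact: initial_segment_trans ta ab. Qed.

(** Past [a], the set [b] continues with [q]. *)
Lemma Qpath_diff_mem a b q t : initial_segment (a `|` [set q]) b ->
  Qpath b t -> ~ Qpath a t -> val t q.
Proof.
move=> [ab iab] [tb itb] nta.
have [x tx nax] : exists2 x, val t x & ~ a x.
  apply: contrapT => nx; apply: nta; split.
    by move=> x tx; apply: contrapT => nax; apply: nx; exists x.
  by move=> x y ax; apply: itb; apply: ab; left.
have [xq|qx|<-//] := ltgtP x q.
  have [//|xq'] : (a `|` [set q]) x by apply: (iab x q) => //; [exact: tb|right].
  by move: xq; rewrite xq' ltxx.
by apply: itb tx qx; apply: ab; right.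
Qed.

Lemma Qpath_diff_disjoint a b b' q q' : initial_segment (a `|` [set q]) b ->
  initial_segment (a `|` [set q']) b' -> (forall x, a x -> x < q) -> q < q' ->
  (Qpath b `\` Qpath a) `&` (Qpath b' `\` Qpath a) = set0.
Proof.
move=> ab ab' aq qq'; apply/seteqP; split => // t [[tb nta] [tb' _]].
have tq := Qpath_diff_mem ab tb nta.
have [/aq|/eqP] : (a `|` [set q']) q.
  by apply: (ab'.2 q q') => //; [exact: tb'.1|right].
  by rewrite ltxx.
by rewrite lt_eqF.
Qed.

Lemma well_orderedS a b : well_ordered b -> a `<=` b -> well_ordered a.
Proof. by move=> wb ab B Ba; apply: wb => x /Ba /ab. Qed.

Lemma well_ordered_top a q : well_ordered a -> (forall x, a x -> x < q) ->
  well_ordered (a `|` [set q]).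
Proof.
move=> wa aq B BA [z Bz].
have [[y [By ay]]|nB] := pselect (exists y, B y /\ a y); last first.
  have Bq : forall x, B x -> x = q.
    move=> x Bx; have [ax|//] := BA _ Bx.
    by exfalso; apply: nB; exists x.
  by exists q => [|x /Bq ->//]; rewrite -(Bq _ Bz).
have [||m [Bm am] mmin] := wa (B `&` a); [by move=> x []|by exists y|].
exists m => // x Bx; have [ax|->] := BA _ Bx; first exact: mmin.
by apply: ltW; exact: aq.
Qed.

Lemma Qpath_new_node a b q : well_ordered a -> (forall x, a x -> x < q) ->
  initial_segment (a `|` [set q]) b -> exists t, Qpath b t /\ ~ Qpath a t.
Proof.
move=> wa aq ab.
have aqP : (a `|` [set q]) \in [set t : set rat | well_ordered t /\
    exists2 m, t m & forall x, t x -> x <= m].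
  rewrite inE; split; first exact: well_ordered_top.
  by exists q; [right|move=> x [/aq/ltW|->]].
pose t : sigmaQ := exist _ (a `|` [set q]) aqP.
exists t; split => // -[/= sub _].
have /aq : a q by apply: sub; right.
by rewrite ltxx.
Qed.

(** * A transfinite recursion inside the rationals *)

Section recursion.
Context {R : realType} (phi : set rat -> R) (e : set rat -> R) (F : set rat -> seq rat).
Hypotheses (e0 : forall a, well_ordered a -> 0 < e a)
  (gap : forall a q b, well_ordered a -> well_ordered b -> q \notin F a ->
    (forall x, a x -> x < q) -> initial_segment (a `|` [set q]) b ->
    phi a + e a <= phi b).

(** Shrink the interval until it contains no element of [s]. *)
Lemma rat_avoiding (u v : R) (s : seq rat) : u < v ->
  exists q : rat, q \notin s /\ u < ratr q < v.
Proof.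
move=> uv; have [w [uw wv ws]] : exists w, [/\ u < w, w <= v &
    forall q, q \in s -> u < ratr q -> w <= ratr q].
  elim: s => [|q s [w [uw wv ws]]]; first by exists v.
  have [uq|qu] := ltP u (ratr q).
    exists (Num.min w (ratr q)); split.
    - by rewrite lt_min uw uq.
    - by rewrite ge_min wv.
    - move=> q'; rewrite inE => /predU1P[->|q's] uq'; first by rewrite ge_min lexx orbT.
      by rewrite ge_min ws.
  exists w; split => // q'; rewrite inE => /predU1P[->|q's] uq'; last exact: ws.
  by move: uq'; rewrite ltNge qu.
have [q] := rat_in_itvoo uw; rewrite in_itv /= => /andP[uq qw].
exists q; rewrite uq (lt_le_trans qw wv); split => //.
by apply/negP => /ws /(_ uq); rewrite leNgt qw.
Qed.

(** Zermelo's argument: call [a] good if each of its elements is [h] of the set of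
    the smaller ones. The gaps make [h a] larger than the elements of a good [a];
    good sets are initial segments of one another, so their union [A] is good, and
    so is [A] with [h A] added, whence [h A] would belong to [A]. *)
Theorem no_gap_function : False.
Proof.
have /choice[h hP] : forall a, exists q : rat, well_ordered a ->
    q \notin F a /\ phi a < ratr q < phi a + e a.
  move=> a; have [wa|] := pselect (well_ordered a); last by exists 0.
  have [|q qP] := @rat_avoiding (phi a) (phi a + e a) (F a); first by rewrite ltrDl e0.
  by exists q.
pose cut a x : set rat := [set y | a y /\ y < x].
pose good a := well_ordered a /\ forall x, a x -> x = h (cut a x).
have wcut a x : well_ordered a -> well_ordered (cut a x).
  by move=> wa; apply: well_orderedS wa _ => y [].
have top a : good a -> forall x, a x -> x < h a.
  move=> [wa ha] x ax; rewrite -(ltr_rat R).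
  have [nF /andP[_ lt]] := hP _ (wcut _ x wa).
  have [_ /andP[lt2 _]] := hP _ wa.
  rewrite {1}(ha _ ax); apply: lt_trans lt _; apply: le_lt_trans lt2.
  apply: (@gap (cut a x) x a) => //; first exact: wcut.
  - by rewrite {1}(ha _ ax).
  - by move=> y [].
  - split; first by move=> y [[]//|->].
    move=> y z ay [[_ zx]|->] yz; left; split => //; exact: lt_trans zx.
have compare a b : good a -> good b -> initial_segment a b \/ initial_segment b a.
  move=> [wa ha] [wb hb].
  pose B := [set x | a x /\ ~ (b x /\ cut a x = cut b x)].
  have [B0|/set0P B0] := eqVneq B set0.
    have ab x : a x -> b x /\ cut a x = cut b x.
      move=> ax; apply: contrapT => nb; have : B x by [].
      by rewrite B0.
    left; split; first by move=> x /ab[].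
    move=> x y bx ay xy; have [_ cxy] := ab _ ay.
    by have : cut b y x by []; rewrite -cxy => -[].
  have [|x [ax nx] xmin] := wa B _ B0; first by move=> x [].
  have below y : a y -> y < x -> b y /\ cut a y = cut b y.
    move=> ay yx; apply: contrapT => ny; have : B y by [].
    by move=> /xmin; rewrite leNgt yx.
  have ini : initial_segment (cut a x) b.
    split; first by move=> y [ay yx]; have [] := below _ ay yx.
    move=> z y bz [ay yx] zy; have [_ cy] := below _ ay yx.
    have : cut b y z by [].
    by rewrite -cy => -[az _]; split => //; exact: lt_trans yx.
  pose D := b `\` cut a x.
  have [D0|/set0P D0] := eqVneq D set0.
    right; have ba y : b y -> cut a x y.
      move=> b_y; apply: contrapT => ncy; have : D y by [].
      by rewrite D0.
    split; first by move=> y /ba[].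
    move=> z y az /ba[_ yx] zy.
    by apply: (ini.1 z); split => //; exact: lt_trans yx.
  have [|z [bz ncz] zmin] := wb D _ D0; first by move=> y [].
  have cE : cut b z = cut a x.
    apply/seteqP; split => y.
      move=> [b_y yz]; apply: contrapT => ncy; have : D y by [].
      by move=> /zmin; rewrite leNgt yz.
    move=> cy; split; first exact: ini.1.
    rewrite ltNge; apply/negP; rewrite le_eqVlt => /predU1P[zy|zy].
      by apply: ncz; rewrite zy.
    by apply: ncz; exact: ini.2 bz cy zy.
  have zx : z = x by rewrite (hb _ bz) cE -ha.
  exfalso; apply: nx; rewrite -zx; split => //.
  by rewrite cE zx.
pose A := \bigcup_(a in good) a.
have cutA a x : good a -> a x -> cut A x = cut a x.
  move=> ga ax; apply/seteqP; split => y; last by move=> [ay yx]; split => //; exists a.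
  move=> [[a' ga' a'y] yx]; split => //.
  by have [[_ ini]|[ini _]] := compare _ _ ga ga'; [exact: ini yx|exact: ini].
have gA : good A.
  split; last first.
    move=> x [a ga ax]; rewrite (cutA a)//; exact: ga.2.
  move=> B BA [b Bb]; have [a ga ab] := BA _ Bb.
  have [||m [Bm am] mmin] := ga.1 (B `&` a); [by move=> x []|by exists b|].
  exists m => // x Bx; rewrite leNgt; apply/negP => xm.
  have : cut A m x by split => //; exact: BA.
  rewrite (cutA a)// => -[ax _].
  by have := mmin x; rewrite leNgt xm => /(_ (conj Bx ax)).
have gA' : good (A `|` [set h A]).
  split; first exact: well_ordered_top gA.1 (top _ gA).
  move=> x [Ax|->].
    have -> : cut (A `|` [set h A]) x = cut A x; last exact: gA.2.
    apply/seteqP; split => y; last by move=> [Ay yx]; split => //; left.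
    move=> [[//|->] hx]; have := lt_trans (top _ gA _ Ax) hx.
    by rewrite ltxx.
  congr h; apply/seteqP; split => y; first by move=> Ay; split; [left|exact: top].
  by move=> [[//|->]]; rewrite ltxx.
have : A (h A) by exists (A `|` [set h A]) => //; right.
by move=> /(top _ gA); rewrite ltxx.
Qed.

End recursion.

End sigmaQ_paths.

(** * No equivalent Kadec norm on the dual *)

Section no_kadec.
Context {R : realType}.
Local Notation X := (JT R sigmaQ).
Local Notation toc := (@to_completion R (c00 R sigmaQ)).
Variable N : dual X -> R.
Hypotheses (equivN : equivalent_norm N) (kadecN : kadec_norm N).
Variable pf : set rat -> dual X.
Hypothesis pfE : forall a y, pf a (toc y) = set_sum y (Qpath a).

Lemma end_extension (a b : set rat) (q : rat) : (forall x, a x -> x < q) ->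
  initial_segment (a `|` [set q]) b -> initial_segment a b.
Proof.
move=> aq; apply: initial_segment_trans; split; first by move=> x; left.
move=> x y [//|->] ay qy.
by have := lt_trans (aq _ ay) qy; rewrite ltxx.
Qed.

Lemma pf_diff (a b : set rat) : initial_segment a b ->
  forall y, (pf b - pf a) (toc y) = set_sum y (Qpath b `\` Qpath a).
Proof.
move=> ab y; rewrite -[LHS]/(pf b (toc y) - pf a (toc y)) !pfE.
by rewrite (set_sum_split y (QpathS ab)) addrC addKr.
Qed.

Lemma dual_norm_ge1 (f : dual X) (A : set sigmaQ) t :
  (forall y, f (toc y) = set_sum y A) -> A t -> 1 <= `|f|.
Proof.
move=> fA At; have := dual_le f (JT_unit t).
rewrite fA set_sum_unit mem_set// normr1 => /le_trans; apply.
by rewrite ler_piMr// JT_unit_norm_le1.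
Qed.

(** Branching off [a] in infinitely many directions gives functionals [pf b]
    converging to [pf a] weakly but not in norm; the Kadec property then keeps
    their norms away from [N (pf a)], up to finitely many directions. *)
Lemma kadec_gap (a : set rat) : well_ordered a ->
  exists (e : R) (F : seq rat), 0 < e /\
  forall q b, well_ordered b -> q \notin F -> (forall x, a x -> x < q) ->
    initial_segment (a `|` [set q]) b -> N (pf a) + e <= N (pf b).
Proof.
have [ND NZ [c [C [c0 C0 NC]]]] := equivN => wa.
have pf1 q b : (forall x, a x -> x < q) -> initial_segment (a `|` [set q]) b ->
    1 <= `|pf b| /\ 1 <= `|pf b - pf a|.
  move=> aq ab; have [t [bt nat]] := Qpath_new_node wa aq ab; split.
    exact: (dual_norm_ge1 (pfE b) bt).
  exact: (dual_norm_ge1 (t := t) (pf_diff (end_extension aq ab))).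
have [Na0|Na] := eqVneq (N (pf a)) 0.
  exists c, [::]; split => // q b _ _ aq ab; rewrite Na0 add0r.
  have [b1 _] := pf1 _ _ aq ab; have /andP[cN _] := NC (pf b).
  by apply: le_trans cN; rewrite ler_peMr// ltW.
apply: contrapT => nex.
have /choice[G HG] : forall p : nat * seq rat, exists w : rat * set rat,
    [/\ w.1 \notin p.2, forall x, a x -> x < w.1,
      initial_segment (a `|` [set w.1]) w.2 &
      N (pf w.2) < N (pf a) + p.1.+1%:R^-1].
  move=> p; apply: contrapT => nw; apply: nex.
  exists (p.1.+1%:R^-1), p.2; split; first by rewrite invr_gt0.
  move=> q b _ qF aq ab; rewrite leNgt; apply/negP => lt; apply: nw.
  by exists (q, b).
pose L := fix L n := if n is m.+1 then (G (m, L m)).1 :: L m else [::].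
pose q n := (G (n, L n)).1; pose b n := (G (n, L n)).2.
have qL m n : (m < n)%N -> q m \in L n.
  elim: n => // n IH; rewrite ltnS leq_eqVlt => /predU1P[->|mn].
    by rewrite /= mem_head.
  by rewrite /= inE IH ?orbT.
have aq n : forall x, a x -> x < q n by have [] := HG (n, L n).
have ab n : initial_segment (a `|` [set q n]) (b n) by have [] := HG (n, L n).
have Nb n : N (pf (b n)) < N (pf a) + n.+1%:R^-1 by have [] := HG (n, L n).
have qinj m n : m <> n -> q m <> q n.
  move=> /eqP; rewrite neq_ltn => /orP[mn|nm] e.
    by have [+ _ _ _] := HG (n, L n); rewrite -/(q n) -e /= qL.
  by have [+ _ _ _] := HG (m, L m); rewrite -/(q m) e /= qL.
pose f n := pf (b n) - pf a; pose A n := Qpath (b n) `\` Qpath a.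
have fA n y : f n (toc y) = set_sum y (A n).
  exact: (pf_diff (end_extension (aq n) (ab n))).
have sA n : segment (A n) by apply: path_diff_segment; exact: Qpath_path.
have dA m n : m <> n -> A m `&` A n = set0.
  move=> /qinj /eqP; rewrite neq_lt => /orP[lt|lt].
    exact: Qpath_diff_disjoint (ab m) (ab n) (aq m) lt.
  by rewrite setIC; exact: Qpath_diff_disjoint (ab n) (ab m) (aq n) lt.
have pfbE n : pf (b n) = pf a + f n by rewrite /f addrC subrK.
have cN : N (pf (b n)) @[n --> \oo] --> N (pf a).
  apply/cvgrPdist_le => e e0.
  have low := disjoint_norm_liminf fA sA dA (pf a) equivN e0.
  have small := near_infty_natSinv_lt (PosNum e0).
  apply: filterS2 low small => n /= lown smalln.
  move: lown smalln (Nb n); rewrite -pfbE ler_norml /=.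
  by move: (n.+1%:R^-1) (N (pf (b n))) => i v ? ? ?; apply/andP; split; lra.
have Nb0 n : N (pf (b n)) != 0.
  have [b1 _] := pf1 _ _ (aq n) (ab n); have /andP[cb _] := NC (pf (b n)).
  rewrite gt_eqF//; apply: lt_le_trans cb; rewrite mulr_gt0//.
  exact: lt_le_trans b1.
have N0 g : 0 <= N g by have /andP[+ _] := NC g; apply: le_trans; rewrite mulr_ge0// ltW.
pose x n := (N (pf (b n)))^-1 *: pf (b n); pose u := (N (pf a))^-1 *: pf a.
have N1 g : N g != 0 -> N ((N g)^-1 *: g) = 1.
  by move=> g0; rewrite NZ normfV ger0_norm// mulVf.
have wx (g : dual (dual X)) : g (x n) @[n --> \oo] --> (g u : R^o).
  rewrite /u linearZ /=.
  have -> : (fun n => g (x n)) = (fun n => (N (pf (b n)))^-1 * (g (pf a) + g (f n))).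
    by apply/funext => n; rewrite /x linearZ /= -linearD -pfbE.
  rewrite -[g (pf a) in X in _ --> X]addr0.
  apply: cvgM; first exact: cvgV.
  by apply: cvgD; [exact: cvg_cst|exact: (disjoint_weak_null fA sA dA)].
have xu := kadec_cvg kadecN (N1 _ Na) (fun n => N1 _ (Nb0 n)) wx.
have bu : pf (b n) @[n --> \oo] --> pf a.
  have -> : (fun n => pf (b n)) = (fun n => N (pf (b n)) *: x n).
    by apply/funext => n; rewrite /x scalerA mulfV// scale1r.
  have -> : pf a = N (pf a) *: u by rewrite /u scalerA mulfV// scale1r.
  by apply: cvgZ.
have [n /=] : exists n, `|pf a - pf (b n)| < 1.
  by apply: (@filter_ex _ \oo); move/cvgrPdist_lt : bu => /(_ 1 ltr01).
have [_ b1] := pf1 _ _ (aq n) (ab n).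
by rewrite distrC ltNge b1.
Qed.

End no_kadec.

Theorem JT_sigmaQ_no_kadec (R : realType) :
  ~ (exists N : dual (JT R sigmaQ) -> R, equivalent_norm N /\ kadec_norm N).
Proof.
move=> [N [equivN kadecN]].
have /choice[pf pfE] : forall a : set rat, exists f : dual (JT R sigmaQ),
    forall y, f (to_completion y) = set_sum y (Qpath a).
  move=> a; have [f fE] := segment_functional (R := R) (path_segment (Qpath_path a)).
  by exists f.
have /choice[w Hw] : forall a : set rat, exists w : R * seq rat, well_ordered a ->
    0 < w.1 /\ forall q b, well_ordered b -> q \notin w.2 ->
      (forall x, a x -> x < q) -> initial_segment (a `|` [set q]) b ->
      N (pf a) + w.1 <= N (pf b).
  move=> a; have [wa|] := pselect (well_ordered a); last by exists (0, [::]).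
  by have [e [F eF]] := kadec_gap equivN kadecN pfE wa; exists (e, F).
apply: (@no_gap_function R (fun a => N (pf a)) (fun a => (w a).1) (fun a => (w a).2)).
  by move=> a wa; exact: (Hw a wa).1.
by move=> a q b wa wb; apply: (Hw a wa).2.
Qed.

Theorem mainTheorem2 (R : realType) :
  [/\ weakly_compactly_generated (JT R sigmaQ),
      ~ contains_ell1 (JT R sigmaQ),
      ~ (exists N : dual (JT R sigmaQ) -> R,
           equivalent_norm N /\ kadec_norm N) &
      exists N : dual (JT R sigmaQ) -> R,
        equivalent_norm N /\ strictly_convex_norm N].

Proof.
have [r hr] := sigmaQ_rank.
split.
- exact: JT_wcg hr.
- exact: JT_no_ell1 sigmaQ_is_tree.
- exact: JT_sigmaQ_no_kadec.
- exact: JT_dual_strictly_convex hr.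
Qed.
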